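(* Let $j=(j_t(x))_{t\in\mathbb R,\,x\in\mathcal A}$ be a quantum noise whose increments generate a von Neumann algebra $\mathcal M$ that is a factor, with shift group $\alpha=(\alpha_t)_{t\in\mathbb R}$ (a Kolmogorov flow on $\mathcal M$) and expectation $\mathbb E(\cdot)=\operatorname{Tr}(\rho\,\cdot)$. Let $w=(w_t)_{t\in\mathbb R}$ be a Markovian $\alpha$-cocycle on $\mathcal M$ such that $\mathbb E(w_t(y))=\mathbb E(y)$ for all $y\in\mathcal M$, $t\in\mathbb R$, and let $\tilde\alpha_t=w_t\circ\alpha_t$, $t\in\mathbb R$, be the perturbed group of automorphisms of $\mathcal M$. Then there exists a subfactor $\tilde{\mathcal M}\subset\mathcal M$ such that the restriction $\tilde\alpha|_{\tilde{\mathcal M}}$ is the Kolmogorov flow generated by a quantum noise $\tilde j$ isomorphic to $j$. The limit $\lim_{t\to+\infty}w_{-t}=w_{-\infty}$ (pointwise on $\mathcal M$, in the strong operator topology) exists and defines a normal $*$-endomorphism $w_{-\infty}$ of $\mathcal M$ with $$\tilde{\mathcal M}=w_{-\infty}(\mathcal M),\qquad \tilde j_t=w_{-\infty}\circ j_t,\quad t\in\mathbb R.$$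
   Context: Quantum noise. Let $\mathcal A$ be a Lie algebra with involution. A quantum noise is a family $j=(j_t)_{t\in\mathbb R}$ of maps from $\mathcal A$ to linear (possibly unbounded) operators in a Hilbert space $\mathcal H$, $j_0(x)=0$, strongly continuous in $t$, such that $j_t$ is linear, involution-preserving and, for $t\ge0$, preserves commutators, together with: (a) an ultraweakly continuous group of $*$-automorphisms $\alpha=(\alpha_t)_{t\in\mathbb R}$ of $B(\mathcal H)$, whose action is correctly defined on the operators $j_s(x)$, with $j_{t+s}(x)=j_t(x)+\alpha_t(j_s(x))$ for all $s,t$ and $x\in\mathcal A$; (b) a state $\rho\ge0$, $\operatorname{Tr}\rho=1$, with expectation $\mathbb E(y)=\operatorname{Tr}(\rho y)$ invariant under $\alpha$; (c) independence of increments: increments $j_{t_1}(x_1)-j_{s_1}(x_1)$ and $j_{t_2}(x_2)-j_{s_2}(x_2)$ over disjoint intervals $(s_1,t_1),(s_2,t_2)$ commute (in the sense that the von Neumann algebras they generate commute), and expectations of products of bounded functions of increments over pairwise disjoint intervals factorize into the product of expectations. $\mathcal M$ is the von Neumann algebra generated by all $j_t(x)$; $\mathcal M_{t]}$ and $\mathcal M_{[t}$ are the von Neumann algebras generated by the increments $j_t(x)-j_r(x)$, $r\le t$, and $j_r(x)-j_t(x)$, $r\ge t$, respectively ($x\in\mathcal A$). $\mathcal M$ is assumed in standard (GNS) form with respect to $\rho$: there is a map $x\mapsto[x]$ from $\mathcal M$ onto a dense subset of $\mathcal H$ with inner product $([x],[y])=\mathbb E(y^*x)$. One has $\alpha_t(\mathcal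 M)=\mathcal M$. A Markovian $\alpha$-cocycle is a family $w=(w_t)_{t\in\mathbb R}$ of $*$-automorphisms of $\mathcal M$ (with ultraweakly continuous dependence on $t$, and with action correctly defined on the operators $j_s(x)$) such that $w_0=\mathrm{Id}$, $w_{s+t}=w_s\circ\alpha_s\circ w_t\circ\alpha_{-s}$ for all $s,t\in\mathbb R$, and $w_t(x)=x$ for $x\in\mathcal M_{[t}$, $t\ge0$. A group of automorphisms $\beta=(\beta_t)$ of a von Neumann algebra $\mathcal N$ is a Kolmogorov flow if there is a von Neumann subalgebra $\mathcal N_{0]}\subset\mathcal N$ such that, with $\mathcal N_{t]}=\beta_t(\mathcal N_{0]})$: $\mathcal N_{s]}\subset\mathcal N_{t]}$ for $s<t$; $\bigcup_t\mathcal N_{t]}$ generates $\mathcal N$; $\bigcap_t\mathcal N_{t]}=\mathbb C\mathbf 1$. It is generated by a quantum noise $\tilde j$ if $\mathcal N$ and $\mathcal N_{0]}$ are generated by the increments of $\tilde j$, respectively by its increments up to time $0$, and $\tilde j_{t+s}=\tilde j_t+\beta_t\circ\tilde j_s$. Two quantum noises $j,\tilde j$ over the same $\mathcal A$ are isomorphic if the operators $\tilde j_t(x)$ satisfy the same algebraic relations and have the same expectations as the $j_t(x)$, i.e. there is a $*$-isomorphism of the generated von Neumann algebras carrying $j_t(x)$ to $\tilde j_t(x)$ and preserving $\mathbb E$. *)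

(* Defs.v *)
From HB Require Import structures.
From mathcomp Require Import all_boot all_order all_algebra.
From mathcomp Require Import complex.
From mathcomp Require Import all_classical all_reals all_analysis.

Set Implicit Arguments.
Unset Strict Implicit.
Unset Printing Implicit Defensive.

Import Order.TTheory GRing.Theory Num.Theory numFieldNormedType.Exports.

Local Open Scope classical_set_scope.
Local Open Scope ring_scope.

(* Naming the structure lets the generic topology of a numFieldType apply;
   it is not inferred from the bare type R[i]. *)
Definition Cx (R : realType) : numClosedFieldType := R[i]%C.

Record lie_star_algebra (R : realType) (A : lmodType (Cx R))
    (br : A -> A -> A) (star : A -> A) : Prop := LieStarAlgebra {
  br_linearl : forall a x y z, br (a *: x + y) z = a *: br x z + br y z ;
  br_linearr : forall a x y z, br z (a *: x + y) = a *: br z x + br z y ;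
  br_alternating : forall x, br x x = 0 ;
  br_jacobi : forall x y z, br x (br y z) + br y (br z x) + br z (br x y) = 0 ;
  star_antilinear : forall a x y, star (a *: x + y) = a^* *: star x + star y ;
  star_involutive : involutive star ;
  star_br : forall x y, star (br x y) = br (star y) (star x) }.

Section HilbertSpace.

(* [ip] is linear in its first argument.  H is a Hilbert space once [ip] is
   known to induce its norm; that hypothesis is stated with the theorem. *)
Variables (R : realType) (H : completeNormedModType (Cx R)).
Variable ip : {dot H for Num.conj}.

Local Notation op := (H -> H).

(** Bounded operators and von Neumann algebras *)

Definition bounded_ops : set op := [set T | linear T /\ continuous T].

Definition adjoint (T S : op) : Prop := forall x y, ip (T x) y = ip x (S y).

Definition commutant (N : set op) : set op :=
  [set B | bounded_ops B /\ forall T, N T -> B \o T = T \o B].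

Definition scalars : set op := [set T | exists c : Cx R, T = fun x => c *: x].

Record von_neumann (N : set op) : Prop := VonNeumann {
  vn_bounded : N `<=` bounded_ops ;
  vn_star : forall T S, N T -> adjoint T S -> N S ;
  vn_bicommutant : commutant (commutant N) = N }.

Definition vn_factor (N : set op) : Prop :=
  von_neumann N /\ N `&` commutant N = scalars.

Record star_hom (N N' : set op) (theta : op -> op) : Prop := StarHom {
  sh_maps : forall T, N T -> N' (theta T) ;
  sh_one : theta idfun = idfun ;
  sh_linear : forall (a : Cx R) S T, N S -> N T ->
    theta (fun x => a *: S x + T x) = fun x => a *: theta S x + theta T x ;
  sh_mul : forall S T, N S -> N T -> theta (S \o T) = theta S \o theta T ;
  sh_star : forall S T, N S -> N T -> adjoint S T ->
    adjoint (theta S) (theta T) }.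

Definition star_iso (N N' : set op) (theta : op -> op) : Prop :=
  star_hom N N' theta /\ set_bij N N' theta.

(** Ultraweak topology *)

Definition square_summable (xi : nat -> H) : Prop :=
  cvgn (series (fun n => `|xi n| ^+ 2)).

Definition uw_functional (xi eta : nat -> H) (T : op) : Cx R :=
  limn (series (fun n => ip (T (xi n)) (eta n))).

Definition uw_cvg (F : set_system op) (T : op) : Prop :=
  forall xi eta, square_summable xi -> square_summable eta ->
    uw_functional xi eta @ F --> uw_functional xi eta T.

Definition normal_map (N : set op) (theta : op -> op) : Prop :=
  forall F : set_system op, ProperFilter F -> F N ->
  forall T, N T -> uw_cvg F T -> uw_cvg (theta @ F) (theta T).

Definition uw_continuous (N : set op) (beta : R -> op -> op) : Prop :=
  forall T, N T -> forall t : R, uw_cvg (beta s T @[s --> t]) (beta t T).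

Record aut_group (N : set op) (beta : R -> op -> op) : Prop := AutGroup {
  ag_aut : forall t, star_iso N N (beta t) ;
  ag_id : forall T, N T -> beta 0 T = T ;
  ag_add : forall s t T, N T -> beta (s + t) T = beta s (beta t T) }.

(** Trace and states *)

Definition orthonormal_basis (B : set H) : Prop :=
  (forall e f, B e -> B f -> ip e f = (e == f)%:R) /\
  (forall x, (forall e, B e -> ip x e = 0) -> x = 0).

Definition finite_subsets_filter (B : set H) : set_system (set H) :=
  filter_from (fsets B) (fun F0 => [set F | fsets B F /\ F0 `<=` F]).

Definition has_trace (T : op) (c : Cx R) : Prop :=
  forall B, orthonormal_basis B ->
    (fun F : set H => \sum_(e \in F) ip (T e) e) @ finite_subsets_filter B
      --> c.

Definition tr (T : op) : Cx R := xget 0 (has_trace T).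

Definition density (rho : op) : Prop :=
  [/\ bounded_ops rho, forall x, 0 <= ip (rho x) x & has_trace rho 1].

Definition expect (rho y : op) : Cx R := tr (rho \o y).

(** Unbounded operators, represented by their graphs *)

Local Notation uop := (set (H * H)%type).

Definition graph (T : op) : uop := [set p | p.2 = T p.1].

Definition dom (G : uop) : set H := [set x | exists y, G (x, y)].

Definition subspace (D : set H) : Prop :=
  D 0 /\ forall (a : Cx R) x y, D x -> D y -> D (a *: x + y).

(* closed, densely defined *)
Record closed_op (G : uop) : Prop := ClosedOp {
  co_zero : G 0 ;
  co_linear : forall (a : Cx R) p q, G p -> G q -> G (a *: p + q) ;
  co_univalent : forall y, G (0, y) -> y = 0 ;
  co_dense : dense (dom G) ;
  co_closed : closed G }.

Definition op_zero : uop := [set p | p.2 = 0].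

Definition op_adj (G : uop) : uop :=
  [set p | forall q, G q -> ip q.2 p.1 = ip q.1 p.2].

(* Algebraic operations are closures of the operations on the natural
   domains. *)
Definition op_scale (a : Cx R) (G : uop) : uop :=
  closure [set p | exists2 u, G (p.1, u) & p.2 = a *: u].

Definition op_add (G1 G2 : uop) : uop :=
  closure [set p | exists u v, [/\ G1 (p.1, u), G2 (p.1, v) & p.2 = u + v]].

Definition op_sub (G1 G2 : uop) : uop := op_add G1 (op_scale (-1) G2).

Definition op_comm (G1 G2 : uop) : uop :=
  closure [set p | exists u u' v v', [/\ G2 (p.1, u), G1 (u, u'),
    G1 (p.1, v), G2 (v, v') & p.2 = u' - v']].

Definition core (G : uop) (D : set H) : Prop :=
  D `<=` dom G /\ closure (G `&` (D `*` setT)) = G.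

Definition commutes_with (B : op) (G : uop) : Prop :=
  forall p, G p -> G (B p.1, B p.2).

(* The von Neumann algebra generated by a set of closed operators: the
   commutant of the bounded operators commuting with each of them and with
   its adjoint. *)
Definition vN_gen (S : set uop) : set op :=
  commutant [set B | bounded_ops B /\
    forall G, S G -> commutes_with B G /\ commutes_with B (op_adj G)].

(* (a x, b x) is the orthogonal projection of (x, 0) on the graph G of T, that
   is, a = (1 + T^* T)^-1 and b = T (1 + T^* T)^-1.  The pair determines a
   closed T, and consists of elements of any von Neumann algebra to which T is
   affiliated. *)
Definition char_pair (G : uop) (a b : op) : Prop :=
  [/\ bounded_ops a, bounded_ops b &
    forall x, G (a x, b x) /\
      forall p, G p -> ip (x - a x) p.1 + ip (- b x) p.2 = 0].

(* G' is the image of the closed operator G, affiliated to N, under the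
   *-homomorphism theta defined on N. *)
Definition op_image (N : set op) (theta : op -> op) (G G' : uop) : Prop :=
  closed_op G' /\ exists a b, [/\ N a, N b, char_pair G a b &
    char_pair G' (theta a) (theta b)].

(** Quantum noises *)

Section Noise.

Variables (A : lmodType (Cx R)) (br : A -> A -> A) (star : A -> A).

Local Notation noise := (R -> A -> uop).

Definition incr (j : noise) (s t : R) (x : A) : uop := op_sub (j t x) (j s x).

Definition incr_alg (j : noise) (s t : R) : set op :=
  vN_gen [set incr j s t x | x in setT].

Definition all_incr_alg (j : noise) : set op :=
  vN_gen [set G | exists s t x, G = incr j s t x].

Definition noise_alg (j : noise) : set op :=
  vN_gen [set G | exists t x, G = j t x].

Definition past_alg (j : noise) (t : R) : set op :=
  vN_gen [set G | exists r x, r <= t /\ G = incr j r t x].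

Definition future_alg (j : noise) (t : R) : set op :=
  vN_gen [set G | exists r x, t <= r /\ G = incr j t r x].

(* j_(t+s) = j_t + beta_t o j_s *)
Definition shift_relation (N : set op) (beta : R -> op -> op) (j : noise)
    : Prop :=
  forall s t x, exists2 G, op_image N (beta t) (j s x) G &
    j (t + s) x = op_add (j t x) G.

(* Identities between closures of sums do not behave like identities unless
   the operators involved share a core; the j_t(x) are therefore taken to have
   a common dense domain, invariant under all of them. *)
Definition common_domain (alpha : R -> op -> op) (j : noise) (D : set H)
    : Prop :=
  [/\ subspace D, dense D,
      forall t x, core (j t x) D /\ (forall p, j t x p -> D p.1 -> D p.2),
      forall s t x G, op_image bounded_ops (alpha t) (j s x) G -> core G D &
      forall x xi (f : R -> H), D xi -> (forall t, j t x (xi, f t)) ->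
        continuous f].

Definition disjoint_intervals (s1 t1 s2 t2 : R) : Prop :=
  `]s1, t1[ `&` `]s2, t2[ = set0.

Record quantum_noise (j : noise) (alpha : R -> op -> op) (rho : op)
    : Prop := QuantumNoise {
  qn_closed : forall t x, closed_op (j t x) ;
  qn_domain : exists D, common_domain alpha j D ;
  qn_zero : forall x, j 0 x = op_zero ;
  qn_linear : forall t a x y,
    j t (a *: x + y) = op_add (op_scale a (j t x)) (j t y) ;
  qn_star : forall t x, j t (star x) = op_adj (j t x) ;
  qn_br : forall t x y, 0 <= t -> j t (br x y) = op_comm (j t x) (j t y) ;
  qn_group : aut_group bounded_ops alpha ;
  qn_group_continuous : uw_continuous bounded_ops alpha ;
  qn_shift : shift_relation bounded_ops alpha j ;
  qn_state : density rho ;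
  qn_invariant : forall t y, bounded_ops y ->
    expect rho (alpha t y) = expect rho y ;
  qn_commute : forall s1 t1 s2 t2 x1 x2 y1 y2, s1 < t1 -> s2 < t2 ->
    disjoint_intervals s1 t1 s2 t2 ->
    vN_gen [set incr j s1 t1 x1] y1 -> vN_gen [set incr j s2 t2 x2] y2 ->
    y1 \o y2 = y2 \o y1 ;
  qn_independent : forall n (s t : 'I_n -> R) (y : 'I_n -> op),
    (forall i, s i < t i) ->
    (forall i k, i != k -> disjoint_intervals (s i) (t i) (s k) (t k)) ->
    (forall i, incr_alg j (s i) (t i) (y i)) ->
    expect rho (\big[comp/idfun]_(i < n) y i) =
      \prod_(i < n) expect rho (y i) }.

Definition noise_iso (j : noise) (rho : op) (j' : noise) (rho' : op) : Prop :=
  exists theta, [/\ star_iso (noise_alg j) (noise_alg j') theta,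
    forall t x, op_image (noise_alg j) theta (j t x) (j' t x) &
    forall y, noise_alg j y -> expect rho' (theta y) = expect rho y].

(* M acts on H by its GNS representation: x |-> [x] maps M onto a dense subset
   of H, ([x], [y]) = E(y^* x) and x [y] = [x y].  Injectivity says that this
   is an inner product on M, i.e. that E is faithful on M. *)
Record standard_form (M : set op) (rho : op) (cls : op -> H) : Prop :=
  StandardForm {
  sf_linear : forall (a : Cx R) S T, M S -> M T ->
    cls (fun x => a *: S x + T x) = a *: cls S + cls T ;
  sf_dense : dense (cls @` M) ;
  sf_ip : forall x y y', M x -> M y -> adjoint y y' ->
    ip (cls x) (cls y) = expect rho (y' \o x) ;
  sf_act : forall x y, M x -> M y -> x (cls y) = cls (x \o y) ;
  sf_inj : set_inj M cls }.

Record kolmogorov_past (N : set op) (beta : R -> op -> op) (N0 : set op)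
    : Prop := KolmogorovPast {
  kp_vn : von_neumann N0 ;
  kp_sub : N0 `<=` N ;
  kp_mono : forall s t, s < t -> beta s @` N0 `<=` beta t @` N0 ;
  kp_gen : N = vN_gen (graph @` \bigcup_t (beta t @` N0)) ;
  kp_trivial : \bigcap_t (beta t @` N0) = scalars }.

Definition kolmogorov_flow (N : set op) (beta : R -> op -> op) : Prop :=
  [/\ von_neumann N, aut_group N beta & exists N0, kolmogorov_past N beta N0].

Definition kolmogorov_flow_generated_by (N : set op) (beta : R -> op -> op)
    (j : noise) : Prop :=
  [/\ kolmogorov_flow N beta, kolmogorov_past N beta (past_alg j 0),
      N = all_incr_alg j & shift_relation N beta j].

Record markovian_cocycle (M : set op) (j : noise) (alpha w : R -> op -> op)
    : Prop := MarkovianCocycle {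
  mc_aut : forall t, star_iso M M (w t) ;
  mc_continuous : uw_continuous M w ;
  mc_action : forall t s x, exists G, op_image M (w t) (j s x) G ;
  mc_id : forall y, M y -> w 0 y = y ;
  mc_cocycle : forall s t y, M y ->
    w (s + t) y = w s (alpha s (w t (alpha (- s) y))) ;
  mc_markov : forall t y, 0 <= t -> future_alg j t y -> w t y = y }.

End Noise.

End HilbertSpace.

(* Main.v *)
(* The cocycle identity gives w_(-s-r) = w_(-s) o alpha_(-s) o w_(-r) o alpha_s,
   and w_(-r) fixes the future M_[0, so t |-> w_(-t) y is eventually constant
   for y in any future M_[s.  Since E is invariant, w_t is implemented on the
   GNS space, with cyclic vector Om = [1], by a unitary W_t fixing Om; as the
   vectors y Om with y in some M_[s are dense, W_(-t) converges strongly to an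
   isometry W.  From w_(-t)(y) z Om = z W_(-t) y Om for z in M' it follows that
   w_(-t)(y) converges strongly on M' Om, hence everywhere.

   The operators z W with z in M' intertwine y with winf(y) and their ranges
   span a dense subspace.  This makes winf an injective *-homomorphism, and it carries
   closed operators affiliated to M, their algebraic operations and the von
   Neumann algebras they generate over to the image.  For normality, h = |z W|
   commutes with M, and by polar decomposition <winf(y) z Om, eta> = <y h Om, e>
   for a vector e independent of y.  The cocycle identity also gives
   winf o alpha_t = w_t o alpha_t o winf on M.  The perturbed group is
   implemented by the unitaries W_t U_t, with U_t implementing alpha_t, and the
   state of the new noise is the vector state of Om. *)

Require Import Defs.
From HB Require Import structures.
From mathcomp Require Import all_boot all_order all_algebra.
From mathcomp Require Import complex.
From mathcomp Require Import all_classical all_reals all_analysis.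
From mathcomp Require Import lra ring.

Set Implicit Arguments.
Unset Strict Implicit.
Unset Printing Implicit Defensive.

Import Order.TTheory GRing.Theory Num.Theory numFieldNormedType.Exports.

Local Open Scope classical_set_scope.
Local Open Scope ring_scope.

(** * Norms and inner products *)

(** Two obstacles shape the proof. The noise operators are unbounded, and the limit isometry alone
    cannot carry them over, since its range need not be dense. The homomorphism is therefore
    recorded by a whole family of intertwining operators with total ranges, and the image of a graph
    consists of the pairs that all their adjoints send back into it; an induction principle
    ([push_ind]) then replaces domain computations. A closed operator enters only through its graph
    and through the projection of [(x, 0)] on it, whose two components are bounded and can be mapped
    by a homomorphism. Next, [j_t - j_s] is defined as a closure, and identifying it with
    [alpha_s(j_(t-s))] is not formal: the common core gives one inclusion, the same identity for the
    adjoints gives the other. Finally, the cocycle acts and preserves the state on [M] only, whereas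
    a quantum noise comes with a group and a density on the whole Hilbert space. Conjugation by
    unitaries extends the perturbed group, but [rho] need not be invariant under the extension,
    which is why a vector state replaces it. *)

Definition nr (R : realType) (V : normedZmodType (Cx R)) (x : V) : R :=
  complex.Re `|x|.

(** The norm of a module over [Cx R] has values in [Cx R]. [nr] extracts the real number and [rc]
    embeds it back, so that estimates take place in the ordered field [R]. *)
Definition rc (R : realType) (x : R) : Cx R := real_complex R x.

Section RealNorm.
Variables (R : realType).
Local Notation C := (Cx R).
Local Notation rc := (@rc R).

Lemma rc_inj : injective rc.
Proof. exact: (@complexI R). Qed.
Lemma rcD x y : rc (x + y) = rc x + rc y.
Proof. exact: (rmorphD (real_complex R)). Qed.
Lemma rcB x y : rc (x - y) = rc x - rc y.
Proof. exact: (rmorphB (real_complex R)). Qed.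
Lemma rcM x y : rc (x * y) = rc x * rc y.
Proof. exact: (rmorphM (real_complex R)). Qed.
Lemma rcX x n : rc (x ^+ n) = rc x ^+ n.
Proof. exact: (rmorphXn (real_complex R)). Qed.
Lemma rc0 : rc 0 = 0.
Proof. by []. Qed.
Lemma rc1 : rc 1 = 1.
Proof. by []. Qed.
Lemma rc_nat n : rc n%:R = n%:R.
Proof. exact: (rmorph_nat (real_complex R)). Qed.
Lemma rc_conj x : (rc x)^* = rc x.
Proof. exact: conjc_real. Qed.
Lemma Re_rc x : complex.Re (rc x) = x.
Proof. by []. Qed.
Lemma rc_Re (z : C) : 0 <= z -> rc (complex.Re z) = z.
Proof. by move=> z0; apply: RRe_real; apply: ger0_real. Qed.
Lemma rc_sum (I : Type) (r : seq I) (P : pred I) (F : I -> R) :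
  rc (\sum_(i <- r | P i) F i) = \sum_(i <- r | P i) rc (F i).
Proof. exact: (rmorph_sum (real_complex R)). Qed.

Lemma nrE (V : normedZmodType C) (x : V) : `|x| = rc (nr x).
Proof. by rewrite /nr rc_Re. Qed.

Lemma rc_ler (x y : R) : (rc x <= rc y) = (x <= y).
Proof. exact: lecR. Qed.

Lemma rc_ltr (x y : R) : (rc x < rc y) = (x < y).
Proof. exact: ltcR. Qed.

Lemma nr_ge0 (V : normedZmodType C) (x : V) : 0 <= nr x.
Proof. by rewrite -rc_ler -nrE normr_ge0. Qed.

Lemma nrD (V : normedZmodType C) (x y : V) : nr (x + y) <= nr x + nr y.
Proof. by rewrite -rc_ler rcD -!nrE ler_normD. Qed.

Lemma nrN (V : normedZmodType C) (x : V) : nr (- x) = nr x.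
Proof. by rewrite /nr normrN. Qed.

Lemma nrB (V : normedZmodType C) (x y : V) : nr (x - y) = nr (y - x).
Proof. by rewrite -nrN opprB. Qed.

Lemma nr0 (V : normedZmodType C) : nr (0 : V) = 0.
Proof. by rewrite /nr normr0. Qed.

Lemma nr_eq0 (V : normedZmodType C) (x : V) : nr x = 0 -> x = 0.
Proof. by move=> h; apply/normr0_eq0; rewrite nrE h. Qed.

Lemma nr_tri (V : normedZmodType C) (z x y : V) : nr (x - y) <= nr (x - z) + nr (z - y).
Proof. by have := nrD (x - z) (z - y); rewrite addrA subrK. Qed.

Lemma nrZ (V : normedModType C) (a : C) (x : V) : nr (a *: x) = nr a * nr x.
Proof. by apply: rc_inj; rewrite rcM -!nrE normrZ. Qed.

Lemma nrM (a b : C) : nr (a * b) = nr a * nr b.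
Proof. by apply: rc_inj; rewrite rcM -!nrE normrM. Qed.

Lemma nr_rc (a : R) : nr (rc a) = `|a|.
Proof. by rewrite /nr normc_def/= expr0n/= addr0 sqrtr_sqr. Qed.

Lemma nr_sum (V : normedZmodType C) (I : Type) (r : seq I) (P : pred I) (F : I -> V) :
  nr (\sum_(i <- r | P i) F i) <= \sum_(i <- r | P i) nr (F i).
Proof.
elim/big_ind2: _ => //; first by rewrite nr0.
by move=> a b c d ab cd; apply: le_trans (nrD _ _) _; apply: lerD.
Qed.

(** A positive element of [Cx R] is real, so real radii suffice. *)
Lemma nr_cvgP (V : pseudoMetricNormedZmodType C) T (F : set_system T)
    {FF : Filter F} (f : T -> V) (l : V) :
  f @ F --> l <-> forall e : R, 0 < e -> \forall x \near F, nr (l - f x) < e.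
Proof.
split=> [/cvgrPdist_lt h e e0|h].
  by near do rewrite -rc_ltr -nrE; apply: h; rewrite (rc_ltr 0).
apply/cvgrPdist_lt => e e0.
have eR : e = rc (complex.Re e) by rewrite rc_Re// ltW.
have e0' : 0 < complex.Re e by rewrite -(rc_ltr 0) -eR.
by near do rewrite eR nrE rc_ltr; apply: h.
Unshelve. all: by end_near. Qed.

Lemma nr_nbhs (V : pseudoMetricNormedZmodType C) (x : V) (A : set V) :
  nbhs x A <-> exists2 e : R, 0 < e & forall y, nr (x - y) < e -> A y.
Proof.
split.
  move=> /nbhs_normP [e/= e0 he].
  have eR : e = rc (complex.Re e) by rewrite rc_Re// ltW.
  exists (complex.Re e); first by rewrite -(rc_ltr 0) -eR.
  by move=> y hy; apply: he; rewrite /ball_ /= nrE eR rc_ltr.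
move=> [e e0 h]; apply/nbhs_normP; exists (rc e) => /=; first by rewrite (rc_ltr 0).
by move=> y /=; rewrite nrE rc_ltr; apply: h.
Qed.

Lemma nr_lim0 (V : normedZmodType C) (x : V) :
  (forall e : R, 0 < e -> nr x <= e) -> x = 0.
Proof.
move=> h; apply: nr_eq0; apply/eqP; rewrite eq_le nr_ge0 andbT.
by apply/ler_addgt0Pl => e e0; rewrite addr0; apply: h.
Qed.

Lemma nr_closureP (V : pseudoMetricNormedZmodType C) (A : set V) (x : V) :
  closure A x <-> forall e : R, 0 < e -> exists2 y, A y & nr (x - y) < e.
Proof.
split=> [h e e0|h B /nr_nbhs[e e0 he]].
  have /h [y [Ay hy]] : nbhs x [set y | nr (x - y) < e] by apply/nr_nbhs; exists e.
  by exists y.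
by have [y Ay hy] := h e e0; exists y; split => //; exact: he.
Qed.

Lemma nr_closure2P (V W : pseudoMetricNormedZmodType C) (A : set (V * W)) p :
  closure A p <-> forall e : R, 0 < e ->
    exists q, [/\ A q, nr (p.1 - q.1) < e & nr (p.2 - q.2) < e].
Proof.
split=> [h e e0|h B [[B1 B2]/= [/nr_nbhs[e1 e10 he1] /nr_nbhs[e2 e20 he2]] hB]].
  have /h [q [Aq [h1 h2]]] : nbhs p ([set y | nr (p.1 - y) < e] `*` [set y | nr (p.2 - y) < e]).
    exists ([set y | nr (p.1 - y) < e], [set y | nr (p.2 - y) < e]) => //=.
    by split; apply/nr_nbhs; exists e.
  by exists q.
have e0 : 0 < Num.min e1 e2 by rewrite lt_min e10.
have [q [Aq]] := h _ e0; rewrite !lt_min => /andP[a1 _] /andP[_ a2].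
by exists q; split => //; apply: hB; split; [exact: he1|exact: he2].
Qed.

Lemma nr_denseP (V : pseudoMetricNormedZmodType C) (A : set V) :
  dense A <-> forall x (e : R), 0 < e -> exists2 y, A y & nr (x - y) < e.
Proof.
split=> [h x e e0|h O [x Ox] oO].
  have o : open (ball x (rc e)) by apply: ball_open; rewrite (rc_ltr 0).
  have [|y [hy Ay]] := h _ _ o; first by exists x; apply: ballxx; rewrite (rc_ltr 0).
  by exists y => //; move: hy; rewrite -ball_normE /= nrE rc_ltr.
have /nr_nbhs [e e0 he] : nbhs x O by rewrite nbhsE; exists O.
by have [y Ay hy] := h x e e0; exists y; split => //; exact: he.
Qed.

End RealNorm.

Section InnerProduct.
Variables (R : realType) (H : completeNormedModType (Cx R)).
Variable ip : {dot H for Num.conj}.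
Local Notation C := (Cx R).
Local Notation rc := (@rc R).
Hypothesis ip_norm : forall x : H, ip x x = `|x| ^+ 2.

Lemma ipDl x y z : ip (x + y) z = ip x z + ip y z.
Proof. exact: linearDl. Qed.
Lemma ipDr x y z : ip x (y + z) = ip x y + ip x z.
Proof. exact: linearDr. Qed.
Lemma ipNl x y : ip (- x) y = - ip x y.
Proof. exact: linearNl. Qed.
Lemma ipNr x y : ip x (- y) = - ip x y.
Proof. exact: linearNr. Qed.
Lemma ipBl x y z : ip (x - y) z = ip x z - ip y z.
Proof. by rewrite ipDl ipNl. Qed.
Lemma ipBr x y z : ip x (y - z) = ip x y - ip x z.
Proof. by rewrite ipDr ipNr. Qed.
Lemma ipZl a x y : ip (a *: x) y = a * ip x y.
Proof. exact: linearZl_LR. Qed.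
Lemma ipZr a x y : ip x (a *: y) = a^* * ip x y.
Proof. exact: linearZr_LR. Qed.
Lemma ip0l x : ip 0 x = 0.
Proof. exact: linear0l. Qed.
Lemma ip0r x : ip x 0 = 0.
Proof. exact: linear0r. Qed.
Lemma ipC x y : ip x y = (ip y x)^*.
Proof. by rewrite hermC expr0 mul1r. Qed.

Lemma ip_nr x : ip x x = rc (nr x ^+ 2).
Proof. by rewrite ip_norm nrE rcX. Qed.

Lemma ip_eq0 x : (forall y, ip x y = 0) -> x = 0.
Proof.
move=> /(_ x); rewrite ip_nr => /rc_inj /eqP.
by rewrite sqrf_eq0 => /eqP /nr_eq0.
Qed.

Lemma ip_inj x y : (forall z, ip x z = ip y z) -> x = y.
Proof. by move=> h; apply/subr0_eq/ip_eq0 => z; rewrite ipBl h subrr. Qed.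

Lemma ip_injr x y : (forall z, ip z x = ip z y) -> x = y.
Proof. by move=> h; apply: ip_inj => z; rewrite ipC h -ipC. Qed.

Lemma nr2_norm (a : C) : rc (nr a ^+ 2) = a * a^*.
Proof. by rewrite rcX -nrE normCK. Qed.

Lemma nr2D x y : nr (x + y) ^+ 2 = nr x ^+ 2 + nr y ^+ 2 + 2 * complex.Re (ip x y).
Proof.
have E : ip x y + ip y x = rc (2 * complex.Re (ip x y)).
  by rewrite [ip y x]ipC rcM rc_nat; exact/addcJ.
apply: rc_inj; rewrite -ip_nr ipDl !ipDr !ip_nr !rcD -E.
by rewrite -!addrA; congr (_ + _); rewrite [RHS]addrC -addrA.
Qed.

(* the graph inner product on H * H, whose product topology carries the sup norm *)
Definition gip (p q : H * H) : C := ip p.1 q.1 + ip p.2 q.2.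
Local Notation ip2 := gip.
Definition nr2 (p : H * H) : R := nr p.1 ^+ 2 + nr p.2 ^+ 2.

Lemma ip2C p q : ip2 p q = (ip2 q p)^*.
Proof. by rewrite /gip rmorphD/= -!ipC. Qed.
Lemma ip2Dl p q r : ip2 (p + q) r = ip2 p r + ip2 q r.
Proof. by rewrite /gip /= !ipDl addrACA. Qed.
Lemma ip2Zl a p r : ip2 (a *: p) r = a * ip2 p r.
Proof. by rewrite /gip /= !ipZl mulrDr. Qed.
Lemma ip2Nl p r : ip2 (- p) r = - ip2 p r.
Proof. by rewrite -scaleN1r ip2Zl mulN1r. Qed.
Lemma ip2Bl p q r : ip2 (p - q) r = ip2 p r - ip2 q r.
Proof. by rewrite ip2Dl ip2Nl. Qed.
Lemma ip2_nr p : ip2 p p = rc (nr2 p).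
Proof. by rewrite /gip !ip_nr -rcD. Qed.
Lemma nr2_ge0 p : 0 <= nr2 p.
Proof. by rewrite addr_ge0 ?sqr_ge0. Qed.
Lemma ip2_eq0 p : ip2 p p = 0 -> p = 0.
Proof.
rewrite ip2_nr => /rc_inj/eqP; rewrite paddr_eq0 ?sqr_ge0// !sqrf_eq0.
by case: p => x y /= /andP[/eqP/nr_eq0-> /eqP/nr_eq0->].
Qed.

Lemma nr2BZ p q a :
  nr2 (p - a *: q) = nr2 p + nr a ^+ 2 * nr2 q - 2 * complex.Re (a^* * ip2 p q).
Proof.
rewrite /nr2 /gip /= !nr2D !nrN !nrZ !ipNr !ipZr !raddfN/= !mulrDr raddfD/=.
by ring.
Qed.

Lemma nr2_parallelogram p q : nr2 (p + q) + nr2 (p - q) = 2 * nr2 p + 2 * nr2 q.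
Proof.
rewrite /nr2 /= !nr2D !nrN !ipNr !raddfN/=; by ring.
Qed.

Lemma cauchy_schwarz2 p q : nr (ip2 p q) ^+ 2 <= nr2 p * nr2 q.
Proof.
have [q0|q0] := eqVneq (nr2 q) 0.
  have -> : q = 0 by apply: ip2_eq0; rewrite ip2_nr q0.
  by rewrite /gip /= !ip0r addr0 nr0 expr0n mulr_ge0 ?nr2_ge0.
have q1 : 0 < nr2 q by rewrite lt_neqAle eq_sym q0 nr2_ge0.
pose a := rc (nr2 q)^-1 * ip2 p q.
have := nr2_ge0 (p - a *: q); rewrite nr2BZ.
have -> : complex.Re (a^* * ip2 p q) = (nr2 q)^-1 * nr (ip2 p q) ^+ 2.
  rewrite /a rmorphM/= rc_conj -mulrA [_^* * _]mulrC -nr2_norm -rcM.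
  exact: Re_rc.
rewrite nrM nr_rc exprMn ger0_norm ?invr_ge0 ?nr2_ge0// => h.
have := mulr_ge0 h (ltW q1); rewrite -[_ <= nr2 p * _]subr_ge0 => /le_trans; apply.
rewrite le_eqVlt; apply/orP; left.
by apply/eqP; field.
Qed.

Lemma cauchy_schwarz x y : nr (ip x y) <= nr x * nr y.
Proof.
rewrite -ler_sqr ?nnegrE ?mulr_ge0 ?nr_ge0// exprMn.
have := cauchy_schwarz2 (x, 0) (y, 0).
by rewrite /gip /nr2 /= ip0l !nr0 expr0n/= !addr0.
Qed.

Lemma ip2_lipschitz p q z (e : R) : nr (p.1 - q.1) < e -> nr (p.2 - q.2) < e ->
  nr (ip2 p z - ip2 q z) <= e * (nr z.1 + nr z.2).
Proof.
move=> h1 h2; rewrite -ip2Bl /gip mulrDr; apply: le_trans (nrD _ _) _.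
by apply: lerD; apply: le_trans (cauchy_schwarz _ _) _;
  apply: ler_wpM2r; rewrite ?nr_ge0 ?ltW.
Qed.

End InnerProduct.

(** * Closed subspaces and generated von Neumann algebras *)

Lemma nr_cauchy_cvg (R : realType) (V : completeNormedModType (Cx R)) (u : nat -> V) :
  (forall e : R, 0 < e -> exists N, forall m n, (N <= m)%N -> (N <= n)%N ->
     nr (u m - u n) < e) -> exists l : V, u n @[n --> \oo] --> l.
Proof.
move=> h; suff hu : cvgn u by exists (limn u).
apply/cauchy_cvgP/cauchy_exP => e e0.
have eR : e = rc (complex.Re e) by rewrite rc_Re// ltW.
have e0' : 0 < complex.Re e by rewrite -(rc_ltr 0) -eR.
have [N hN] := h _ e0'; exists (u N); exists N => // n /= Nn.
by rewrite -ball_normE /= nrE eR rc_ltr; apply: hN.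
Qed.

Lemma invS_lt (R : realType) (e : R) : 0 < e ->
  exists N, forall n, (N <= n)%N -> n.+1%:R^-1 < e.
Proof.
move=> e0; have [N _ hN] := near_infty_natSinv_lt (PosNum e0).
by exists N => n Nn; exact: hN.
Qed.

Section Projection.
Variables (R : realType) (H : completeNormedModType (Cx R)).
Variable ip : {dot H for Num.conj}.
Local Notation C := (Cx R).
Local Notation rc := (@rc R).
Hypothesis ip_norm : forall x : H, ip x x = `|x| ^+ 2.
Local Notation ip2 := (gip ip).

Record closed_subspace (G : set (H * H)) : Prop := ClosedSubspace {
  cs0 : G 0 ;
  csP : forall (a : C) p q, G p -> G q -> G (a *: p + q) ;
  csC : closed G }.

Section Subspace.
Variable G : set (H * H).
Hypothesis cG : closed_subspace G.

Lemma csD p q : G p -> G q -> G (p + q).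
Proof. by move=> *; rewrite -(scale1r p); apply: csP. Qed.
Lemma csZ a p : G p -> G (a *: p).
Proof. by move=> *; rewrite -[_ *: _]addr0; apply: csP => //; exact: cs0. Qed.
Lemma csN p : G p -> G (- p).
Proof. by move=> *; rewrite -scaleN1r; exact: csZ. Qed.
Lemma csB p q : G p -> G q -> G (p - q).
Proof. by move=> *; apply: csD => //; exact: csN. Qed.

Lemma cs_lim (u : nat -> H * H) x y : (forall n, G (u n)) ->
  (u n).1 @[n --> \oo] --> x -> (u n).2 @[n --> \oo] --> y -> G (x, y).
Proof.
move=> hu /nr_cvgP hx /nr_cvgP hy; apply: (csC cG); apply/nr_closure2P => e e0.
have [N _ hN] := hx e e0; have [N' _ hN'] := hy e e0.
exists (u (maxn N N')); split => //; [apply: hN|apply: hN'] => /=.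
  exact: leq_maxl.
exact: leq_maxr.
Qed.

(** The projection theorem for the graph inner product. The parallelogram identity, with midpoints
    in [G], makes a minimising sequence Cauchy; its two components converge separately because [nr2]
    dominates both. *)
Lemma exists_projection p : exists2 g, G g & forall q, G q -> ip2 (p - g) q = 0.
Proof.
pose D := [set r | exists2 g, G g & r = nr2 (p - g)].
have lD : has_lbound D by exists 0 => _ [g _ ->]; exact: nr2_ge0.
have hD : has_inf D by split=> //; exists (nr2 (p - 0)), 0 => //; exact: cs0.
have near_inf n : exists g, G g /\ nr2 (p - g) < inf D + n.+1%:R^-1.
  have [||_ [g gG ->] hg] := @inf_adherent _ D n.+1%:R^-1; rewrite ?invr_gt0//.
  by exists g.
have /choice [g hg] := near_inf.
have gG n : G (g n) by case: (hg n).
have lt_g n : nr2 (p - g n) < inf D + n.+1%:R^-1 by case: (hg n).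
have ge_inf q : G q -> inf D <= nr2 (p - q) by move=> qG; apply: ge_inf => //; exists q.
have cauchy_g m n : nr2 (g m - g n) <= 2 * (m.+1%:R^-1 + n.+1%:R^-1).
  have := nr2_parallelogram ip_norm (p - g m) (p - g n).
  rewrite (_ : p - g m - (p - g n) = - (g m - g n)); last first.
    by rewrite !opprB addrC addrA subrK.
  have -> : p - g m + (p - g n) = 2 *: (p - (2^-1 : C) *: (g m + g n)).
    rewrite scalerBr scalerA divff ?pnatr_eq0// scale1r scaler_nat mulr2n.
    by rewrite addrACA -opprD.
  have : inf D <= nr2 (p - (2^-1 : C) *: (g m + g n)).
    by apply: ge_inf; apply: csZ => //; exact: csD.
  have sc q : nr2 (2 *: q) = 4 * nr2 q :> R.
    rewrite /nr2 /= !nrZ -(rc_nat R 2) nr_rc ger0_norm// !exprMn; ring.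
  have -> : nr2 (- (g m - g n)) = nr2 (g m - g n) by rewrite /nr2 /= !nrN.
  have aux (i u v a b X N : R) : a < i + u -> b < i + v -> i <= X ->
      4 * X + N = 2 * b + 2 * a -> N <= 2 * (v + u) by move=> *; lra.
  by rewrite sc; exact: aux (lt_g n) (lt_g m).
have sub1 q : nr q.1 ^+ 2 <= nr2 q :> R by rewrite lerDl sqr_ge0.
have sub2 q : nr q.2 ^+ 2 <= nr2 q :> R by rewrite lerDr sqr_ge0.
have small (e : R) : 0 < e -> exists N, forall m n, (N <= m)%N -> (N <= n)%N ->
    nr2 (g m - g n) < e ^+ 2.
  move=> e0; have e20 : 0 < e ^+ 2 / 4 by rewrite divr_gt0// exprn_gt0.
  have [N hN] := invS_lt e20.
  exists N => m n Nm Nn; apply: le_lt_trans (cauchy_g m n) _.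
  have aux (i k d : R) : i < d / 4 -> k < d / 4 -> 0 < d -> 2 * (i + k) < d.
    by move=> *; lra.
  by apply: aux (hN m Nm) (hN n Nn) _; rewrite exprn_gt0.
have cvg1 (f : H * H -> H) : (forall q q', f q - f q' = f (q - q')) ->
    (forall q, nr (f q) ^+ 2 <= nr2 q) -> exists l : H, f (g n) @[n --> \oo] --> l.
  move=> fB fle; apply: nr_cauchy_cvg => e e0; have [N hN] := small e e0.
  exists N => m n Nm Nn; rewrite fB -ltr_sqr ?nnegrE ?nr_ge0 ?ltW//.
  exact: le_lt_trans (fle _) (hN _ _ Nm Nn).
have [|//|x hx] := cvg1 fst; first by [].
have [|//|y hy] := cvg1 snd; first by [].
exists (x, y); first exact: cs_lim hx hy.
move=> q qG.
(* Near-minimality of [g n] is tested against the competitor [g n + t a q]. Taking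
   [t = 1 / (nr2 q + 1)] in place of [1 / nr2 q] covers [q = 0] as well. *)
have bnd n : nr (ip2 (p - g n) q) ^+ 2 <= n.+1%:R^-1 * (nr2 q + 1).
  set a := ip2 (p - g n) q; pose t := (nr2 q + 1)^-1.
  have q1 : 0 < nr2 q + 1 by rewrite ltr_wpDl ?nr2_ge0.
  have : inf D <= nr2 (p - g n - (rc t * a) *: q).
    rewrite -addrA -opprD; apply: ge_inf; apply: csD => //; exact: csZ.
  rewrite (nr2BZ ip_norm) -/a nrM nr_rc.
  have -> : complex.Re ((rc t * a)^* * a) = t * nr a ^+ 2.
    by rewrite rmorphM/= rc_conj -mulrA [_^* * _]mulrC -nr2_norm -rcM Re_rc.
  have tq : t * (nr2 q + 1) = 1 by rewrite mulVf// gt_eqF.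
  have t0 : 0 < t by rewrite invr_gt0.
  rewrite exprMn ger0_norm ?(ltW t0)//; have := lt_g n => h1 h2.
  have h3 : t * nr a ^+ 2 <= n.+1%:R^-1.
    have := sqr_ge0 (nr a) => a0.
    have h4 : t ^+ 2 * nr a ^+ 2 * nr2 q = t * nr a ^+ 2 - t * nr a ^+ 2 * t.
      have tq' : t * nr2 q = 1 - t by rewrite -tq; ring.
      have -> : t ^+ 2 * nr a ^+ 2 * nr2 q = t * nr a ^+ 2 * (t * nr2 q) by ring.
      by rewrite tq'; ring.
    have h5 := mulr_ge0 (mulr_ge0 (ltW t0) a0) (ltW t0).
    have aux (i N b c d k : R) : i <= N + b - 2 * c -> N < i + k ->
      b = c - d -> 0 <= d -> c <= k by move=> *; lra.
    exact: aux h2 h1 h4 h5.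
  have := ler_wpM2r (ltW q1) h3; rewrite mulrAC tq mul1r.
  by [].
apply: nr_lim0 => e e0.
have eq0 : 0 < e / 2 / (nr q.1 + nr q.2 + 1).
  by rewrite !divr_gt0// ltr_wpDl// addr_ge0 ?nr_ge0.
have e20 : 0 < (e / 2) ^+ 2 / (nr2 q + 1).
  by rewrite divr_gt0 ?exprn_gt0 ?divr_gt0// ltr_wpDl ?nr2_ge0.
move/nr_cvgP: hx => /(_ _ eq0) [N1 _ hN1]; move/nr_cvgP: hy => /(_ _ eq0) [N2 _ hN2].
have [N3 hN3] := invS_lt e20.
pose n := maxn N1 (maxn N2 N3).
have /= k1 := hN1 n (leq_maxl _ _).
have /= k2 := hN2 n (leq_trans (leq_maxl _ _) (leq_maxr _ _)).
have /= k3 := hN3 n (leq_trans (leq_maxr _ _) (leq_maxr _ _)).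
have b1 := bnd n.
have e2 : 0 <= e / 2 by rewrite divr_ge0// ltW.
have q1 : 0 < nr2 q + 1 by rewrite ltr_wpDl ?nr2_ge0.
have q2 : 0 < nr q.1 + nr q.2 + 1 by rewrite ltr_wpDl// addr_ge0 ?nr_ge0.
have b2 : nr (ip2 (p - g n) q) <= e / 2.
  rewrite -ler_sqr ?nnegrE ?nr_ge0//.
  by apply: le_trans b1 _; rewrite -ler_pdivlMr// ltW.
have b3 : nr (ip2 (g n) q - ip2 (x, y) q) <= e / 2.
  rewrite nrB; apply: le_trans (@ip2_lipschitz _ _ _ ip_norm (x, y) (g n) q _ k1 k2) _.
  rewrite -mulrA ler_piMr// ler_pdivrMl ?mulr1 ?lerDl//.
have -> : p - (x, y) = (p - g n) + (g n - (x, y)) by rewrite addrA subrK.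
rewrite ip2Dl [ip2 (_ - (x, y)) q]ip2Bl.
apply: le_trans (nrD _ _) _; lra.
Qed.

End Subspace.
End Projection.

(** The radius [e / (a + 1)] stands in for [e / a] throughout, so that [a = 0] is not a separate
    case. *)
Lemma mul_divS_le (R : realType) (a e : R) : 0 <= a -> 0 <= e -> a * (e / (a + 1)) <= e.
Proof.
move=> a0 e0; rewrite mulrCA ler_piMr// ler_pdivrMr ?mul1r ?lerDl//.
by rewrite ltr_wpDl.
Qed.

Lemma mul_divS_lt (R : realType) (a e : R) : 0 <= a -> 0 < e -> a * (e / (a + 1)) < e.
Proof.
move=> a0 e0; rewrite mulrCA gtr_pMr// ltr_pdivrMr ?mul1r ?ltrDl//.
by rewrite ltr_wpDl.
Qed.

Lemma divS_gt0 (R : realType) (a e : R) : 0 <= a -> 0 < e -> 0 < e / (a + 1).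
Proof. by move=> a0 e0; rewrite divr_gt0// ltr_wpDl. Qed.

(** * Adjoints of graphs, dense and total subspaces *)

Section Operators.
Variables (R : realType) (H : completeNormedModType (Cx R)).
Variable ip : {dot H for Num.conj}.
Local Notation C := (Cx R).
Local Notation rc := (@rc R).
Local Notation op := (H -> H).
Hypothesis ip_norm : forall x : H, ip x x = `|x| ^+ 2.
Local Notation ip2 := (gip ip).

Lemma closed_ip2_ker (S : set (H * H)) : closed [set p | forall z, S z -> ip2 p z = 0].
Proof.
move=> p /nr_closure2P hp z Sz; apply: nr_lim0 => e e0.
have z0 : 0 <= nr z.1 + nr z.2 by rewrite addr_ge0 ?nr_ge0.
have [q [hq k1 k2]] := hp _ (divS_gt0 z0 e0).
have := ip2_lipschitz ip_norm z k1 k2; rewrite hq// subr0 => /le_trans; apply.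
by rewrite mulrC mul_divS_le// ltW.
Qed.

Definition perp2 (S : set (H * H)) : set (H * H) :=
  [set p | forall z, S z -> ip2 p z = 0].

Lemma perp2_closed_subspace S : closed_subspace (perp2 S).
Proof.
split; last exact: closed_ip2_ker.
  by move=> z _; rewrite /gip /= !ip0l addr0.
by move=> a p q hp hq z Sz; rewrite ip2Dl ip2Zl hp// hq// mulr0 addr0.
Qed.

(** Projecting on [S] leaves a remainder in [G] orthogonal to [S]. Double adjoints ([op_adjK]) and
    the two induction principles [char_ind] and [push_ind] all come from this. *)
Lemma closed_subspace_total (G S : set (H * H)) : closed_subspace G ->
  closed_subspace S -> S `<=` G ->
  (forall r, G r -> (forall s, S s -> ip2 r s = 0) -> r = 0) -> G `<=` S.
Proof.
move=> cG cS SG h p Gp; have [s Ss hs] := exists_projection ip_norm cS p.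
suff /subr0_eq -> : p - s = 0 by [].
by apply: h => //; apply: csB => //; exact: SG.
Qed.

Lemma closure_subspace2 (S : set (H * H)) : S 0 ->
  (forall (a : C) p q, S p -> S q -> S (a *: p + q)) -> closed_subspace (closure S).
Proof.
move=> S0 SP; split; [exact: subset_closure | | exact: closed_closure].
move=> a p q /nr_closure2P hp /nr_closure2P hq; apply/nr_closure2P => e e0.
have e1 := divS_gt0 (nr_ge0 a) (divr_gt0 e0 (ltr0n _ 2)).
have [p' [Sp p1 p2]] := hp _ e1; have [q' [Sq q1 q2]] := hq _ (divr_gt0 e0 (ltr0n _ 2)).
exists (a *: p' + q'); split; first exact: SP.
- rewrite /= opprD addrACA -scalerBr; apply: le_lt_trans (nrD _ _) _; rewrite nrZ.
  have : nr a * nr (p.1 - p'.1) <= e / 2.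
    apply: le_trans (ler_wpM2l (nr_ge0 a) (ltW p1)) _.
    by rewrite mul_divS_le ?nr_ge0// divr_ge0// ltW.
  by move=> *; lra.
- rewrite /= opprD addrACA -scalerBr; apply: le_lt_trans (nrD _ _) _; rewrite nrZ.
  have : nr a * nr (p.2 - p'.2) <= e / 2.
    apply: le_trans (ler_wpM2l (nr_ge0 a) (ltW p2)) _.
    by rewrite mul_divS_le ?nr_ge0// divr_ge0// ltW.
  by move=> *; lra.
Qed.

(** The rotation that turns the adjoint of a graph into an orthogonal complement ([op_adjE]), from
    which its closedness is inherited. *)
Definition swapN (p : H * H) : H * H := (p.2, - p.1).

Lemma op_adjE (G : set (H * H)) : op_adj ip G = [set p | perp2 G (swapN p)].
Proof.
apply/seteqP; split=> p hp q Gq; have := hp q Gq; rewrite /gip /= ipNl.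
  move=> e; apply/eqP; rewrite subr_eq0; apply/eqP.
  by rewrite (ipC ip p.2) -e -ipC.
by move/subr0_eq => e; rewrite ipC -e -ipC.
Qed.

Lemma op_adj_closed_subspace (G : set (H * H)) : closed_subspace (op_adj ip G).
Proof.
rewrite op_adjE; have [h0 hP hC] := perp2_closed_subspace G; split.
- by rewrite /= /swapN /= oppr0.
- move=> a p q hp hq; rewrite /= (_ : swapN _ = a *: swapN p + swapN q); first exact: hP.
  by rewrite /swapN /= opprD -scalerN.
- move=> p /nr_closure2P hp; apply: hC; apply/nr_closure2P => e e0.
  have [q [hq k1 k2]] := hp e e0; exists (swapN q); split => //=.
  by rewrite opprK addrC nrB.
Qed.

Lemma op_adjK (G : set (H * H)) : closed_subspace G -> op_adj ip (op_adj ip G) = G.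
Proof.
move=> cG; apply/seteqP; split; last first.
  by move=> p Gp q /(_ p Gp) e; rewrite ipC -e -ipC.
apply: closed_subspace_total => //; first exact: op_adj_closed_subspace.
  by move=> p Gp q /(_ p Gp) e; rewrite ipC -e -ipC.
move=> r hr hG; apply: ip2_eq0 => //.
(* As [r] is orthogonal to [G], the rotated pair [(- r.2, r.1)] lies in the adjoint of [G]; pairing
   it with [r] yields the square norm of [r]. *)
have := hr (- r.2, r.1); rewrite /gip /= => -> //.
  by rewrite ipNl addNr.
move=> q Gq /=; rewrite ipNr; apply/esym/eqP; rewrite -addr_eq0; apply/eqP.
by rewrite (ipC ip q.1) (ipC ip q.2) -rmorphD/= -[_ + _]/(ip2 r q) (hG q Gq) rmorph0.
Qed.

(** The projection theorem in [H * H], applied to [K] placed in the first coordinate. *)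
Lemma closed_projection (K : set H) : Defs.subspace K -> closed K ->
  forall x, exists2 k, K k & forall z, K z -> ip (x - k) z = 0.
Proof.
move=> [K0 KP] cK x; have cG : closed_subspace [set p : H * H | K p.1 /\ p.2 = 0].
  split=> //.
    by move=> a p q [p1 p2] [q1 q2]; split; [exact: KP | rewrite /= p2 q2 scaler0 addr0].
  move=> p /nr_closure2P hp; split.
    apply: cK; apply/nr_closureP => e e0; have [q [[q1 q2] k1 k2]] := hp e e0.
    by exists q.1.
  apply: nr_lim0 => e e0; have [q [[q1 q2] k1 k2]] := hp e e0.
  by move: k2; rewrite q2 subr0 => /ltW.
have [[k k2]/= [Kk ->] hk] := exists_projection ip_norm cG (x, 0).
exists k => // z Kz; have := hk (z, 0); rewrite /gip /= ip0r addr0; exact.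
Qed.

Lemma closure_subspace (K : set H) : Defs.subspace K -> Defs.subspace (closure K).
Proof.
move=> [K0 KP]; split; first exact: subset_closure.
move=> a x y /nr_closureP hx /nr_closureP hy; apply/nr_closureP => e e0.
have e1 := divS_gt0 (nr_ge0 a) (divr_gt0 e0 (ltr0n _ 2)).
have [x' Kx x1] := hx _ e1; have [y' Ky y1] := hy _ (divr_gt0 e0 (ltr0n _ 2)).
exists (a *: x' + y'); first exact: KP.
rewrite /= opprD addrACA -scalerBr; apply: le_lt_trans (nrD _ _) _; rewrite nrZ.
have : nr a * nr (x - x') <= e / 2.
  apply: le_trans (ler_wpM2l (nr_ge0 a) (ltW x1)) _.
  by rewrite mul_divS_le ?nr_ge0// divr_ge0// ltW.
by move=> *; lra.
Qed.

Lemma total_dense (K : set H) : Defs.subspace K ->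
  (forall u, (forall z, K z -> ip u z = 0) -> u = 0) -> dense K.
Proof.
move=> sK h; apply/nr_denseP => x; apply/nr_closureP.
have [k Kk hk] := closed_projection (closure_subspace sK) (@closed_closure _ K) x.
suff /subr0_eq -> : x - k = 0 by [].
by apply: h => z Kz; apply: hk; exact: subset_closure.
Qed.

Lemma dense_total (K : set H) : dense K ->
  forall u, (forall z, K z -> ip u z = 0) -> u = 0.
Proof.
move=> /nr_denseP dK u h; apply: ip_eq0 => // y; apply: nr_lim0 => e e0.
have [z Kz hz] := dK y _ (divS_gt0 (nr_ge0 u) e0).
rewrite -(subrK z y) ipDr (h z Kz) addr0; apply: le_trans (cauchy_schwarz ip_norm _ _) _.
apply: le_trans (ler_wpM2l (nr_ge0 _) (ltW hz)) _.
by rewrite mul_divS_le ?nr_ge0// ltW.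
Qed.

Lemma bounded_opsP (T : op) : bounded_ops T <->
  linear T /\ exists2 c : R, 0 <= c & forall x, nr (T x) <= c * nr x.
Proof.
split=> [[lT cT]|[lT [c c0 hc]]]; split=> //; last first.
  move=> x; apply/nr_cvgP => e e0.
  have c1 : 0 < c + 1 by rewrite ltr_wpDl.
  apply/nr_nbhs; exists (e / (c + 1)); first exact: divr_gt0.
  move=> y hy; have -> : T x - T y = T (x - y).
    by rewrite addrC -scaleN1r -lT scaleN1r addrC.
  apply: le_lt_trans (hc _) _; apply: le_lt_trans (_ : c * (e / (c + 1)) < _).
    by apply: ler_wpM2l => //; exact: ltW.
  by rewrite mulrCA gtr_pMr// ltr_pdivrMr// mul1r ltrDl.
have T0 : T 0 = 0 by have := lT (-1) 0 0; rewrite scaler0 addr0 scaleN1r addNr.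
have TZ a x : T (a *: x) = a *: T x by have := lT a x 0; rewrite T0 !addr0.
have /nr_nbhs [d d0 hd] : nbhs 0 [set y | nr (T y) < 1].
  have /nr_cvgP/(_ 1 ltr01) := cT 0; rewrite T0; apply: filterS => y.
  by rewrite sub0r nrN.
exists (2 / d); first by rewrite divr_ge0// ltW.
move=> x; have [->|x0] := eqVneq x 0; first by rewrite T0 !nr0 mulr0.
have nx : 0 < nr x.
  by rewrite lt_neqAle nr_ge0 andbT eq_sym; apply: contra_neq x0 => /nr_eq0.
have := hd (rc (d / 2 / nr x) *: x); rewrite sub0r nrN /= TZ !nrZ nr_rc.
have dx : 0 <= d / 2 / nr x by rewrite !divr_ge0// ltW.
rewrite ger0_norm// divfK ?gt_eqF// => h.
have {}h := ltW (h (_ : d / 2 < d)).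
have -> : nr (T x) = 2 / d * nr x * (d / 2 / nr x * nr (T x)).
  by field; rewrite !gt_eqF.
rewrite ler_piMr//; last by apply: h; lra.
by rewrite mulr_ge0 ?nr_ge0// divr_ge0// ltW.
Qed.
End Operators.

(** * Bounded operators and their adjoints *)

Section BoundedOperators.
Variables (R : realType) (H : completeNormedModType (Cx R)).
Variable ip : {dot H for Num.conj}.
Local Notation C := (Cx R).
Local Notation op := (H -> H).
Local Notation bnd := (@bounded_ops R H).

Section Linear.
Variable T : op.
Hypothesis bT : bnd T.
Lemma bndP a x y : T (a *: x + y) = a *: T x + T y.
Proof. by case: bT => lT _; exact: lT. Qed.
Lemma bndD x y : T (x + y) = T x + T y.
Proof. by rewrite -{1}(scale1r x) bndP scale1r. Qed.
Lemma bnd0 : T 0 = 0.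
Proof. by apply: (@addrI _ (T 0)); rewrite -bndD !addr0. Qed.
Lemma bndZ a x : T (a *: x) = a *: T x.
Proof. by rewrite -{1}[a *: x]addr0 bndP bnd0 addr0. Qed.
Lemma bndN x : T (- x) = - T x.
Proof. by rewrite -scaleN1r bndZ scaleN1r. Qed.
Lemma bndB x y : T (x - y) = T x - T y.
Proof. by rewrite bndD bndN. Qed.
Lemma bnd_norm : exists2 c : R, 0 <= c & forall x, nr (T x) <= c * nr x.
Proof. by case/bounded_opsP: bT. Qed.
Lemma bnd_cvg I (F : set_system I) {FF : Filter F} (f : I -> H) (l : H) :
  f @ F --> l -> T (f i) @[i --> F] --> T l.
Proof. by move=> fl; apply: continuous_cvg fl; case: bT => _; apply. Qed.
End Linear.

Lemma mk_bnd (T : op) (c : R) : 0 <= c -> (forall a x y, T (a *: x + y) = a *: T x + T y) ->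
  (forall x, nr (T x) <= c * nr x) -> bnd T.
Proof. by move=> c0 lT hc; apply/bounded_opsP; split=> //; exists c. Qed.

Lemma bnd_comp S T : bnd S -> bnd T -> bnd (S \o T).
Proof.
move=> bS bT; have [c c0 hc] := bnd_norm bS; have [d d0 hd] := bnd_norm bT.
apply: (@mk_bnd _ (c * d)); first exact: mulr_ge0.
  by move=> a x y /=; rewrite !bndP.
move=> x /=; apply: le_trans (hc _) _; rewrite -mulrA; exact: ler_wpM2l.
Qed.

Lemma bnd_id : bnd idfun.
Proof. by apply: (@mk_bnd _ 1) => // x; rewrite mul1r. Qed.

Lemma bnd_lincomb a S T : bnd S -> bnd T -> bnd (fun x => a *: S x + T x).
Proof.
move=> bS bT; have [c c0 hc] := bnd_norm bS; have [d d0 hd] := bnd_norm bT.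
apply: (@mk_bnd _ (nr a * c + d)).
- by rewrite addr_ge0// mulr_ge0// nr_ge0.
- move=> b x y; rewrite (bndP bS) (bndP bT) [a *: (_ + _)]scalerDr.
  rewrite [b *: (a *: _ + _)]scalerDr addrACA.
  by congr (_ + _ + _); rewrite !scalerA (mulrC a b).
- move=> x; apply: le_trans (nrD _ _) _; rewrite nrZ mulrDl; apply: lerD => //.
  by rewrite -mulrA ler_wpM2l// nr_ge0.
Qed.

Lemma bnd_scale a T : bnd T -> bnd (fun x => a *: T x).
Proof.
move=> bT; have [c c0 hc] := bnd_norm bT; apply: (@mk_bnd _ (nr a * c)).
- by rewrite mulr_ge0// nr_ge0.
- by move=> b x y; rewrite (bndP bT) scalerDr !scalerA (mulrC a b).
- by move=> x; rewrite nrZ -mulrA ler_wpM2l// nr_ge0.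
Qed.

Hypothesis ip_norm : forall x : H, ip x x = `|x| ^+ 2.

Lemma riesz (phi : H -> C) (c : R) :
  (forall a x y, phi (a *: x + y) = a * phi x + phi y) ->
  (forall x, nr (phi x) <= c * nr x) -> exists eta, forall x, phi x = ip x eta.
Proof.
move=> lphi hc.
have phiB x y : phi (x - y) = phi x - phi y.
  by rewrite addrC -scaleN1r lphi mulN1r addrC.
have phi0 : phi 0 = 0 by rewrite -(subrr 0) phiB subrr.
have phiZ a x : phi (a *: x) = a * phi x by rewrite -[_ *: _]addr0 lphi phi0 addr0.
have [h|/existsNP[x0 phix0]] := pselect (forall x, phi x = 0).
  by exists 0 => x; rewrite h ip0r.
have c0 : 0 <= c.
  have := le_trans (nr_ge0 _) (hc x0); rewrite pmulr_lge0//.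
  rewrite lt_neqAle nr_ge0 andbT eq_sym; apply/eqP => /nr_eq0 x00.
  by apply: phix0; rewrite x00.
have cK : closed [set x | phi x = 0].
  move=> x /nr_closureP hx; apply: nr_lim0 => e e0.
  have [y /= y0 hy] := hx _ (divS_gt0 c0 e0).
  rewrite -[phi x]subr0 -y0 -phiB; apply: le_trans (hc _) _.
  by apply: le_trans (ler_wpM2l c0 (ltW hy)) _; rewrite mul_divS_le// ltW.
have [|k /= k0 hk] := closed_projection ip_norm _ cK x0.
  by split=> // a x y /= hx hy; rewrite lphi hx hy mulr0 addr0.
pose z := x0 - k; have phiz : phi z != 0 by rewrite phiB k0 subr0; apply/eqP.
have zz : ip z z != 0.
  rewrite ip_nr// -rc0; apply/eqP => /rc_inj/eqP; rewrite sqrf_eq0 => /eqP/nr_eq0 zz.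
  by move/eqP: phiz; apply; rewrite zz.
exists ((phi z / ip z z)^* *: z) => x; rewrite ipZr conjCK.
have hx : phi (x - (phi x / phi z) *: z) = 0 by rewrite phiB phiZ divfK// subrr.
have := hk _ hx; rewrite -/z ipC ipBl ipZl => /(congr1 Num.conj).
rewrite conjCK rmorph0 => /subr0_eq -> /=.
by rewrite mulrCA divfK// divfK.
Qed.

Lemma exists_adjoint T : bnd T -> exists S, bnd S /\ adjoint ip T S.
Proof.
move=> bT; have [c c0 hc] := bnd_norm bT.
have hS y : exists Sy, forall x, ip (T x) y = ip x Sy.
  apply: (@riesz _ (c * nr y)) => [a x z|x].
    by rewrite bndP// ipDl ipZl.
  by apply: le_trans (cauchy_schwarz ip_norm _ _) _; rewrite mulrAC ler_wpM2r// nr_ge0.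
have [S hS'] := choice hS.
exists S; split; last by move=> x y; exact: hS'.
apply: (@mk_bnd _ c) => //.
  move=> a x y; apply: (ip_injr ip_norm) => z.
  by rewrite -hS' !ipDr !ipZr !hS'.
move=> x; have [->|S0] := eqVneq (S x) 0; first by rewrite nr0 mulr_ge0// nr_ge0.
have Sx : 0 < nr (S x).
  by rewrite lt_neqAle nr_ge0 andbT eq_sym; apply: contra_neq S0 => /nr_eq0.
rewrite -(ler_pM2l Sx).
have -> : nr (S x) * nr (S x) = nr (ip (S x) (S x)).
  by rewrite (ip_nr ip_norm) nr_rc ger0_norm ?sqr_ge0// expr2.
rewrite -hS'.
apply: le_trans (cauchy_schwarz ip_norm _ _) _.
by rewrite mulrA ler_wpM2r ?nr_ge0// mulrC.
Qed.

(** A total function: at each [y] a representing vector is chosen, with value 0 if there is none. By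
    [adjo_spec] it is the adjoint on bounded operators. *)
Definition adjo (T : op) : op := fun y => xget 0 [set z | forall x, ip (T x) y = ip x z].

Lemma adjo_spec T : bnd T -> bnd (adjo T) /\ adjoint ip T (adjo T).
Proof.
move=> /exists_adjoint [S [bS TS]]; suff -> : adjo T = S by [].
apply/funext => y; rewrite /adjo; case: xgetP => [z _ hz|/(_ (S y))[]].
  by apply: (ip_injr ip_norm) => x; rewrite -hz TS.
by move=> x; rewrite TS.
Qed.

Lemma bnd_adjo T : bnd T -> bnd (adjo T).
Proof. by move=> /adjo_spec[]. Qed.

Lemma adjoP T x y : bnd T -> ip (T x) y = ip x (adjo T y).
Proof. by move=> /adjo_spec[_]; apply. Qed.

Lemma adjoPr T x y : bnd T -> ip (adjo T x) y = ip x (T y).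
Proof. by move=> bT; rewrite ipC -adjoP// -ipC. Qed.

Lemma adjo_uniq T S : bnd T -> adjoint ip T S -> S = adjo T.
Proof.
by move=> bT TS; apply/funext => x; apply: (ip_injr ip_norm) => y; rewrite -TS adjoP.
Qed.

Lemma adjoK T : bnd T -> adjo (adjo T) = T.
Proof.
move=> bT; apply/esym/adjo_uniq; first exact: bnd_adjo.
by move=> x y; rewrite adjoPr.
Qed.

Lemma adjo_comp S T : bnd S -> bnd T -> adjo (S \o T) = adjo T \o adjo S.
Proof.
move=> bS bT; apply/esym/adjo_uniq; first exact: bnd_comp.
by move=> x y /=; rewrite !adjoP.
Qed.

Lemma isometry_nr T x : bnd T -> adjo T \o T = idfun -> nr (T x) = nr x.
Proof.
move=> bT TT; apply/eqP; rewrite -(eqrXn2 (n := 2))// ?nr_ge0//; apply/eqP/rc_inj.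
by rewrite -!(ip_nr ip_norm) adjoP// -[adjo T (T x)]/((adjo T \o T) x) TT.
Qed.

End BoundedOperators.

(** * Affiliated operators and generated von Neumann algebras *)

Section Generated.
Variables (R : realType) (H : completeNormedModType (Cx R)).
Variable ip : {dot H for Num.conj}.
Local Notation C := (Cx R).
Local Notation op := (H -> H).
Local Notation uop := (set (H * H)%type).
Local Notation bnd := (@bounded_ops R H).
Local Notation ip2 := (gip ip).
Local Notation adjo := (adjo ip).
Local Notation char_pair := (char_pair ip).
Local Notation op_adj := (op_adj ip).
Hypothesis ip_norm : forall x : H, ip x x = `|x| ^+ 2.

Lemma cmp_eq (S T S' T' : op) : S \o T = S' \o T' -> forall x, S (T x) = S' (T' x).
Proof. by move=> e x; exact: (congr1 (fun f => f x) e). Qed.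

Lemma cmp_eq1 (S T U : op) : S \o T = U -> forall x, S (T x) = U x.
Proof. by move=> e x; exact: (congr1 (fun f => f x) e). Qed.

(** Affiliation is phrased through the bounded pair that determines [G], as in [op_image];
    commutation with the commutant of [N] is then a consequence ([affiliated_comm]). *)
Definition affiliated (N : set op) (G : uop) : Prop :=
  closed_op G /\ exists a b, [/\ N a, N b & char_pair G a b].

Definition commuting (S : set uop) : set op := [set B | bnd B /\
  forall G, S G -> commutes_with B G /\ commutes_with B (op_adj G)].

Lemma closed_op_subspace (G : uop) : closed_op G -> closed_subspace G.
Proof. by case. Qed.

Lemma closed_subspaceI (G G' : uop) :
  closed_subspace G -> closed_subspace G' -> closed_subspace (G `&` G').
Proof.
move=> [a0 aP aC] [b0 bP bC]; split; [by []| |exact: closedI].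
by move=> a p q [p1 p2] [q1 q2]; split; [exact: aP|exact: bP].
Qed.

Lemma closed_subspace_preim (G : uop) (B : op) : closed_subspace G -> bnd B ->
  closed_subspace [set p | G (B p.1, B p.2)].
Proof.
move=> cG bB; split.
- by rewrite /= (bnd0 bB); exact: (cs0 cG).
- by move=> a p q hp hq /=; rewrite !(bndP bB); exact: (csP cG a hp hq).
- move=> p /nr_closure2P hp; apply: (csC cG); apply/nr_closure2P => e e0.
  have [c c0 hc] := bnd_norm bB.
  have [q [Gq k1 k2]] := hp _ (divS_gt0 c0 (divr_gt0 e0 (ltr0n _ 2))).
  have e2 : e / 2 < e by lra.
  have bd x : nr x < e / 2 / (c + 1) -> nr (B x) < e.
    move=> hx; apply: le_lt_trans (hc _) (le_lt_trans _ e2).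
    by apply: le_trans (ler_wpM2l c0 (ltW hx)) _; rewrite mul_divS_le// divr_ge0// ltW.
  exists (B q.1, B q.2); split => //=; rewrite -(bndB bB); exact: bd.
Qed.

Section CharPair.
Variables (G : uop) (a b : op).
Hypothesis chG : char_pair G a b.

Lemma char_in x : G (a x, b x).
Proof. by case: chG => _ _ /(_ x)[]. Qed.

Lemma char_perp x p : G p -> ip2 (x - a x, - b x) p = 0.
Proof. by case: chG => _ _ /(_ x)[_]; apply. Qed.

Lemma char_ip x p : G p -> ip2 (a x, b x) p = ip x p.1.
Proof.
move=> /(char_perp x); rewrite /gip /= ipBl ipNl => h; apply/eqP.
by rewrite -subr_eq0 -oppr_eq0 opprB opprD addrA h.
Qed.

(** The projection of [(x, 0)] is the only vector of [G] representing the pairing with [x] in the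
    first coordinate. Commutation with [a] and [b] is proved by recognising it. *)
Lemma char_uniq x p : closed_subspace G -> G p -> (forall q, G q -> ip2 p q = ip x q.1) ->
  p = (a x, b x).
Proof.
move=> cG Gp hp; apply/subr0_eq/(ip2_eq0 ip_norm).
have Gd : G (p - (a x, b x)) by apply: csB => //; exact: char_in.
by rewrite ip2Bl hp// char_ip// subrr.
Qed.

(** By [char_ip], a vector of [G] orthogonal to every [(a x, b x)] has first coordinate 0, and then
    vanishes because [G] is univalent. These vectors are therefore total in [G]. *)
Lemma char_ind (S : uop) : closed_op G -> closed_subspace S ->
  (forall x, S (a x, b x)) -> G `<=` S.
Proof.
move=> cG cS hS; have cG' := closed_op_subspace cG.
suff : G `<=` S `&` G by move=> h p /h[].
apply: (closed_subspace_total ip_norm) => //; first exact: closed_subspaceI.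
move=> r Gr hr; have r1 : r.1 = 0.
  apply: (ip_eq0 ip_norm) => x; rewrite ipC -(char_ip x Gr) ip2C hr ?rmorph0//.
  by split=> //; exact: char_in.
case: r Gr {hr} r1 => r1 r2 Gr /= r10; rewrite r10 in Gr *.
by rewrite (co_univalent cG Gr).
Qed.

Lemma char_commutes B : closed_op G -> bnd B -> B \o a = a \o B -> B \o b = b \o B ->
  commutes_with B G.
Proof.
move=> cG bB Ba Bb; have cG' := closed_op_subspace cG.
apply: (char_ind cG (closed_subspace_preim cG' bB)) => x /=.
by rewrite (cmp_eq Ba) (cmp_eq Bb); exact: char_in.
Qed.

End CharPair.

Lemma char_pair_inj (G G' : uop) a b : closed_op G -> closed_op G' ->
  char_pair G a b -> char_pair G' a b -> G = G'.
Proof.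
move=> cG cG' ch ch'; apply/seteqP; split.
  by apply: (char_ind ch) => //; [exact: closed_op_subspace|exact: (char_in ch')].
by apply: (char_ind ch') => //; [exact: closed_op_subspace|exact: (char_in ch)].
Qed.

Lemma char_pair_uniq (G : uop) a b a' b' : closed_subspace G ->
  char_pair G a b -> char_pair G a' b' -> a = a' /\ b = b'.
Proof.
move=> cG ch ch'; have h x : (a x, b x) = (a' x, b' x).
  by apply: (char_uniq ch') => //; [exact: (char_in ch x)|move=> q; exact: char_ip].
by split; apply/funext => x; case: (h x).
Qed.

Lemma commutes_with_adj (G : uop) B : bnd B -> commutes_with B G ->
  commutes_with (adjo B) (op_adj G).
Proof.
move=> bB BG p hp q Gq /=; rewrite -!adjoP//; exact: (hp (B q.1, B q.2) (BG _ Gq)).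
Qed.

Lemma commutes_with_perp (G : uop) B p : bnd B -> commutes_with B (op_adj G) ->
  perp2 ip G p -> perp2 ip G (B p.1, B p.2).
Proof.
move=> bB BG hp; rewrite op_adjE in BG.
have := BG (- p.2, p.1); rewrite /swapN /= opprK (bndN bB) opprK; apply.
by case: p hp.
Qed.

(** An operator commuting with [G] and with its adjoint preserves [G] and its orthogonal complement,
    hence commutes with the projection on [G]. *)
Lemma commuting_char (G : uop) a b B : closed_subspace G -> char_pair G a b -> bnd B ->
  commutes_with B G -> commutes_with B (op_adj G) -> B \o a = a \o B /\ B \o b = b \o B.
Proof.
move=> cG ch bB BG BGa; have h x : (B (a x), B (b x)) = (a (B x), b (B x)).
  apply: (char_uniq ch) => //; first exact: (BG (a x, b x) (char_in ch x)).
  move=> q Gq; have := commutes_with_perp bB BGa (char_perp ch x).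
  move=> /(_ q Gq); rewrite /gip /= (bndB bB) (bndN bB) ipBl ipNl => e; apply/eqP.
  by rewrite -subr_eq0 -oppr_eq0 opprB opprD addrA e.
by split; apply/funext => x; case: (h x).
Qed.

Lemma commutant_id (N : set op) : commutant N idfun.
Proof. by split; [exact: bnd_id|]. Qed.

Lemma commutant_comp (N : set op) S T : commutant N S -> commutant N T -> commutant N (S \o T).
Proof.
move=> [bS hS] [bT hT]; split; first exact: bnd_comp.
by move=> B NB; apply/funext => x /=; rewrite (cmp_eq (hT _ NB)) (cmp_eq (hS _ NB)).
Qed.

Lemma commutant_lincomb (N : set op) (a : C) S T : N `<=` bnd ->
  commutant N S -> commutant N T -> commutant N (fun x => a *: S x + T x).
Proof.
move=> bN [bS hS] [bT hT]; split; first exact: bnd_lincomb.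
move=> B NB; apply/funext => x /=.
by rewrite (bndP (bN _ NB)) (cmp_eq (hS _ NB)) (cmp_eq (hT _ NB)).
Qed.

Lemma commutant_adj (N : set op) T : (forall S, N S -> bnd S /\ N (adjo S)) ->
  commutant N T -> commutant N (adjo T).
Proof.
move=> sN [bT hT]; split; first exact: bnd_adjo.
move=> B NB; have [bB NaB] := sN _ NB.
rewrite -[B in LHS](adjoK ip_norm bB) -[B in RHS](adjoK ip_norm bB).
by rewrite -!adjo_comp ?hT//; exact: bnd_adjo.
Qed.

Lemma commutant_anti (N N' : set op) : N `<=` N' -> commutant N' `<=` commutant N.
Proof. by move=> h T [bT hT]; split=> // B /h; exact: hT. Qed.

Lemma sub_bicommutant (N : set op) : N `<=` bnd -> N `<=` commutant (commutant N).
Proof. by move=> bN T NT; split; [exact: bN|move=> B [_ /(_ _ NT)]]. Qed.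

Lemma commutant_vN (N : set op) : (forall S, N S -> bnd S /\ N (adjo S)) ->
  von_neumann ip (commutant N).
Proof.
move=> sN; split.
- by move=> T [].
- move=> T S NT TS; rewrite (adjo_uniq ip_norm NT.1 TS); exact: commutant_adj.
- apply/seteqP; split; last by apply: sub_bicommutant => T [].
  by apply: commutant_anti; apply: sub_bicommutant => T /sN[].
Qed.

(** Taking adjoints exchanges the two conditions, since a closed graph is its own double adjoint. *)
Lemma commuting_star (S : set uop) : (forall G, S G -> closed_subspace G) ->
  forall B, commuting S B -> bnd B /\ commuting S (adjo B).
Proof.
move=> cS B [bB hB]; split=> //; split; first exact: bnd_adjo.
move=> G SG; have [h1 h2] := hB _ SG; split; last exact: commutes_with_adj.
rewrite -(op_adjK ip_norm (cS _ SG)); exact: commutes_with_adj.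
Qed.

Lemma vN_gen_vN (S : set uop) : (forall G, S G -> closed_subspace G) ->
  von_neumann ip (vN_gen ip S).
Proof. by move=> cS; apply: commutant_vN; exact: commuting_star. Qed.

Section VonNeumann.
Variable N : set op.
Hypothesis vN : von_neumann ip N.

Lemma vn_bnd T : N T -> bnd T.
Proof. by move=> NT; exact: (vn_bounded vN). Qed.

Lemma vn_adjo T : N T -> N (adjo T).
Proof. by move=> NT; apply: (vn_star vN NT) => x y; rewrite adjoP//; exact: vn_bnd. Qed.

Lemma vn_id : N idfun.
Proof. by rewrite -(vn_bicommutant vN); exact: commutant_id. Qed.

Lemma vn_comp S T : N S -> N T -> N (S \o T).
Proof. rewrite -(vn_bicommutant vN); exact: commutant_comp. Qed.

Lemma vn_lincomb (a : C) S T : N S -> N T -> N (fun x => a *: S x + T x).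
Proof. by rewrite -(vn_bicommutant vN); apply: commutant_lincomb => B []. Qed.

Lemma commutant_star B : commutant N B -> bnd B /\ commutant N (adjo B).
Proof.
move=> NB; split; first by case: NB.
by apply: commutant_adj NB => S NS; split; [exact: vn_bnd|exact: vn_adjo].
Qed.

Lemma vn_memP T : bnd T -> (forall B, commutant N B -> B \o T = T \o B) -> N T.
Proof. by move=> bT h; rewrite -(vn_bicommutant vN); split=> // B /h. Qed.

Lemma affiliated_commuting (S : set uop) : (forall G, S G -> affiliated N G) ->
  commutant N `<=` commuting S.
Proof.
move=> aS B NB; have [bB [bA aB]] := commutant_star NB; split=> // G SG.
have [cG [a [b [Na Nb ch]]]] := aS _ SG.
have cw B' : commutant N B' -> commutes_with B' G.
  by move=> [bB' hB']; apply: (char_commutes ch) => //; rewrite hB'.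
split; first exact: cw.
rewrite -(adjoK ip_norm bB); apply: commutes_with_adj => //; exact: cw.
Qed.

Lemma vN_gen_sub (S : set uop) : (forall G, S G -> affiliated N G) ->
  vN_gen ip S `<=` N.
Proof.
move=> /affiliated_commuting h T /(commutant_anti h); by rewrite (vn_bicommutant vN).
Qed.

Lemma affiliated_vN_gen (S : set uop) G : S G -> affiliated N G ->
  affiliated (vN_gen ip S) G.
Proof.
move=> SG [cG [a [b [Na Nb ch]]]]; split=> //; exists a, b.
have h B : commuting S B -> B \o a = a \o B /\ B \o b = b \o B.
  move=> [bB /(_ _ SG)[h1 h2]].
  exact: (commuting_char (closed_op_subspace cG) ch bB h1 h2).
split=> //; (split; first exact: vn_bnd); by move=> B /h[].
Qed.

End VonNeumann.

Lemma affiliated_comm (N : set op) (G : uop) B : affiliated N G -> bnd B ->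
  (forall y, N y -> B \o y = y \o B) -> commutes_with B G.
Proof.
move=> [cG [a [b [Na Nb ch]]]] bB h; apply: (char_commutes ch) => //; exact: h.
Qed.

End Generated.

(** * Homomorphisms implemented by intertwining operators *)

Section Intertwiners.
Variables (R : realType) (H : completeNormedModType (Cx R)).
Variable ip : {dot H for Num.conj}.
Local Notation C := (Cx R).
Local Notation op := (H -> H).
Local Notation uop := (set (H * H)%type).
Local Notation bnd := (@bounded_ops R H).
Local Notation ip2 := (gip ip).
Local Notation adjo := (adjo ip).
Local Notation char_pair := (char_pair ip).
Local Notation op_adj := (op_adj ip).
Local Notation affiliated := (affiliated ip).
Hypothesis ip_norm : forall x : H, ip x x = `|x| ^+ 2.

(** This covers two situations at once: the operators [z W] with [z] in the commutant, for the limit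
    endomorphism, and a single unitary, for [alpha t]. [iw_r] is listed apart from [iw_l] because
    [theta] is not assumed to respect adjoints; that follows from it ([iw_adjo]). [iw_total] says
    that the ranges of [I] span a dense subspace. *)
Record intertwiner (N : set op) (theta : op -> op) (I : set op) (W : op) : Prop :=
  Intertwiner {
  iw_bnd : forall X, I X -> bnd X ;
  iw_l : forall X y, I X -> N y -> X \o y = theta y \o X ;
  iw_r : forall X y, I X -> N y -> adjo X \o theta y = y \o adjo X ;
  iw_total : forall u, (forall X, I X -> adjo X u = 0) -> u = 0 ;
  iw_in : I W ;
  iw_iso : adjo W \o W = idfun ;
  iw_img : forall y, N y -> bnd (theta y) }.

(* The image of G under the homomorphism spatially given by I. *)
Definition push (I : set op) (G : uop) : uop :=
  [set p | forall X, I X -> G (adjo X p.1, adjo X p.2)].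

(** What makes every [X] of [I] carry [G] into [push I G] ([push_in]). Graphs affiliated to [N] have
    it, as [adjo X \o X'] commutes with [N]. *)
Definition stable (I : set op) (G : uop) : Prop :=
  forall X X', I X -> I X' -> commutes_with (adjo X \o X') G.

Section Fixed.
Variables (N : set op) (theta : op -> op) (I : set op) (W : op).
Hypothesis iw : intertwiner N theta I W.

Let bI X : I X -> bnd X. Proof. exact: (iw_bnd iw). Qed.
Let bIa X : I X -> bnd (adjo X). Proof. by move=> /bI; exact: bnd_adjo. Qed.

(** The ranges of [I] are total, so identities between values of [theta] may be tested after
    composition with each [X], where [iw_l] moves them back to [N]. The homomorphism laws follow in
    this way. *)
Lemma iw_eq S T : bnd S -> bnd T -> (forall X, I X -> S \o X = T \o X) -> S = T.
Proof.
move=> bS bT h; rewrite -(adjoK ip_norm bS) -(adjoK ip_norm bT); congr (adjo _).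
apply/funext => u; apply/subr0_eq/(iw_total iw) => X IX.
rewrite bndB; last exact: bIa.
have := congr1 adjo (h X IX).
rewrite (adjo_comp ip_norm bS (bI IX)) (adjo_comp ip_norm bT (bI IX)) => e.
by rewrite (cmp_eq e) subrr.
Qed.

Lemma iw_inv y : N y -> adjo W \o theta y \o W = y.
Proof.
move=> Ny; apply/funext => x /=.
by rewrite (cmp_eq (iw_r iw (iw_in iw) Ny)) (cmp_eq1 (iw_iso iw)).
Qed.

Lemma iw_inj y y' : N y -> N y' -> theta y = theta y' -> y = y'.
Proof. by move=> Ny Ny' e; rewrite -(iw_inv Ny) e iw_inv. Qed.

Lemma iw_comp S T : N S -> N T -> N (S \o T) -> theta (S \o T) = theta S \o theta T.
Proof.
move=> NS NT NST; apply: iw_eq; first exact: (iw_img iw).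
  by apply: bnd_comp; exact: (iw_img iw).
move=> X IX; rewrite -(iw_l iw IX NST); apply/funext => x /=.
by rewrite (cmp_eq (iw_l iw IX NS)) (cmp_eq (iw_l iw IX NT)).
Qed.

Lemma iw_id : N idfun -> theta idfun = idfun.
Proof.
move=> N1; apply: iw_eq; [exact: (iw_img iw)|exact: bnd_id|].
by move=> X IX; rewrite -(iw_l iw IX N1).
Qed.

Lemma iw_lincomb (a : C) S T : N S -> N T -> N (fun x => a *: S x + T x) ->
  theta (fun x => a *: S x + T x) = fun x => a *: theta S x + theta T x.
Proof.
move=> NS NT NST; apply: iw_eq; first exact: (iw_img iw).
  by apply: bnd_lincomb; exact: (iw_img iw).
move=> X IX; rewrite -(iw_l iw IX NST); apply/funext => x /=.
by rewrite (bndP (bI IX)) (cmp_eq (iw_l iw IX NS)) (cmp_eq (iw_l iw IX NT)).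
Qed.

Lemma iw_adjo S : N S -> N (adjo S) -> bnd S -> theta (adjo S) = adjo (theta S).
Proof.
move=> NS NaS bS; have bt := iw_img iw NS; apply: iw_eq; first exact: (iw_img iw).
  exact: bnd_adjo.
move=> X IX; rewrite -(iw_l iw IX NaS).
have := congr1 adjo (iw_r iw IX NS).
rewrite (adjo_comp ip_norm (bIa IX) bt) (adjo_comp ip_norm bS (bIa IX)).
by rewrite (adjoK ip_norm (bI IX)).
Qed.

Lemma stable_affiliated G : affiliated N G -> stable I G.
Proof.
move=> aG X X' IX IX'; apply: (affiliated_comm ip_norm aG).
  by apply: bnd_comp; [exact: bIa|exact: bI].
move=> y Ny; apply/funext => x /=.
by rewrite (cmp_eq (iw_l iw IX' Ny)) (cmp_eq (iw_r iw IX Ny)).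
Qed.

Lemma stable_adj G : stable I G -> stable I (op_adj G).
Proof.
move=> sG X X' IX IX' p hp q Gq /=.
rewrite -!(adjoP ip_norm _ _ (bI IX)) -!(adjoPr ip_norm _ _ (bI IX')).
exact: (hp (adjo X' (X q.1), adjo X' (X q.2)) (sG _ _ IX' IX _ Gq)).
Qed.

Lemma push_in G X p : stable I G -> I X -> G p -> push I G (X p.1, X p.2).
Proof. by move=> sG IX Gp X' IX'; exact: (sG X' X IX' IX p Gp). Qed.

Lemma push_closed_subspace G : closed_subspace G -> closed_subspace (push I G).
Proof.
move=> cG; split.
- by move=> X IX /=; rewrite (bnd0 (bIa IX)); exact: (cs0 cG).
- move=> a p q hp hq X IX /=; rewrite !(bndP (bIa IX)).
  exact: (csP cG a (hp X IX) (hq X IX)).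
- move=> p hp X IX; apply: (csC (closed_subspace_preim cG (bIa IX))).
  by apply: closureS hp => q; apply.
Qed.

(** The vectors [(X p.1, X p.2)] are total in [push I G]. If [r] in [push I G] is orthogonal to
    them, then so it is to the image under [X] of [(adjo X r.1, adjo X r.2)], which lies in [G];
    hence the latter has norm 0 for every [X], and [r = 0] by totality. *)
Lemma push_ind G (S : uop) : closed_subspace G -> stable I G -> closed_subspace S ->
  (forall X p, I X -> G p -> S (X p.1, X p.2)) -> push I G `<=` S.
Proof.
move=> cG sG cS hS; suff : push I G `<=` S `&` push I G by move=> h p /h[].
have cP := push_closed_subspace cG.
apply: (closed_subspace_total ip_norm) => //; first exact: closed_subspaceI.
move=> r hr hp.
have hX X : I X -> (adjo X r.1, adjo X r.2) = 0.
  move=> IX; apply: (ip2_eq0 ip_norm).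
  have e : ip2 r (X (adjo X r.1), X (adjo X r.2)) = 0.
    apply: hp; split; first exact: (hS X (adjo X r.1, adjo X r.2) IX (hr X IX)).
    by apply: (push_in (p := (adjo X r.1, adjo X r.2))) => //; exact: hr.
  by rewrite /gip /= !(adjoPr ip_norm _ _ (bI IX)).
case: r {hp hr} hX => r1 r2 /= hX; congr (_, _).
  by apply: (iw_total iw) => X /hX[].
by apply: (iw_total iw) => X /hX[].
Qed.

Lemma push_adj G : closed_subspace G -> stable I G ->
  op_adj (push I G) = push I (op_adj G).
Proof.
move=> cG sG; apply/seteqP; split=> u hu.
  move=> X IX q Gq /=; rewrite -!(adjoP ip_norm _ _ (bI IX)).
  exact: (hu (X q.1, X q.2) (push_in sG IX Gq)).
(* With [u] fixed, the vectors that pair correctly with it form the closed subspace [op_adj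
   [set u]], which opens the way to [push_ind] in the tested vector. *)
have cu : closed_subspace [set q | op_adj [set u] q].
  exact: op_adj_closed_subspace.
move=> q hq; rewrite (ipC ip q.2) (ipC ip q.1); congr (_^*).
apply/esym.
suff : op_adj [set u] q by move=> /(_ u erefl).
apply: (push_ind cG sG cu _ hq) => X p IX Gp _ -> /=.
have := hu X IX p Gp; rewrite /= -!(adjoP ip_norm _ _ (bI IX)) => e.
by rewrite ipC -e -ipC.
Qed.

Lemma push_char G a b : closed_subspace G -> stable I G -> N a -> N b ->
  char_pair G a b -> char_pair (push I G) (theta a) (theta b).
Proof.
move=> cG sG Na Nb ch; split; [exact: (iw_img iw)|exact: (iw_img iw)|].
move=> x; split.
  move=> X IX /=; rewrite (cmp_eq (iw_r iw IX Na)) (cmp_eq (iw_r iw IX Nb)).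
  exact: (char_in ch).
move=> p hp; suff : perp2 ip [set (x - theta a x, - theta b x)] p.
  move=> /(_ _ erefl); rewrite /gip /= => e.
  by rewrite (ipC ip (x - _)) (ipC ip (- _)) -rmorphD/= e rmorph0.
apply: (push_ind cG sG (perp2_closed_subspace ip_norm _) _ hp) => X q IX Gq _ ->.
rewrite ip2C /gip /= -!(adjoPr ip_norm _ _ (bI IX)).
rewrite (bndB (bIa IX)) (bndN (bIa IX)).
rewrite (cmp_eq (iw_r iw IX Na)) (cmp_eq (iw_r iw IX Nb)) -[_ + _]/(ip2 (_, _) _).
by rewrite (char_perp ch)// rmorph0.
Qed.

Lemma push_closed_op G : closed_op G -> stable I G -> closed_op (push I G).
Proof.
move=> cG sG; have cG' := closed_op_subspace cG.
have [p0 pP pC] := push_closed_subspace cG'; split=> //.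
  move=> y hy; apply: (iw_total iw) => X IX.
  by have := hy X IX; rewrite /= (bnd0 (bIa IX)); exact: (co_univalent cG).
apply: (total_dense ip_norm).
  split; first by exists 0.
  by move=> a x y [x' hx] [y' hy]; exists (a *: x' + y'); exact: (pP a (x, x') (y, y')).
move=> u hu; apply: (iw_total iw) => X IX.
apply: (dense_total ip_norm (co_dense cG)) => x [x' hx].
rewrite (adjoPr ip_norm _ _ (bI IX)); apply: hu; exists (X x').
exact: (push_in (p := (x, x')) sG IX hx).
Qed.

Lemma push_affiliated G : affiliated N G -> affiliated (theta @` N) (push I G).
Proof.
move=> aG; have sG := stable_affiliated aG; case: aG => cG [a [b [Na Nb ch]]].
split; first exact: push_closed_op.
exists (theta a), (theta b); split; [by exists a|by exists b|].
by apply: push_char => //; exact: closed_op_subspace.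
Qed.

Lemma push_op_image G : affiliated N G -> op_image ip N theta G (push I G).
Proof.
move=> aG; have sG := stable_affiliated aG; case: aG => cG [a [b [Na Nb ch]]].
split; first exact: push_closed_op.
exists a, b; split=> //.
by apply: push_char => //; exact: closed_op_subspace.
Qed.

(** The characteristic pair determines a closed operator, so the image is unique. This turns the
    existential in [shift_relation] into an equation. *)
Lemma op_image_push G G' : closed_op G -> op_image ip N theta G G' -> G' = push I G.
Proof.
move=> cG [cG' [a [b [Na Nb ch ch']]]]; have aG : affiliated N G by split=> //; exists a, b.
have sG := stable_affiliated aG.
apply: (char_pair_inj ip_norm) ch' _ => //; first exact: push_closed_op.
by apply: push_char => //; exact: closed_op_subspace.
Qed.

Lemma closure_map (S S' : uop) X : bnd X -> (forall p, S p -> S' (X p.1, X p.2)) ->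
  forall p, closure S p -> closure S' (X p.1, X p.2).
Proof.
move=> bX h p /nr_closure2P hp; apply/nr_closure2P => e e0.
have [c c0 hc] := bnd_norm bX.
have [q [Gq k1 k2]] := hp _ (divS_gt0 c0 (divr_gt0 e0 (ltr0n _ 2))).
have e2 : e / 2 < e by lra.
have bd x : nr x < e / 2 / (c + 1) -> nr (X x) < e.
  move=> hx; apply: le_lt_trans (hc _) (le_lt_trans _ e2).
  by apply: le_trans (ler_wpM2l c0 (ltW hx)) _; rewrite mul_divS_le// divr_ge0// ltW.
exists (X q.1, X q.2); split => //=; first exact: h.
  by rewrite -(bndB bX); exact: bd.
by rewrite -(bndB bX); exact: bd.
Qed.

(* An operation on graphs whose natural domain is respected by I and its
   adjoints commutes with push. *)
Lemma push_closure (S S' : uop) :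
  (S 0 /\ forall (a : C) p q, S p -> S q -> S (a *: p + q)) ->
  (S' 0 /\ forall (a : C) p q, S' p -> S' q -> S' (a *: p + q)) ->
  (forall X p, I X -> S p -> S' (X p.1, X p.2)) ->
  (forall X p, I X -> S' p -> S (adjo X p.1, adjo X p.2)) ->
  stable I (closure S) /\ push I (closure S) = closure S'.
Proof.
move=> [S0 SP] [S0' SP'] SS' S'S.
have cS := closure_subspace2 S0 SP; have cS' := closure_subspace2 S0' SP'.
have sS : stable I (closure S).
  move=> X X' IX IX'; apply: closure_map.
    by apply: bnd_comp; [exact: bIa|exact: bI].
  by move=> p Sp; exact: (S'S X (X' p.1, X' p.2) IX (SS' _ _ IX' Sp)).
split=> //; apply/seteqP; split.
  apply: push_ind => // X p IX; apply: closure_map; first exact: bI.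
  by move=> q; exact: SS'.
move=> p hp X IX; apply: closure_map hp; first exact: bIa.
by move=> q; exact: S'S.
Qed.

Section Gen.
Variable S : set uop.
Hypothesis vN : von_neumann ip N.
Hypothesis aS : forall G, S G -> affiliated N G.

Lemma commuting_conj X X' B : I X -> I X' -> commuting ip (push I @` S) B ->
  commuting ip S (adjo X \o B \o X').
Proof.
move=> IX IX' [bB hB]; split.
  exact: (bnd_comp (bnd_comp (bIa IX) bB) (bI IX')).
move=> G SG; have [h1 h2] := hB _ (ex_intro2 _ _ G SG erefl).
have aG := aS SG; have sG := stable_affiliated aG.
have cG := closed_op_subspace aG.1.
split=> p Gp; first exact: (h1 (X' p.1, X' p.2) (push_in sG IX' Gp) X IX).
rewrite (push_adj cG sG) in h2.
exact: (h2 (X' p.1, X' p.2) (push_in (stable_adj sG) IX' Gp) X IX).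
Qed.

Lemma commuting_push X X' B : I X -> I X' -> commuting ip S B ->
  commuting ip (push I @` S) (X \o B \o adjo X').
Proof.
move=> IX IX' [bB hB]; split.
  exact: (bnd_comp (bnd_comp (bI IX) bB) (bIa IX')).
move=> _ [G SG <-]; have [h1 h2] := hB _ SG.
have aG := aS SG; have sG := stable_affiliated aG.
have cG := closed_op_subspace aG.1.
split=> p Gp.
  exact: (push_in (p := (B (adjo X' p.1), B (adjo X' p.2))) sG IX (h1 _ (Gp _ IX'))).
move: Gp; rewrite (push_adj cG sG) => Gp.
exact: (push_in (p := (B (adjo X' p.1), B (adjo X' p.2))) (stable_adj sG) IX (h2 _ (Gp _ IX'))).
Qed.

(** For [T] on the left, each [X \o adjo W] commutes with the pushed generators, hence with [T];
    composing with the isometry [W] gives [T X = X y] for [y = adjo W \o T \o W], that is,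
    [T = theta y]. Conversely, if [B] commutes with the pushed generators, then [adjo X \o B \o X']
    commutes with the original ones and so with [y], which is the commutation of [theta y] with [B]
    sandwiched between [adjo X] and [X']. *)
Lemma vN_gen_push : vN_gen ip (push I @` S) = theta @` vN_gen ip S.
Proof.
have sub := vN_gen_sub ip_norm vN aS.
apply/seteqP; split=> [T [bT hT]|_ [y ySg <-]].
  have IW := iw_in iw.
  have cI X : I X -> T \o (X \o adjo W) = (X \o adjo W) \o T.
    move=> IX; apply: hT; have := @commuting_push X W idfun IX IW; apply.
    by split; [exact: bnd_id|move=> G SG; split; case].
  pose y := adjo W \o T \o W.
  have ySg : vN_gen ip S y.
    split; first exact: (bnd_comp (bnd_comp (bIa IW) bT) (bI IW)).
    move=> B hB; apply/funext => x /=.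
    have e := cmp_eq (hT _ (commuting_push IW IW hB)) (W x); rewrite /= in e.
    rewrite (cmp_eq1 (iw_iso iw)) /= in e; rewrite /y /= e.
    by rewrite (cmp_eq1 (iw_iso iw)).
  exists y => //; apply: iw_eq => //; first by apply: (iw_img iw); exact: sub.
  move=> X IX; rewrite -(iw_l iw IX (sub _ ySg)); apply/funext => x /=.
  have := cmp_eq (cI X IX) (W x); rewrite /= => <-.
  by rewrite (cmp_eq1 (iw_iso iw)).
have Ny := sub _ ySg; split; first exact: (iw_img iw).
move=> B hB; have bB := hB.1.
apply: iw_eq; try by apply: bnd_comp => //; exact: (iw_img iw).
move=> X' IX'; apply/funext => xi.
have h X : I X -> adjo X (theta y (B (X' xi))) = adjo X (B (theta y (X' xi))).
  move=> IX; rewrite (cmp_eq (iw_r iw IX Ny)) -(cmp_eq (iw_l iw IX' Ny)).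
  exact: (cmp_eq (ySg.2 _ (commuting_conj IX IX' hB)) xi).
apply/subr0_eq/(iw_total iw) => X IX; rewrite (bndB (bIa IX)) /=.
by rewrite (h X IX) subrr.
Qed.

End Gen.

Lemma push_graph T : N T -> bnd T -> push I (graph T) = graph (theta T).
Proof.
move=> NT bT; apply/seteqP; split=> -[x y]; rewrite /push /graph /= => h.
  apply/subr0_eq/(iw_total iw) => X IX; rewrite (bndB (bIa IX)) h//.
  by rewrite (cmp_eq (iw_r iw IX NT)) subrr.
by move=> X IX; rewrite h (cmp_eq (iw_r iw IX NT)).
Qed.

End Fixed.
End Intertwiners.

(** * Cyclic and separating vectors, unitary implementation *)

Section Spatial.
Variables (R : realType) (H : completeNormedModType (Cx R)).
Variable ip : {dot H for Num.conj}.
Local Notation C := (Cx R).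
Local Notation op := (H -> H).
Local Notation uop := (set (H * H)%type).
Local Notation bnd := (@bounded_ops R H).
Local Notation adjo := (adjo ip).
Hypothesis ip_norm : forall x : H, ip x x = `|x| ^+ 2.

Lemma bnd_total_eq (D : set H) S T : bnd S -> bnd T ->
  (forall u, (forall z, D z -> ip u z = 0) -> u = 0) ->
  (forall z, D z -> S z = T z) -> S = T.
Proof.
move=> bS bT tD h; rewrite -(adjoK ip_norm bS) -(adjoK ip_norm bT); congr (adjo _).
apply/funext => u; apply/subr0_eq/tD => z Dz; rewrite ipBl.
by rewrite (adjoPr ip_norm _ _ bS) (adjoPr ip_norm _ _ bT) h// subrr.
Qed.

(** The last clause says that [Q] commutes with every operator reduced by [K]. With [K] the closure
    of an orbit of the cyclic vector, this places [Q] in a commutant. *)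
Lemma exists_projector K : Defs.subspace K -> closed K -> exists Q,
  [/\ bnd Q, forall x, K (Q x), forall x, K x -> Q x = x &
    forall B, bnd B -> (forall x, K x -> K (B x)) -> (forall x, K x -> K (adjo B x)) ->
      B \o Q = Q \o B].
Proof.
move=> sK cK; have [K0 KP] := sK.
have /choice [Q hQ] : forall x, exists y, K y /\ forall z, K z -> ip (x - y) z = 0.
  by move=> x; have [k Kk hk] := closed_projection ip_norm sK cK x; exists k.
have KB x y : K x -> K y -> K (x - y).
  by move=> Kx Ky; rewrite addrC -scaleN1r; exact: KP.
have uniq x k : K k -> (forall z, K z -> ip (x - k) z = 0) -> k = Q x.
  move=> Kk hk; apply/subr0_eq/(ip_eq0 ip_norm) => u.
  have Kd : K (k - Q x) by apply: KB => //; case: (hQ x).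
  suff -> : k - Q x = 0 by rewrite ip0l.
  suff e : ip (k - Q x) (k - Q x) = 0.
    by move: e; rewrite (ip_nr ip_norm) => /rc_inj/eqP; rewrite sqrf_eq0 => /eqP/nr_eq0.
  have -> : ip (k - Q x) (k - Q x) = ip (x - Q x) (k - Q x) - ip (x - k) (k - Q x).
    by rewrite -ipBl opprB [x - _ + _]addrC addrA subrK.
  by rewrite hk// (hQ x).2// subrr.
have nQ x : nr (Q x) <= nr x.
  have o : ip (x - Q x) (Q x) = 0 by apply: (hQ x).2; case: (hQ x).
  have := nr2D ip_norm (x - Q x) (Q x); rewrite o subrK raddf0 mulr0 addr0 => e.
  by rewrite -ler_sqr ?nnegrE ?nr_ge0// e lerDr sqr_ge0.
have bQ : bnd Q.
  apply: (@mk_bnd _ _ _ 1) => //; last by move=> x; rewrite mul1r.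
  move=> a x y; apply/esym/uniq; first by apply: KP; [case: (hQ x)|case: (hQ y)].
  move=> z Kz; rewrite opprD addrACA -scalerBr ipDl ipZl (hQ x).2// (hQ y).2//.
  by rewrite mulr0 addr0.
exists Q; split=> //; first by move=> x; case: (hQ x).
  by move=> x Kx; apply/esym/uniq => // z _; rewrite subrr ip0l.
move=> B bB BK BaK; apply/funext => x /=; apply: uniq.
  by apply: BK; case: (hQ x).
move=> z Kz; rewrite -(bndB bB) (adjoP ip_norm _ _ bB); apply: (hQ x).2; exact: BaK.
Qed.

(** A densely defined isometry is extended by closing its graph: the closure is still isometric,
    hence single valued, and it is everywhere defined. *)
Lemma isometric_graph (K : uop) : K 0 ->
  (forall (a : C) p q, K p -> K q -> K (a *: p + q)) ->
  (forall u, (forall p, K p -> ip u p.1 = 0) -> u = 0) ->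
  (forall p q, K p -> K q -> ip p.1 q.1 = ip p.2 q.2) ->
  exists U, [/\ bnd U, forall p, K p -> U p.1 = p.2 &
    forall x y, ip (U x) (U y) = ip x y].
Proof.
move=> K0 KP tK isoK; have cK := closure_subspace2 K0 KP.
pose L : uop := closure K.
have iso1 p q : L p -> K q -> ip p.1 q.1 = ip p.2 q.2.
  move=> Lp Kq; suff : perp2 ip [set (q.1, - q.2)] p.
    by move=> /(_ _ erefl); rewrite /gip /= ipNr => /subr0_eq.
  have [_ _ cp] := perp2_closed_subspace ip_norm [set (q.1, - q.2)].
  apply: cp; apply: closureS Lp => r Kr _ ->.
  by rewrite /gip /= ipNr isoK// subrr.
have iso p q : L p -> L q -> ip p.1 q.1 = ip p.2 q.2.
  move=> Lp Lq; suff : perp2 ip [set (p.1, - p.2)] q.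
    move=> /(_ _ erefl); rewrite /gip /= ipNr => /subr0_eq e.
    by rewrite ipC e -ipC.
  have [_ _ cp] := perp2_closed_subspace ip_norm [set (p.1, - p.2)].
  apply: cp; apply: closureS Lq => r Kr _ ->.
  by rewrite /gip /= ipNr (ipC ip r.1) iso1// -ipC subrr.
have hU x : exists y, L (x, y).
  (* the projection of (x, 0) on the graph of an isometry is (x, U x) / 2 *)
  have [g Lg hg] := exists_projection ip_norm cK (x, 0).
  exists (2 *: g.2); suff -> : (x, 2 *: g.2) = 2 *: g by exact: (csZ cK 2 Lg).
  congr (_, _); apply/subr0_eq/tK => p Kp.
  have := hg p (subset_closure Kp); rewrite /gip /= sub0r ipBl ipNl -(iso1 _ _ Lg Kp).
  by rewrite ipBl ipZl mulrDl mul1r opprD addrA.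
have [U {}hU] := choice hU.
have isoU x y : ip (U x) (U y) = ip x y by have := iso _ _ (hU x) (hU y).
have U_uniq x y : L (x, y) -> y = U x.
  move=> Lxy; apply/subr0_eq; have /= := csB cK Lxy (hU x); rewrite -/L => Ld.
  have := iso _ _ Ld Ld; rewrite /= subrr ip0l (ip_nr ip_norm) -rc0 => /rc_inj/esym/eqP.
  by rewrite sqrf_eq0 => /eqP/nr_eq0.
exists U; split=> //; last first.
  by move=> -[p1 p2] Kp /=; rewrite (U_uniq p1 p2)//; exact: subset_closure.
apply: (@mk_bnd _ _ _ 1) => //.
  by move=> a x y; apply/esym/U_uniq; exact: (csP cK a (hU x) (hU y)).
move=> x; rewrite mul1r -ler_sqr ?nnegrE ?nr_ge0// -rc_ler -!(ip_nr ip_norm).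
by rewrite isoU.
Qed.

Section Cyclic.
Variables (M : set op) (Om : H).
Hypothesis vM : von_neumann ip M.
Hypothesis cyc : dense [set y Om | y in M].
Hypothesis sep : forall y, M y -> y Om = 0 -> y = fun=> 0.

Lemma cyclic_total u : (forall y, M y -> ip u (y Om) = 0) -> u = 0.
Proof. by move=> h; apply: (dense_total ip_norm cyc) => _ [y My <-]; exact: h. Qed.

Lemma separating_eq y z : M y -> M z -> y Om = z Om -> y = z.
Proof.
move=> My Mz e; have Myz := vn_lincomb vM (-1) Mz My.
have h : (fun x => -1 *: z x + y x) = fun=> 0.
  by apply: sep => //; rewrite e scaleN1r addNr.
apply/funext => x; have /= := congr1 (fun f => f x) h.
by rewrite scaleN1r addrC => /subr0_eq.
Qed.

(** A separating vector is cyclic for the commutant. The projection [Q] on the closure of [K]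
    commutes with the commutant of [M], so it lies in [M]; it fixes [Om], and separation forces [Q]
    to be the identity. *)
Lemma commutant_total u : (forall z, commutant M z -> ip u (z Om) = 0) -> u = 0.
Proof.
move=> hu; pose K := [set z Om | z in commutant M].
have sM S : M S -> bnd S /\ M (adjo S).
  by move=> MS; split; [exact: (vn_bnd vM MS)|exact: (vn_adjo ip_norm vM MS)].
have sK : Defs.subspace K.
  split.
    exists (fun x => -1 *: idfun x + idfun x); last by rewrite scaleN1r addNr.
    by apply: commutant_lincomb; [move=> T /sM[]|exact: commutant_id|exact: commutant_id].
  move=> a _ _ [z Mz <-] [z' Mz' <-]; exists (fun x => a *: z x + z' x) => //.
  by apply: commutant_lincomb => // T /sM[].
have [Q [bQ QK idQ comQ]] := exists_projector (closure_subspace sK) (@closed_closure _ K).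
have invK B : commutant M B -> forall x, closure K x -> closure K (B x).
  move=> MB x /nr_closureP hx; apply/nr_closureP => e e0.
  have [c c0 hc] := bnd_norm MB.1.
  have [_ [z Mz <-] hz] := hx _ (divS_gt0 c0 (divr_gt0 e0 (ltr0n _ 2))).
  exists (B (z Om)); first by exists (B \o z) => //; exact: commutant_comp.
  rewrite -(bndB MB.1); apply: le_lt_trans (hc _) _.
  apply: le_lt_trans (ler_wpM2l c0 (ltW hz)) _.
  apply: le_lt_trans (mul_divS_le c0 _) _; first by rewrite divr_ge0// ltW.
  lra.
have MQ : M Q.
  apply: (vn_memP vM) => // B MB; have [bB MaB] := commutant_star ip_norm vM MB.
  by apply: comQ => //; exact: invK.
have KOm : K Om by exists idfun => //; exact: commutant_id.
have Q1 : Q = idfun.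
  apply: separating_eq => //; first exact: (vn_id vM).
  by rewrite idQ//; exact: subset_closure.
have Ku : closure K u by have := QK u; rewrite Q1.
have : ip u u = 0.
  apply: nr_lim0 => e e0; move/nr_closureP: Ku => /(_ _ (divS_gt0 (nr_ge0 u) e0)).
  move=> [_ [z Mz <-] hz]; rewrite -{2}(subrK (z Om) u) ipDr hu// addr0.
  apply: le_trans (cauchy_schwarz ip_norm _ _) _.
  by apply: le_trans (ler_wpM2l (nr_ge0 _) (ltW hz)) _; rewrite mul_divS_le ?nr_ge0// ltW.
by rewrite (ip_nr ip_norm) => /rc_inj/eqP; rewrite sqrf_eq0 => /eqP/nr_eq0.
Qed.

(** The map [y Om |-> beta y Om] is isometric because [beta] preserves the vector state of [Om]. Its
    inverse is built in the same way from the swapped graph, whose domain is total because [beta] is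
    onto. *)
Lemma implementation beta : star_iso ip M M beta ->
  (forall y, M y -> ip (beta y Om) Om = ip (y Om) Om) ->
  exists U, [/\ bnd U, U \o adjo U = idfun, adjo U \o U = idfun, U Om = Om &
    (forall y, M y -> U (y Om) = beta y Om) /\ forall y, M y -> U \o y = beta y \o U].
Proof.
move=> [[bM b1 bL bMul bStar] [_ bInj bSurj]] bE.
have bA y : M y -> beta (adjo y) = adjo (beta y).
  move=> My; apply: adjo_uniq => //; first exact: (vn_bnd vM (bM _ My)).
  apply: bStar => //; first exact: (vn_adjo ip_norm vM).
  by move=> ? ?; rewrite adjoP//; exact: (vn_bnd vM My).
have bip y z : M y -> M z -> ip (beta y Om) (beta z Om) = ip (y Om) (z Om).
  move=> My Mz; have Maz := vn_adjo ip_norm vM Mz.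
  have bz := vn_bnd vM Mz; have bbz := vn_bnd vM (bM _ Mz).
  have := bE _ (vn_comp vM Maz My); rewrite (bMul _ _ Maz My) (bA _ Mz) /=.
  by rewrite (adjoPr ip_norm _ _ bbz) (adjoPr ip_norm _ _ bz).
pose K : uop := [set p | exists2 y, M y & p = (y Om, beta y Om)].
pose K' : uop := [set p | exists2 y, M y & p = (beta y Om, y Om)].
have M0 : M (fun=> 0).
  have := vn_lincomb vM (-1) (vn_id vM) (vn_id vM).
  by congr (M _); apply/funext => x; rewrite /= scaleN1r addNr.
have bt0 : beta (fun=> 0) = fun=> 0.
  have := bL (-1) _ _ M0 M0.
  have -> : (fun x : H => -1 *: (0 : H) + (0 : H)) = (fun=> 0).
    by apply/funext => x; rewrite scaler0 addr0.
  by move=> ->; apply/funext => x; rewrite scaleN1r addNr.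
have cycB u : (forall y, M y -> ip u (beta y Om) = 0) -> u = 0.
  move=> h; apply: cyclic_total => z Mz; have [y My <-] := bSurj z Mz; exact: h.
have [||||U [bU hU isoU]] := @isometric_graph K.
- by exists (fun=> 0) => //; rewrite bt0.
- move=> a _ _ [y My ->] [z Mz ->]; exists (fun x => a *: y x + z x).
    exact: (vn_lincomb vM).
  by rewrite bL.
- by move=> u h; apply: cyclic_total => y My; apply: (h (y Om, beta y Om)); exists y.
- by move=> _ _ [y My ->] [z Mz ->] /=; rewrite bip.
have [||||V [bV hV isoV]] := @isometric_graph K'.
- by exists (fun=> 0) => //; rewrite bt0.
- move=> a _ _ [y My ->] [z Mz ->]; exists (fun x => a *: y x + z x).
    exact: (vn_lincomb vM).
  by rewrite bL.
- by move=> u h; apply: cycB => y My; apply: (h (beta y Om, y Om)); exists y.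
- by move=> _ _ [y My ->] [z Mz ->] /=; rewrite bip.
have Uy y : M y -> U (y Om) = beta y Om.
  by move=> My; apply: (hU (y Om, beta y Om)); exists y.
have Vy y : M y -> V (beta y Om) = y Om.
  by move=> My; apply: (hV (beta y Om, y Om)); exists y.
have UV : U \o V = idfun.
  apply: (@bnd_total_eq [set beta y Om | y in M]); first exact: bnd_comp.
  - exact: bnd_id.
  - by move=> u h; apply: cycB => y My; apply: h; exists y.
  - by move=> _ [y My <-] /=; rewrite Vy// Uy.
have VU : V \o U = idfun.
  apply: (@bnd_total_eq [set y Om | y in M]); first exact: bnd_comp.
  - exact: bnd_id.
  - by move=> u h; apply: cyclic_total => y My; apply: h; exists y.
  - by move=> _ [y My <-] /=; rewrite Uy// Vy.
have aU : adjo U = V.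
  apply/esym/(adjo_uniq ip_norm bU) => x y.
  by have /= e := cmp_eq1 UV y; rewrite -{1}e isoU.
exists U; rewrite aU; split=> //.
  by rewrite -{1}[Om]/(idfun Om) Uy ?b1//; exact: (vn_id vM).
split=> //.
move=> y My; apply: (@bnd_total_eq [set y Om | y in M]).
- by apply: bnd_comp => //; exact: (vn_bnd vM My).
- by apply: bnd_comp => //; exact: (vn_bnd vM (bM _ My)).
- by move=> u h; apply: cyclic_total => z Mz; apply: h; exists z.
- move=> _ [z Mz <-] /=; rewrite (Uy _ Mz).
  by have := Uy _ (vn_comp vM My Mz); rewrite (bMul _ _ My Mz).
Qed.

Lemma unitary_intertwiner (N : set op) theta U : bnd U -> U \o adjo U = idfun ->
  adjo U \o U = idfun -> (forall y, N y -> U \o y = theta y \o U) ->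
  (forall y, N y -> bnd (theta y)) -> intertwiner ip N theta [set U] U.
Proof.
move=> bU UV VU hU bth; split=> //.
- by move=> _ ->.
- by move=> _ y -> /hU.
- move=> _ y -> Ny; apply/funext => x /=.
  have /= e := cmp_eq1 UV x; rewrite -{1}e.
  by rewrite -(cmp_eq (hU _ Ny)) (cmp_eq1 VU).
- by move=> u /(_ U erefl) h; have /= <- := cmp_eq1 UV u; rewrite h bnd0.
Qed.

End Cyclic.
End Spatial.

(** * Increments of a noise *)

Section Increments.
Variables (R : realType) (H : completeNormedModType (Cx R)).
Variable ip : {dot H for Num.conj}.
Local Notation op := (H -> H).
Local Notation uop := (set (H * H)%type).
Local Notation bnd := (@bounded_ops R H).
Local Notation op_adj := (op_adj ip).
Hypothesis ip_norm : forall x : H, ip x x = `|x| ^+ 2.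

Lemma op_scaleN1 (G : uop) : closed_subspace G -> op_scale (-1) G = [set p | G (p.1, - p.2)].
Proof.
move=> cG; apply/seteqP; split=> p.
  move=> /nr_closure2P hp; apply: (csC cG); apply/nr_closure2P => e e0.
  have [q [[u Gu q2] k1 k2]] := hp e e0; exists (q.1, u); split=> //=.
  by rewrite -nrN opprB opprK addrC; move: k2; rewrite q2 scaleN1r opprK.
move=> Gp; apply: subset_closure; exists (- p.2) => //.
by rewrite scaleN1r opprK.
Qed.

Lemma graph_uniq (G : uop) x u v : closed_op G -> G (x, u) -> G (x, v) -> u = v.
Proof.
move=> cG Gu Gv; apply/subr0_eq/(co_univalent cG).
by have /= := csB (closed_op_subspace cG) Gu Gv; rewrite -[(x, u) - _]/(x - x, u - v) subrr.
Qed.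

Definition difference_on (D : set H) (G1 G2 G3 : uop) : Prop := forall x, D x ->
  exists u v, [/\ G1 (x, u), G2 (x, v) & G3 (x, u - v)].

(** As [D] is a core of [G3], the pointwise identity yields only that [G3] is contained in the
    closed difference. The other inclusion is by duality: the identity for the adjoints, on a core
    of [op_adj G3], shows that every vector of the difference pairs correctly with [op_adj G3],
    hence lies in its adjoint [G3]. *)
Lemma op_sub_core (D : set H) (G1 G2 G3 : uop) :
  closed_op G2 -> closed_op G3 -> closed_op (op_adj G3) ->
  core G3 D -> core (op_adj G3) D ->
  difference_on D G1 G2 G3 -> difference_on D (op_adj G1) (op_adj G2) (op_adj G3) ->
  op_sub G1 G2 = G3.
Proof.
move=> cG2 cG3 cG3' [_ core3] [_ core3'] h h'.
have s2 := closed_op_subspace cG2; have s3 := closed_op_subspace cG3.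
rewrite /op_sub op_scaleN1//; apply/seteqP; split; last first.
  rewrite -core3; apply: closureS => -[x y] [Gp [/= Dx _]].
  have [u [v [G1u G2v G3uv]]] := h _ Dx.
  exists u, (- v); split=> //=; first by rewrite opprK.
  exact: graph_uniq cG3 Gp G3uv.
move=> p0 hp0; apply: (csC s3); apply: closureS hp0 => p [u [v [G1u G2v pE]]] {p0}.
rewrite -(op_adjK ip_norm s3) => q hq.
suff : op_adj [set p] q by move=> /(_ p erefl) e; rewrite ipC -e -ipC.
apply: (csC (op_adj_closed_subspace ip_norm [set p])).
move: hq; rewrite -{1}core3'; apply: closureS => -[x y] [Gq [/= Dx _]] _ ->.
have [u' [v' [G1u' G2v' G3uv']]] := h' _ Dx.
rewrite (graph_uniq cG3' Gq G3uv') /= pE ipDl (G1u' (p.1, u) G1u).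
have /= e := G2v' (p.1, - v) G2v; rewrite ipNl in e.
by rewrite ipBr -e opprK.
Qed.

Lemma commutes_with_sub (B : op) (G1 G2 : uop) : bnd B -> closed_subspace G2 ->
  commutes_with B G1 -> commutes_with B G2 -> commutes_with B (op_sub G1 G2).
Proof.
move=> bB s2 B1 B2; rewrite /op_sub (op_scaleN1 s2) => p.
apply: closure_map => // q [u [v [G1u G2v qE]]].
exists (B u), (B v); split; first exact: (B1 (q.1, u)).
  by rewrite /= -(bndN bB); exact: (B2 (q.1, - v)).
by rewrite /= qE (bndD bB).
Qed.

Section Noise.
Variables (A : lmodType (Cx R)) (br : A -> A -> A) (star : A -> A).
Variables (j : R -> A -> uop) (alpha : R -> op -> op) (rho : op) (M : set op).
Variables (D : set H) (U : R -> op).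
Hypothesis qn : quantum_noise ip br star j alpha rho.
Hypothesis vM : von_neumann ip M.
Hypothesis Mnoise : M = noise_alg ip j.
Hypothesis shM : shift_relation ip M alpha j.
Hypothesis autM : aut_group ip M alpha.
Hypothesis cD : common_domain ip alpha j D.
Hypothesis iwU : forall t, intertwiner ip M (alpha t) [set U t] (U t).

Local Notation affiliated := (affiliated ip).

Let sD : Defs.subspace D. Proof. by case: cD. Qed.

Lemma noise_affiliated t x : affiliated M (j t x).
Proof.
have [G [_ [a [b [Ma Mb ch _]]]] _] := shM t 0 x.
by split; [exact: (qn_closed qn)|exists a, b].
Qed.

Lemma noise_subspace t x : closed_subspace (j t x).
Proof. exact/closed_op_subspace/(qn_closed qn). Qed.

(** The operator [alpha_s(j_t(x))]: the first argument is the shift, the second the time of the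
    noise. *)
Definition shifted s t x : uop := push ip [set U s] (j t x).

Lemma shifted_affiliated s t x : affiliated M (shifted s t x).
Proof.
have [c [a [b [[a' Ma' <-] [b' Mb' <-] ch]]]] :=
  push_affiliated ip_norm (iwU s) (noise_affiliated t x).
have sub y : M y -> M (alpha s y) by exact: (sh_maps (ag_aut autM s).1).
by split=> //; exists (alpha s a'), (alpha s b'); split=> //; exact: sub.
Qed.

Lemma noise_shift s t x : j (t + s) x = op_add (j t x) (shifted t s x).
Proof.
have [G hG ->] := shM s t x; congr (op_add _ _).
exact: (op_image_push ip_norm (iwU t) (qn_closed qn s x) hG).
Qed.

Lemma shifted_core s t x : core (shifted s t x) D.
Proof.
case: cD => _ _ _ h _; apply: (h t s x).
have [c [a [b [Ma Mb ch ch']]]] := push_op_image ip_norm (iwU s) (noise_affiliated t x).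
by split=> //; exists a, b; split=> //; exact: (vn_bnd vM).
Qed.

Lemma shifted_adj s t x : op_adj (shifted s t x) = shifted s t (star x).
Proof.
rewrite /shifted (push_adj ip_norm (iwU s)) ?(qn_star qn)//.
  exact: noise_subspace.
exact: stable_affiliated (noise_affiliated t x).
Qed.

Lemma noise_dom t x xi : D xi -> Defs.dom (j t x) xi.
Proof. by move=> Dxi; case: cD => _ _ /(_ t x)[[h _] _] _ _; exact: h. Qed.

Lemma shifted_difference s t x : difference_on D (j t x) (j s x) (shifted s (t - s) x).
Proof.
move=> xi Dxi.
have [u ju] := noise_dom t x Dxi; have [v jv] := noise_dom s x Dxi.
have [+ _] := shifted_core s (t - s) x; move=> /(_ _ Dxi)[z Gz].
exists u, v; split=> //; suff -> : u - v = z by [].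
have : j (s + (t - s)) x (xi, v + z).
  rewrite noise_shift; apply: subset_closure; by exists v, z.
rewrite addrC subrK => juz.
by rewrite (graph_uniq (qn_closed qn t x) ju juz) addrC addKr.
Qed.

(** Stationarity of increments: the relation [j_t = j_s + alpha_s(j_(t-s))] solved for the second
    summand. Closedness, affiliation, adjoints and cores of increments are read off from the
    right-hand side. *)
Lemma incr_shifted s t x : incr j s t x = shifted s (t - s) x.
Proof.
apply: (@op_sub_core D).
- exact: (qn_closed qn).
- by case: (shifted_affiliated s (t - s) x).
- by rewrite shifted_adj; case: (shifted_affiliated s (t - s) (star x)).
- exact: shifted_core.
- by rewrite shifted_adj; exact: shifted_core.
- exact: shifted_difference.
- by rewrite -!(qn_star qn) shifted_adj; exact: shifted_difference.
Qed.

Lemma incr_affiliated s t x : affiliated M (incr j s t x).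
Proof. by rewrite incr_shifted; exact: shifted_affiliated. Qed.

Lemma incr_adj s t x : op_adj (incr j s t x) = incr j s t (star x).
Proof. by rewrite !incr_shifted shifted_adj. Qed.

Lemma incr_core s t x : core (incr j s t x) D.
Proof. by rewrite incr_shifted; exact: shifted_core. Qed.

Lemma incr_split r s t x : op_sub (incr j r t x) (incr j r s x) = incr j s t x.
Proof.
have h y : difference_on D (incr j r t y) (incr j r s y) (incr j s t y).
  move=> xi Dxi; rewrite !incr_shifted.
  have [u [v [ju jv Gst]]] := shifted_difference s t y Dxi.
  have [u1 [w [ju1 jw Grt]]] := shifted_difference r t y Dxi.
  have [v1 [w1 [jv1 jw1 Grs]]] := shifted_difference r s y Dxi.
  exists (u1 - w), (v1 - w1); split=> //; suff -> : u1 - w - (v1 - w1) = u - v by [].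
  rewrite (graph_uniq (qn_closed qn t y) ju1 ju) (graph_uniq (qn_closed qn s y) jv1 jv).
  by rewrite (graph_uniq (qn_closed qn r y) jw1 jw) opprB addrA subrK.
apply: (@op_sub_core D).
- by case: (incr_affiliated r s x).
- by case: (incr_affiliated s t x).
- by rewrite incr_adj; case: (incr_affiliated s t (star x)).
- exact: incr_core.
- by rewrite incr_adj; exact: incr_core.
- exact: h.
- by rewrite !incr_adj; exact: h.
Qed.

Lemma incr0 t x : incr j 0 t x = j t x.
Proof.
have h y : difference_on D (j t y) (j 0 y) (j t y).
  move=> xi Dxi; have [u ju] := noise_dom t y Dxi.
  by exists u, 0; rewrite subr0; split=> //; rewrite (qn_zero qn).
have cj : core (j t x) D by case: cD => _ _ /(_ t x)[].
have cj' : core (j t (star x)) D by case: cD => _ _ /(_ t (star x))[].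
apply: (@op_sub_core D) => //; rewrite -?(qn_star qn)//; exact: (qn_closed qn).
Qed.

Lemma noise_incr s t x : op_sub (incr j s t x) (incr j s 0 x) = j t x.
Proof. by rewrite incr_split incr0. Qed.

(** Both sides are images of [j (t - s) x], under [alpha r] after [alpha s] and under
    [alpha (r + s)]. The group law applies to the bounded characteristic pair, which determines the
    operator. *)
Lemma push_incr r s t x : push ip [set U r] (incr j s t x) = incr j (r + s) (r + t) x.
Proof.
rewrite !incr_shifted /shifted.
have a1 := noise_affiliated (t - s) x.
have [c1 [a [b [Ma Mb ch ch1]]]] := push_op_image ip_norm (iwU s) a1.
have aS := shifted_affiliated s (t - s) x.
have subM q y : M y -> M (alpha q y) by exact: (sh_maps (ag_aut autM q).1).
have -> : r + t - (r + s) = t - s by rewrite opprD addrACA subrr add0r.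
apply: (@char_pair_inj _ _ _ ip_norm _ _ (alpha (r + s) a) (alpha (r + s) b)).
- exact: (push_closed_op ip_norm (iwU r) c1 (stable_affiliated ip_norm (iwU r) aS)).
- exact: (push_closed_op ip_norm (iwU (r + s)) (qn_closed qn _ _)
    (stable_affiliated ip_norm (iwU _) a1)).
- rewrite !(ag_add autM)//; apply: (push_char ip_norm (iwU r)) => //.
  + exact: closed_op_subspace.
  + exact: (stable_affiliated ip_norm (iwU r) aS).
  + exact: subM.
  + exact: subM.
- apply: (push_char ip_norm (iwU (r + s))) => //.
  + exact: noise_subspace.
  + exact: (stable_affiliated ip_norm (iwU (r + s)) a1).
Qed.

Definition future (t : R) : set uop := [set G | exists r x, t <= r /\ G = incr j t r x].

Lemma future_affiliated t G : future t G -> affiliated M G.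
Proof. by move=> [r [x [_ ->]]]; exact: incr_affiliated. Qed.

Lemma future_vN t : von_neumann ip (future_alg ip j t).
Proof.
apply: (vN_gen_vN ip_norm) => G /future_affiliated[cG _]; exact: closed_op_subspace.
Qed.

Lemma future_sub t : future_alg ip j t `<=` M.
Proof. apply: (vN_gen_sub ip_norm vM) => G; exact: future_affiliated. Qed.

Lemma future_shift r t : alpha r @` future_alg ip j t = future_alg ip j (r + t).
Proof.
rewrite /future_alg -/(future t) -/(future (r + t)).
rewrite -(vN_gen_push ip_norm (iwU r) vM); last by move=> G; exact: future_affiliated.
congr (vN_gen _ _); apply/seteqP; split.
  move=> _ [_ [s [x [ts ->]]] <-]; exists (r + s), x; rewrite lerD2l; split=> //.
  exact: push_incr.
move=> _ [s [x [ts ->]]]; exists (incr j t (s - r) x).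
  by exists (s - r), x; rewrite lerBrDl.
by rewrite push_incr [r + (s - r)]addrC subrK.
Qed.

(** An increment starting at [t] is the difference of two increments starting at the earlier time
    [s]. *)
Lemma future_mono s t : s <= t -> future_alg ip j t `<=` future_alg ip j s.
Proof.
move=> st; apply: commutant_anti => B [bB hB]; split=> // G [r [x [tr ->]]].
have h y : commutes_with B (incr j t r y).
  rewrite -(incr_split s); apply: commutes_with_sub => //.
  - by apply/closed_op_subspace; case: (incr_affiliated s t y).
  - by apply: (hB _ _).1; exists r, y; split=> //; exact: le_trans tr.
  - by apply: (hB _ _).1; exists t, y.
by split; rewrite ?incr_adj.
Qed.

Variable Om : H.
Hypothesis cyc : dense [set y Om | y in M].

Lemma future_total (Q : op) : bnd Q -> (forall s y, future_alg ip j s y -> Q \o y = y \o Q) ->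
  forall y, M y -> Q \o y = y \o Q.
Proof.
move=> bQ hQ y; rewrite Mnoise => My; apply/esym/My.2; split=> // _ [t [x ->]].
have h s r z : s <= r -> commutes_with Q (incr j s r z).
  move=> sr; apply: (affiliated_comm ip_norm _ bQ (hQ s)).
  by apply: (affiliated_vN_gen ip_norm vM) (incr_affiliated s r z); exists r, z.
have hj z : commutes_with Q (j t z).
  (* Starting both increments at [min t 0] puts them in a future algebra for negative [t] too. *)
  rewrite -(noise_incr (Num.min t 0)); apply: commutes_with_sub => //.
  - by apply/closed_op_subspace; case: (incr_affiliated (Num.min t 0) 0 z).
  - by apply: h; rewrite ge_min lexx.
  - by apply: h; rewrite ge_min lexx orbT.
by split; rewrite -?(qn_star qn).
Qed.

(** The projection [Q] on the closure of [K] commutes with every future algebra, hence with [M] by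
    [future_total]. It fixes [Om], which is cyclic for [M], so [Q] is the identity. *)
Lemma future_dense : dense [set y Om | y in \bigcup_s future_alg ip j s].
Proof.
pose K := [set y Om | y in \bigcup_s future_alg ip j s].
have sK : Defs.subspace K.
  split.
    exists (fun x => -1 *: idfun x + idfun x); last by rewrite scaleN1r addNr.
    by exists 0 => //; apply: (vn_lincomb (future_vN 0)); exact: (vn_id (future_vN 0)).
  move=> a _ _ [y [s _ Fy] <-] [z [t _ Fz] <-].
  exists (fun x => a *: y x + z x) => //; exists (Num.min s t) => //.
  apply: (vn_lincomb (future_vN _)).
    by apply: future_mono Fy; rewrite ge_min lexx.
  by apply: future_mono Fz; rewrite ge_min lexx orbT.
have [Q [bQ QK idQ comQ]] := exists_projector ip_norm (closure_subspace sK) (@closed_closure _ K).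
have KF s y : future_alg ip j s y -> forall x, closure K x -> closure K (y x).
  move=> Fy x /nr_closureP hx; apply/nr_closureP => e e0.
  have by_ := vn_bnd (future_vN s) Fy; have [c c0 hc] := bnd_norm by_.
  have [_ [z [t _ Fz] <-] hz] := hx _ (divS_gt0 c0 (divr_gt0 e0 (ltr0n _ 2))).
  exists (y (z Om)).
    exists (y \o z) => //; exists (Num.min s t) => //.
    apply: (vn_comp (future_vN _)).
      by apply: future_mono Fy; rewrite ge_min lexx.
    by apply: future_mono Fz; rewrite ge_min lexx orbT.
  rewrite -(bndB by_); apply: le_lt_trans (hc _) _.
  apply: le_lt_trans (ler_wpM2l c0 (ltW hz)) _.
  apply: le_lt_trans (mul_divS_le c0 _) _; first by rewrite divr_ge0// ltW.
  lra.
have Qcomm := @future_total Q bQ.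
have QM y : M y -> Q \o y = y \o Q.
  apply: Qcomm => s z Fz; apply/esym/comQ; first exact: vn_bnd (future_vN s) _ Fz.
    exact: KF Fz.
  by apply: (KF s); exact: (vn_adjo ip_norm (future_vN s)).
have QOm : Q Om = Om.
  apply: idQ; apply: subset_closure; exists idfun => //; exists 0 => //.
  exact: (vn_id (future_vN 0)).
have Q1 : Q = idfun.
  apply: (@bnd_total_eq _ _ _ ip_norm [set y Om | y in M]) => //; first exact: bnd_id.
    by move=> u h; apply: (dense_total ip_norm cyc).
  by move=> _ [y My <-]; rewrite (cmp_eq (QM y My)) QOm.
by apply/nr_denseP => x; apply/nr_closureP; have := QK x; rewrite Q1.
Qed.

End Noise.
End Increments.

(** * The limit of the cocycle *)

Section Limits.
Variables (R : realType) (H : completeNormedModType (Cx R)).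
Variable ip : {dot H for Num.conj}.
Local Notation C := (Cx R).
Local Notation rc := (@rc R).
Hypothesis ip_norm : forall x : H, ip x x = `|x| ^+ 2.

Lemma nr_cvg_bounded T (F : set_system T) {FF : Filter F} (f : T -> H) (l : H) :
  f @ F --> l -> \forall i \near F, nr (f i) < nr l + 1.
Proof.
move=> /nr_cvgP/(_ 1 ltr01); apply: filterS => i h.
by have := nrD (f i - l) l; rewrite subrK nrB; lra.
Qed.

Lemma ip_cvg T (F : set_system T) {FF : Filter F} (f g : T -> H) (l m : H) :
  f @ F --> l -> g @ F --> m -> ip (f i) (g i) @[i --> F] --> ip l m.
Proof.
move=> fl gm; apply/nr_cvgP => e e0.
have e20 : 0 < e / 2 by rewrite divr_gt0.
have gb : \forall i \near F, nr (g i) < nr m + 1 by exact: nr_cvg_bounded.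
have m1 : 0 <= nr m + 1 by rewrite addr_ge0// nr_ge0.
move/nr_cvgP: fl => /(_ _ (divS_gt0 m1 e20)) fl.
move/nr_cvgP: (gm) => /(_ _ (divS_gt0 (nr_ge0 l) e20)) {}gm.
near=> i.
have -> : ip l m - ip (f i) (g i) = ip (l - f i) (g i) + ip l (m - g i).
  by rewrite ipBl ipBr [RHS]addrC addrA subrK.
apply: le_lt_trans (nrD _ _) _.
have h1 : nr (ip l (m - g i)) <= e / 2.
  apply: le_trans (cauchy_schwarz ip_norm _ _) _.
  apply: le_trans (ler_wpM2l (nr_ge0 _) (ltW (_ : _ < e / 2 / (nr l + 1)))) _.
    by near: i.
  by rewrite mul_divS_le ?nr_ge0// ltW.
have h2 : nr (ip (l - f i) (g i)) < e / 2.
  apply: le_lt_trans (cauchy_schwarz ip_norm _ _) _.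
  have a1 : nr (l - f i) < e / 2 / (nr m + 1 + 1) by near: i.
  have a2 : nr (g i) < nr m + 1 by near: i.
  apply: le_lt_trans (ler_wpM2l (nr_ge0 _) (ltW a2)) _.
  apply: le_lt_trans (ler_wpM2r m1 (ltW a1)) _.
  by rewrite mulrC mul_divS_lt.
by rewrite [e]splitr addrC ler_ltD.
Unshelve. all: by end_near. Qed.

Lemma cvg_uniq T (F : set_system T) {FF : ProperFilter F} (f : T -> H) (l m : H) :
  f @ F --> l -> f @ F --> m -> l = m.
Proof. by move=> fl fm; apply: cvg_unique fl fm. Qed.

Lemma cvg_uniqC T (F : set_system T) {FF : ProperFilter F} (f : T -> C) (l m : C) :
  f @ F --> l -> f @ F --> m -> l = m.
Proof. by move=> fl fm; apply: cvg_unique fl fm. Qed.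

Lemma cauchy_ex_cvg (V : completeNormedModType C) T (F : set_system T) {FF : ProperFilter F}
    (f : T -> V) :
  (forall e : R, 0 < e -> exists x, \forall i \near F, nr (x - f i) < e) ->
  exists l : V, f @ F --> l.
Proof.
move=> h; suff hf : cvg (f @ F) by exists (lim (f @ F)).
apply/cauchy_cvgP/cauchy_exP => e e0.
have eR : e = rc (complex.Re e) by rewrite rc_Re// ltW.
have e0' : 0 < complex.Re e by rewrite -(rc_ltr 0) -eR.
have [x hx] := h _ e0'; exists x; apply: filterS hx => i /=.
by rewrite -ball_normE /= nrE eR rc_ltr.
Qed.

Lemma near_pinfty_sub (P : R -> Prop) (s : R) :
  (\forall t \near +oo, P t) -> \forall t \near +oo, P (t - s).
Proof.
move=> [N [_ hN]]; exists (N + s); split; first exact: num_real.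
by move=> t Nt; apply: hN; rewrite ltrBrDr.
Qed.

End Limits.

Section CocycleLimit.
Variables (R : realType) (H : completeNormedModType (Cx R)).
Variable ip : {dot H for Num.conj}.
Local Notation op := (H -> H).
Local Notation bnd := (@bounded_ops R H).
Local Notation adjo := (adjo ip).
Hypothesis ip_norm : forall x : H, ip x x = `|x| ^+ 2.

Variables (M : set op) (Om : H) (alpha w : R -> op -> op) (F : R -> set op).
Variables (U Wu : R -> op).
Hypothesis vM : von_neumann ip M.
Hypothesis sep : forall y, M y -> y Om = 0 -> y = fun=> 0.
Hypothesis autM : aut_group ip M alpha.
Hypothesis w_aut : forall t, star_iso ip M M (w t).
Hypothesis w_id : forall y, M y -> w 0 y = y.
Hypothesis w_cocycle : forall s t y, M y ->
  w (s + t) y = w s (alpha s (w t (alpha (- s) y))).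
Hypothesis w_markov : forall t y, 0 <= t -> F t y -> w t y = y.
Hypothesis F_sub : forall t, F t `<=` M.
Hypothesis F_shift : forall r t, alpha r @` F t = F (r + t).
Hypothesis F_dense : dense [set y Om | y in \bigcup_s F s].
Hypothesis bU : forall t, bnd (U t).
Hypothesis UU : forall t, U t \o adjo (U t) = idfun.
Hypothesis UM : forall t y, M y -> U t \o y = alpha t y \o U t.
Hypothesis bW : forall t, bnd (Wu t).
Hypothesis WW : forall t, Wu t \o adjo (Wu t) = idfun.
Hypothesis WW' : forall t, adjo (Wu t) \o Wu t = idfun.
Hypothesis WOm : forall t, Wu t Om = Om.
Hypothesis WM : forall t y, M y -> Wu t \o y = w t y \o Wu t.

Let wM t y : M y -> M (w t y). Proof. exact: (sh_maps (w_aut t).1). Qed.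
Let aM t y : M y -> M (alpha t y). Proof. exact: (sh_maps (ag_aut autM t).1). Qed.

Lemma aut_inj (beta : op -> op) y z : star_iso ip M M beta -> M y -> M z ->
  beta y = beta z -> y = z.
Proof. by move=> [_ [_ h _]] My Mz; apply: h; rewrite inE. Qed.

Lemma aut_groupNK t y : M y -> alpha (- t) (alpha t y) = y.
Proof. by move=> My; rewrite -(ag_add autM)// addNr (ag_id autM). Qed.

(** The Markov property concerns nonnegative times only. At time 0 the cocycle identity reads
    [w_r (alpha_r (w_(-r) z)) = alpha_r z], and [alpha_r z] lies in the future from [r], where [w_r]
    is the identity; cancelling [w_r] and [alpha_r] leaves the claim. *)
Lemma cocycle_future0 r z : 0 <= r -> F 0 z -> w (- r) z = z.
Proof.
move=> r0 Fz; have Mz := F_sub Fz; have Maz := aM r Mz.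
have Faz : F r (alpha r z) by rewrite -[r in F r]addr0 -F_shift; exists z.
have := w_cocycle r (- r) Maz; rewrite subrr w_id// aut_groupNK// => e.
have Mwz := wM (- r) Mz.
apply: (aut_inj (ag_aut autM r)) => //.
apply: (aut_inj (w_aut r)) => //; first exact: aM.
by rewrite -e w_markov.
Qed.

Lemma cocycle_stationary s r y : 0 <= r -> F (- s) y -> w (- s - r) y = w (- s) y.
Proof.
move=> r0 Fy; have My := F_sub Fy; rewrite w_cocycle// opprK.
rewrite cocycle_future0//; first by rewrite aut_groupNK.
by rewrite -(subrr s) -F_shift; exists y.
Qed.

Lemma cocycle_eventually y s : F s y ->
  exists N, forall t, N <= t -> w (- t) y = w (- N) y.
Proof.
move=> Fy; exists (- s) => t Nt.
have -> : - t = - (- s) - (t + s) by rewrite opprK opprD [- t - s]addrC addrA subrr add0r.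
by rewrite cocycle_stationary// ?opprK// -lerBlDr sub0r.
Qed.

Lemma Wu_y t y : M y -> Wu t (y Om) = w t y Om.
Proof. by move=> My; rewrite (cmp_eq (WM t My)) WOm. Qed.

Lemma Wu_ip t x y : ip (Wu t x) (Wu t y) = ip x y.
Proof. by rewrite (adjoP ip_norm _ _ (bW t)) (cmp_eq1 (WW' t)). Qed.

Lemma Wu_nr t x : nr (Wu t x) = nr x.
Proof. exact: (isometry_nr ip_norm). Qed.

Lemma Wu_adjo_nr t x : nr (adjo (Wu t) x) = nr x.
Proof. by rewrite -(Wu_nr t) (cmp_eq1 (WW t)). Qed.

Lemma Wu_cvg x : exists l : H, Wu (- t) x @[t --> +oo] --> l.
Proof.
apply: cauchy_ex_cvg => e e0.
have /nr_denseP := F_dense => /(_ x e e0) [_ [y [s _ Fy] <-] hy].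
have [N hN] := cocycle_eventually Fy; have My := F_sub Fy.
exists (Wu (- N) (y Om)); exists N; split; first exact: num_real.
move=> t /ltW Nt; rewrite (Wu_y _ My) -(hN t Nt) -(Wu_y _ My) -(bndB (bW _)) Wu_nr nrB//.
Qed.

Definition Winf : op := fun x => lim (Wu (- t) x @[t --> +oo]).

Lemma WinfP x : Wu (- t) x @[t --> +oo] --> Winf x.
Proof. by have [l hl] := Wu_cvg x; apply: cvgP hl. Qed.

Arguments WinfP x : clear implicits.

Lemma Winf_ip x y : ip (Winf x) (Winf y) = ip x y.
Proof.
apply: (cvg_uniqC (ip_cvg ip_norm (WinfP x) (WinfP y))).
by under eq_fun do rewrite Wu_ip; exact: cvg_cst.
Qed.

Lemma bnd_Winf : bnd Winf.
Proof.
apply: (@mk_bnd _ _ _ 1) => //.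
  move=> a x y; apply: (cvg_uniq (WinfP _)).
  under eq_fun do rewrite (bndP (bW _)).
  by apply: cvgD; [apply: cvgZr; exact: WinfP|exact: WinfP].
move=> x; rewrite mul1r -ler_sqr ?nnegrE ?nr_ge0// -rc_ler -!(ip_nr ip_norm).
by rewrite Winf_ip.
Qed.

Lemma Winf_iso : adjo Winf \o Winf = idfun.
Proof.
apply/funext => x; apply: (ip_inj ip_norm) => y /=.
by rewrite (adjoPr ip_norm _ _ bnd_Winf) Winf_ip.
Qed.

Lemma Winf_Om : Winf Om = Om.
Proof.
by apply: (cvg_uniq (WinfP _)); under eq_fun do rewrite WOm; exact: cvg_cst.
Qed.

Lemma w_spatial t y : M y -> w t y = Wu t \o y \o adjo (Wu t).
Proof.
by move=> My; apply/funext => x /=; rewrite (cmp_eq (WM t My)) (cmp_eq1 (WW t)).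
Qed.

(** The constant has to be uniform in [t] for convergence to extend from a dense set of vectors;
    this comes from the unitary implementation. *)
Lemma w_bound y : M y -> exists2 c, 0 <= c & forall t x, nr (w t y x) <= c * nr x.
Proof.
move=> My; have [c c0 hc] := bnd_norm (vn_bnd vM My); exists c => // t x.
by rewrite w_spatial//= Wu_nr -(Wu_adjo_nr t x).
Qed.

Lemma w_commutant t y z : M y -> commutant M z -> w t y \o z = z \o w t y.
Proof. by move=> My [_ hz]; rewrite hz//; exact: wM. Qed.

Lemma w_cvg y x : M y -> exists l : H, w (- t) y x @[t --> +oo] --> l.
Proof.
move=> My; have [c c0 hc] := w_bound My.
apply: cauchy_ex_cvg => e e0; have e20 : 0 < e / 2 by rewrite divr_gt0.
have Ksub : Defs.subspace [set z Om | z in commutant M].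
  have sM : M `<=` bnd by move=> T; exact: (vn_bnd vM).
  split.
    exists (fun x => -1 *: idfun x + idfun x); last by rewrite scaleN1r addNr.
    by apply: commutant_lincomb => //; exact: commutant_id.
  move=> a _ _ [z Mz <-] [z' Mz' <-]; exists (fun x => a *: z x + z' x) => //.
  exact: commutant_lincomb.
have /nr_denseP dK : dense [set z Om | z in commutant M].
  apply: (total_dense ip_norm Ksub) => u hu.
  by apply: (commutant_total ip_norm vM sep) => z Mz; apply: hu; exists z.
have [_ [z Mz <-] hz] := dK x _ (divS_gt0 c0 e20).
have bz := Mz.1.
have cz : z (Wu (- t) (y Om)) @[t --> +oo] --> z (Winf (y Om)).
  by apply: (bnd_cvg bz); exact: WinfP.
exists (z (Winf (y Om))).
move/nr_cvgP: cz => /(_ _ e20); apply: filterS => t ht.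
have e1 : w (- t) y (z Om) = z (Wu (- t) (y Om)).
  by rewrite (cmp_eq (w_commutant (- t) My Mz)) Wu_y.
rewrite [e]splitr; apply: le_lt_trans (nr_tri (w (- t) y (z Om)) _ _) _.
rewrite e1 ltr_leD// -e1 -(bndB (vn_bnd vM (wM _ My))).
apply: le_trans (hc _ _) _; rewrite nrB.
by apply: le_trans (ler_wpM2l c0 (ltW hz)) _; rewrite mul_divS_le// ltW.
Qed.

Definition winf (y : op) : op := fun x => lim (w (- t) y x @[t --> +oo]).

Lemma winfP y x : M y -> w (- t) y x @[t --> +oo] --> winf y x.
Proof. by move=> My; have [l hl] := w_cvg x My; apply: cvgP hl. Qed.

Arguments winfP [y] x My.

Lemma winf_bound y : M y -> exists2 c, 0 <= c & forall x, nr (winf y x) <= c * nr x.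
Proof.
move=> My; have [c c0 hc] := w_bound My; exists c => // x.
apply/ler_addgt0Pl => e e0; have /nr_cvgP/(_ _ e0) [N [_ hN]] := winfP x My.
have := hN (N + 1); rewrite ltrDl => /(_ ltr01) h.
have := nrD (winf y x - w (- (N + 1)) y x) (w (- (N + 1)) y x); rewrite subrK => h1.
have := hc (- (N + 1)) x; lra.
Qed.

Lemma bnd_winf y : M y -> bnd (winf y).
Proof.
move=> My; have [c c0 hc] := winf_bound My; apply: (mk_bnd c0) => // a u v.
apply: (cvg_uniq (winfP _ My)).
under eq_fun do rewrite (bndP (vn_bnd vM (wM _ My))).
by apply: cvgD; [apply: cvgZr; exact: winfP|exact: winfP].
Qed.

Lemma winf_M y : M y -> M (winf y).
Proof.
move=> My; apply: (vn_memP vM); first exact: bnd_winf.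
move=> z Mz; apply/funext => x /=; apply: (cvg_uniq _ (winfP _ My)).
have e t : w t y (z x) = z (w t y x) by rewrite (cmp_eq (w_commutant t My Mz)).
by under eq_fun do rewrite e; apply: (bnd_cvg Mz.1); exact: winfP.
Qed.

Lemma winf_W y : M y -> Winf \o y = winf y \o Winf.
Proof.
move=> My; have [c c0 hc] := w_bound My; apply/funext => x /=.
apply: (cvg_uniq (WinfP _)).
apply/nr_cvgP => e e0; have e20 : 0 < e / 2 by rewrite divr_gt0.
have /nr_cvgP/(_ _ e20) h1 := winfP (Winf x) My.
have /nr_cvgP/(_ _ (divS_gt0 c0 e20)) h2 := WinfP x.
near=> t; rewrite (cmp_eq (WM _ My)).
rewrite [e]splitr; apply: le_lt_trans (nr_tri (w (- t) y (Winf x)) _ _) _.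
have a1 : nr (winf y (Winf x) - w (- t) y (Winf x)) < e / 2 by near: t.
have a2 : nr (Winf x - Wu (- t) x) < e / 2 / (c + 1) by near: t.
rewrite ltr_leD// -(bndB (vn_bnd vM (wM _ My))).
apply: le_trans (hc _ _) _.
by apply: le_trans (ler_wpM2l c0 (ltW a2)) _; rewrite mul_divS_le// ltW.
Unshelve. all: by end_near. Qed.

Lemma winf_adjo y : M y -> winf (adjo y) = adjo (winf y).
Proof.
move=> My; have May := vn_adjo ip_norm vM My.
apply: (adjo_uniq ip_norm (bnd_winf My)) => u v.
have h1 : ip (w (- t) y u) v @[t --> +oo] --> ip (winf y u) v.
  by apply: (ip_cvg ip_norm); [exact: winfP|exact: cvg_cst].
have h2 : ip u (w (- t) (adjo y) v) @[t --> +oo] --> ip u (winf (adjo y) v).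
  by apply: (ip_cvg ip_norm); [exact: cvg_cst|exact: winfP].
apply: (cvg_uniqC h1).
have e t : ip (w (- t) y u) v = ip u (w (- t) (adjo y) v).
  apply: (sh_star (w_aut (- t)).1) => //.
  by move=> a b; rewrite (adjoP ip_norm _ _ (vn_bnd vM My)).
by under eq_fun do rewrite e; exact: h2.
Qed.

Lemma winf_intertwiner :
  intertwiner ip M winf [set z \o Winf | z in commutant M] Winf.
Proof.
have bW' := bnd_Winf.
have ad z : commutant M z -> adjo (z \o Winf) = adjo Winf \o adjo z.
  by move=> Mz; exact: adjo_comp Mz.1 bW'.
split.
- by move=> _ [z Mz <-]; exact: bnd_comp Mz.1 bW'.
- move=> _ y [z Mz <-] My; apply/funext => x /=.
  by rewrite (cmp_eq (winf_W My)) (cmp_eq (Mz.2 _ (winf_M My))).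
- move=> _ y [z Mz <-] My; rewrite (ad z Mz); apply/funext => x /=.
  have [bz Maz] := commutant_star ip_norm vM Mz.
  rewrite (cmp_eq (Maz.2 _ (winf_M My))).
  (* The relation for the adjoint of [Winf] is [winf_W] at [adjo y], with adjoints taken. *)
  have := congr1 adjo (winf_W (vn_adjo ip_norm vM My)).
  have bay := vn_bnd vM (vn_adjo ip_norm vM My).
  rewrite (adjo_comp ip_norm bW' bay) (adjo_comp ip_norm (bnd_winf (vn_adjo ip_norm vM My)) bW').
  rewrite (winf_adjo My) (adjoK ip_norm (vn_bnd vM My)) (adjoK ip_norm (bnd_winf My)) => e.
  by rewrite -(cmp_eq e).
- move=> u hu; apply: (commutant_total ip_norm vM sep) => z Mz.
  have := hu _ (ex_intro2 _ _ z Mz erefl); rewrite (ad z Mz) /= => e.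
  (* Since [Winf] fixes [Om], the vector [z Om] already lies in the range of [z \o Winf]. *)
  rewrite -Winf_Om -(adjoPr ip_norm _ _ Mz.1).
  by rewrite -(adjoPr ip_norm _ _ bW') e ip0l.
- by exists idfun => //; exact: commutant_id.
- exact: Winf_iso.
- exact: bnd_winf.
Qed.

(** On [M], [w_s o alpha_s] is conjugation by a unitary, so it passes inside the strong limit. The
    cocycle identity gives [w_s (alpha_s (w_(-t-s) y)) = w_(-t) (alpha_s y)], and the limit is
    unchanged by the shift of the parameter by [s]. *)
Lemma winf_shift s y : M y -> w s (alpha s (winf y)) = winf (alpha s y).
Proof.
move=> My; have May := aM s My; have bWs := bW s; have bUs := bU s.
have a_spatial z : M z -> alpha s z = U s \o z \o adjo (U s).
  by move=> Mz; apply/funext => x /=; rewrite (cmp_eq (UM s Mz)) (cmp_eq1 (UU s)).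
have sp z x : M z -> w s (alpha s z) x =
    Wu s (U s (z (adjo (U s) (adjo (Wu s) x)))).
  by move=> Mz; rewrite (w_spatial s (aM s Mz)) (a_spatial _ Mz).
apply/funext => x; apply: (cvg_uniq _ (winfP x May)).
rewrite (sp _ _ (winf_M My)); set v := adjo (U s) _.
have h : Wu s (U s (w (- t) y v)) @[t --> +oo] --> Wu s (U s (winf y v)).
  by apply: (bnd_cvg bWs); apply: (bnd_cvg bUs); exact: winfP.
apply/nr_cvgP => e e0; move/nr_cvgP: h => /(_ _ e0) h.
have := near_pinfty_sub (- s) h; apply: filterS => t; rewrite opprK.
rewrite /v -(sp _ _ (wM (- (t + s)) My)).
have := w_cocycle s (- (t + s)) May; rewrite aut_groupNK// => <-.
by rewrite opprD addrCA subrr addr0.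
Qed.

End CocycleLimit.

(** * Normality *)

Section SquareRoot.
Variables (R : realType) (H : completeNormedModType (Cx R)).
Variable ip : {dot H for Num.conj}.
Local Notation C := (Cx R).
Local Notation rc := (@rc R).
Local Notation op := (H -> H).
Local Notation uop := (set (H * H)%type).
Local Notation bnd := (@bounded_ops R H).
Local Notation adjo := (adjo ip).
Hypothesis ip_norm : forall x : H, ip x x = `|x| ^+ 2.

Section Iteration.
Variable c : op.
Hypothesis bc : bnd c.
Hypothesis sc : forall u v, ip (c u) v = ip u (c v).
Hypothesis nc : forall u, nr (c u) <= nr u.

(* The iterates sqit n are polynomials in c with nonnegative coefficients; sqbd n
   is the value of that polynomial at 1, and so bounds the norm of sqit n. *)
Record controlled (T : op) (tau : R) : Prop := Controlled {
  ct_bnd : bnd T ;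
  ct_norm : forall u, nr (T u) <= tau * nr u ;
  ct_self : forall u v, ip (T u) v = ip u (T v) ;
  ct_comm : forall S, bnd S -> S \o c = c \o S -> S \o T = T \o S }.

Lemma ctD S T s t : controlled S s -> controlled T t ->
  controlled (fun u => S u + T u) (s + t).
Proof.
move=> [bS nS sS cS] [bT nT sT cT]; split.
- have := bnd_lincomb 1 bS bT; congr (bnd _).
  by apply/funext => u; rewrite scale1r.
- by move=> u; apply: le_trans (nrD _ _) _; rewrite mulrDl lerD.
- by move=> u v; rewrite ipDl ipDr sS sT.
- move=> Q bQ hQ; apply/funext => u /=.
  by rewrite (bndD bQ) (cmp_eq (cS _ bQ hQ)) (cmp_eq (cT _ bQ hQ)).
Qed.

Lemma ct_half T t : controlled T t -> controlled (fun u => rc 2^-1 *: T u) (2^-1 * t).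
Proof.
move=> [bT nT sT cT]; split.
- exact: bnd_scale.
- move=> u; rewrite nrZ nr_rc ger0_norm ?invr_ge0// -mulrA ler_wpM2l// invr_ge0//.
- by move=> u v; rewrite ipZl ipZr rc_conj sT.
- move=> Q bQ hQ; apply/funext => u /=.
  by rewrite (bndZ bQ) (cmp_eq (cT _ bQ hQ)).
Qed.

Lemma ct_comp S T s t : 0 <= s -> controlled S s -> controlled T t ->
  controlled (S \o T) (s * t).
Proof.
move=> s0 [bS nS sS cS] [bT nT sT cT].
have TS : S \o T = T \o S by apply: cT => //; rewrite cS.
split.
- exact: bnd_comp.
- by move=> u /=; apply: le_trans (nS _) _; rewrite -mulrA ler_wpM2l.
- by move=> u v /=; rewrite sS sT -(cmp_eq TS).
- move=> Q bQ hQ; apply/funext => u /=.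
  by rewrite (cmp_eq (cS _ bQ hQ)) (cmp_eq (cT _ bQ hQ)).
Qed.

Lemma ct_c : controlled c 1.
Proof. by split=> // u; rewrite mul1r. Qed.

Lemma ct_0 : controlled (fun=> 0) 0.
Proof.
split.
- by apply: (@mk_bnd _ _ _ 0) => // [*|u]; rewrite ?scaler0 ?addr0// nr0 mul0r.
- by move=> u; rewrite nr0 mul0r.
- by move=> u v; rewrite ip0l ip0r.
- by move=> S bS _; apply/funext => u /=; rewrite (bnd0 bS).
Qed.

Fixpoint sqit (n : nat) : op :=
  if n is m.+1 then fun u => rc 2^-1 *: (c u + sqit m (sqit m u)) else fun=> 0.

Fixpoint sqbd (n : nat) : R := if n is m.+1 then 2^-1 * (1 + sqbd m * sqbd m) else 0.

Lemma sqbd_bound n : 0 <= sqbd n <= 1.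
Proof.
elim: n => [|n /andP[h0 h1]] /=; first by rewrite lexx ler01.
have := mulr_ge0 h0 h0; have := mulr_ile1 h0 h0 h1 h1 => a1 a2.
by apply/andP; split; lra.
Qed.

Lemma sqit_controlled n : controlled (sqit n) (sqbd n).
Proof.
elim: n => [|n IH]; first exact: ct_0.
apply: ct_half; apply: ctD; first exact: ct_c.
by apply: ct_comp => //; have /andP[] := sqbd_bound n.
Qed.

(** The iterates commute, so a step equals half of the sum times the difference of the two previous
    iterates. [sqbd] satisfies the same factored recursion, and its increments therefore bound those
    of [sqit]. *)
Lemma sqit_step n : controlled (fun u => sqit n.+1 u - sqit n u) (sqbd n.+1 - sqbd n).
Proof.
elim: n => [|n IH].
  have := ct_half (ctD ct_c (ct_comp (lexx 0) ct_0 ct_0)).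
  by congr (controlled _ _); [apply/funext => u /=; rewrite subr0|rewrite /= subr0].
have h1 := sqit_controlled n.+1; have h0 := sqit_controlled n.
have s0 : 0 <= sqbd n.+1 + sqbd n.
  by rewrite addr_ge0//; [have /andP[] := sqbd_bound n.+1|have /andP[] := sqbd_bound n].
have := ct_half (ct_comp s0 (ctD h1 h0) IH).
congr (controlled _ _); last by rewrite /=; field.
have cm : sqit n \o sqit n.+1 = sqit n.+1 \o sqit n.
  apply: (ct_comm h1); first exact: ct_bnd h0.
  apply/esym/(ct_comm h0) => //.
apply/funext => u; rewrite [sqit n.+2 u]/= [sqit n.+1 u in RHS]/= -scalerBr /comp.
congr (_ *: _); rewrite !(bndB (ct_bnd h1)) !(bndB (ct_bnd h0)).
rewrite -(cmp_eq cm) addrA subrK opprD addrACA subrr add0r.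
by [].
Qed.

Lemma sqit_cauchy n k u : nr (sqit (n + k) u - sqit n u) <= (sqbd (n + k) - sqbd n) * nr u.
Proof.
elim: k => [|k IH]; first by rewrite addn0 !subrr nr0 mul0r.
have := ct_norm (sqit_step (n + k)) u; rewrite -addnS => h.
apply: le_trans (nr_tri (sqit (n + k) u) _ _) _.
apply: le_trans (lerD h IH) _; rewrite -mulrDl ler_wpM2r ?nr_ge0//.
by rewrite addrA subrK.
Qed.

Lemma sqbd_cvg : exists l : R, sqbd n @[n --> \oo] --> l.
Proof.
suff h : cvgn sqbd by exists (limn sqbd).
apply: nondecreasing_is_cvgn.
  apply/nondecreasing_seqP => n; rewrite -subr_ge0.
  elim: n => [|n IH] /=; first by rewrite mulr0 addr0 mulr1 subr0 invr_ge0.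
  have := sqbd_bound n => /andP[a0 a1]; have := sqbd_bound n.+1 => /andP[b0 b1].
  have -> : 2^-1 * (1 + sqbd n.+1 * sqbd n.+1) - sqbd n.+1 =
     2^-1 * ((sqbd n.+1 + sqbd n) * (sqbd n.+1 - sqbd n)) by rewrite /=; field.
  by rewrite mulr_ge0 ?invr_ge0// mulr_ge0// addr_ge0.
by exists 1 => _ [n _ <-]; have /andP[] := sqbd_bound n.
Qed.

Lemma sqit_cvg u : exists l : H, sqit n u @[n --> \oo] --> l.
Proof.
have [l hl] := sqbd_cvg; apply: cauchy_ex_cvg => e e0.
have e20 : 0 < e / (nr u + 1) / 2 by rewrite divr_gt0// divS_gt0// nr_ge0.
move/cvgrPdist_lt: hl => /(_ _ e20) [N _ hN].
exists (sqit N u); exists N => // n /= Nn.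
rewrite nrB -(subnKC Nn); apply: le_lt_trans (sqit_cauchy _ _ _) _.
rewrite (subnKC Nn).
have a1 := hN _ (leqnn N); have a2 := hN _ Nn; rewrite /= in a1 a2.
have h : sqbd n - sqbd N <= e / (nr u + 1).
  by move: a1 a2; rewrite !ltr_norml => /andP[p1 p2] /andP[p3 p4]; lra.
apply: le_lt_trans (ler_wpM2r (nr_ge0 _) h) _.
by rewrite mulrC mul_divS_lt// nr_ge0.
Qed.

(* The root t of t = (c + t^2) / 2, so that 1 - t is a square root of 1 - c. *)
Definition sqlim : op := fun u => lim (sqit n u @[n --> \oo]).

Lemma sqlimP u : sqit n u @[n --> \oo] --> sqlim u.
Proof. by have [l hl] := sqit_cvg u; apply: cvgP hl. Qed.
Arguments sqlimP u : clear implicits.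

Lemma sqit_le n u : nr (sqit n u) <= nr u.
Proof.
apply: le_trans (ct_norm (sqit_controlled n) u) _.
by have /andP[h0 h1] := sqbd_bound n; rewrite ler_piMl ?nr_ge0.
Qed.

Lemma nr_lim_le (f : nat -> H) l (b : R) : f n @[n --> \oo] --> l ->
  (forall n, nr (f n) <= b) -> nr l <= b.
Proof.
move=> /nr_cvgP hf hb; apply/ler_addgt0Pl => e e0.
have [N _ hN] := hf e e0; have /= h := hN N (leqnn N).
have := nrD (l - f N) (f N); rewrite subrK => h1; have := hb N; lra.
Qed.

Lemma bnd_sqlim : bnd sqlim.
Proof.
apply: (@mk_bnd _ _ _ 1) => //.
  move=> a u v; apply: (cvg_uniq (sqlimP _)).
  under eq_fun do rewrite (bndP (ct_bnd (sqit_controlled _))).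
  by apply: cvgD; [apply: cvgZr; exact: sqlimP|exact: sqlimP].
by move=> u; rewrite mul1r; apply: nr_lim_le (sqlimP u) _ => n; exact: sqit_le.
Qed.

Lemma sqlim_self u v : ip (sqlim u) v = ip u (sqlim v).
Proof.
have h1 : ip (sqit n u) v @[n --> \oo] --> ip (sqlim u) v.
  by apply: (ip_cvg ip_norm); [exact: sqlimP|exact: cvg_cst].
have h2 : ip u (sqit n v) @[n --> \oo] --> ip u (sqlim v).
  by apply: (ip_cvg ip_norm); [exact: cvg_cst|exact: sqlimP].
apply: (cvg_uniqC h1).
by under eq_fun do rewrite (ct_self (sqit_controlled _)); exact: h2.
Qed.

Lemma sqlim_comm S : bnd S -> S \o c = c \o S -> S \o sqlim = sqlim \o S.
Proof.
move=> bS hS; apply/funext => u /=; apply/esym/(cvg_uniq (sqlimP _)).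
have e n : sqit n (S u) = S (sqit n u).
  by rewrite (cmp_eq (ct_comm (sqit_controlled n) bS hS)).
by under eq_fun do rewrite e; apply: (bnd_cvg bS); exact: sqlimP.
Qed.

Lemma sqlim_eq u : sqlim u = rc 2^-1 *: (c u + sqlim (sqlim u)).
Proof.
have h : sqit n.+1 u @[n --> \oo] --> sqlim u.
  by have := sqlimP u; rewrite -(cvg_shiftS (fun n => sqit n u)).
apply: (cvg_uniq h) => /=; apply: cvgZr; apply: cvgD; first exact: cvg_cst.
apply/nr_cvgP => e e0; have e20 : 0 < e / 2 by rewrite divr_gt0.
have /nr_cvgP/(_ _ e20) h1 := sqlimP u.
have /nr_cvgP/(_ _ e20) h2 := sqlimP (sqlim u).
near=> n; rewrite [e]splitr.
apply: le_lt_trans (nr_tri (sqit n (sqlim u)) _ _) _; apply: ltrD.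
  by near: n.
rewrite -(bndB (ct_bnd (sqit_controlled n))); apply: le_lt_trans (sqit_le _ _) _.
by near: n.
Unshelve. all: by end_near. Qed.

End Iteration.

(** The modulus of [x]. With [s = 1 / (d + 1)] the operator [s x] is a contraction, so [k], which is
    [s^2] times [adjo x \o x], gives a selfadjoint contraction [c = 1 - k]; then [1 - sqlim c] is a
    square root of [k], and the factor [d + 1] undoes the scaling. Operators commuting with
    [adjo x \o x] commute with [c], hence with the limit of polynomials in [c]. *)
Lemma exists_sqrt (x : op) : bnd x -> exists h : op, [/\ bnd h,
  forall u v, ip (h u) (h v) = ip (x u) (x v) &
  forall S, bnd S -> S \o (adjo x \o x) = (adjo x \o x) \o S -> S \o h = h \o S].
Proof.
move=> bx; have [d d0 hd] := bnd_norm bx; pose s := (d + 1)^-1.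
have d1 : 0 < d + 1 by rewrite ltr_wpDl.
have s0 : 0 <= s by rewrite invr_ge0 ltW.
pose k u := rc (s ^+ 2) *: adjo x (x u).
have bk : bnd k by apply: bnd_scale; apply: (bnd_comp (bnd_adjo ip_norm bx) bx).
pose c u := -1 *: k u + idfun u.
have bc : bnd c by apply: bnd_lincomb => //; exact: bnd_id.
have ipk u v : ip (k u) v = rc (s ^+ 2) * ip (x u) (x v).
  by rewrite ipZl (adjoPr ip_norm _ _ bx).
have ipk' u v : ip u (k v) = rc (s ^+ 2) * ip (x u) (x v).
  by rewrite ipZr rc_conj (adjoP ip_norm _ _ bx).
have sc u v : ip (c u) v = ip u (c v).
  by rewrite /c ipDl ipDr ipZl ipZr rmorphN1 ipk ipk'.
have nx u : s * nr (x u) <= nr u.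
  by rewrite mulrC ler_pdivrMr// mulrC; apply: le_trans (hd u) _; rewrite ler_wpM2r ?nr_ge0// lerDl.
have nk u : nr (k u) <= s * nr (x u).
  have h1 : nr (ip (k u) (k u)) <= (s * nr (x u)) * nr (k u).
    rewrite ipk nrM nr_rc ger0_norm ?sqr_ge0//.
    apply: le_trans (ler_wpM2l (sqr_ge0 _) (cauchy_schwarz ip_norm _ _)) _.
    rewrite expr2 -!mulrA ler_wpM2l// mulrCA ler_wpM2l ?nr_ge0//.
  have [k0|k0] := eqVneq (nr (k u)) 0; first by rewrite k0 mulr_ge0 ?nr_ge0.
  have kp : 0 < nr (k u) by rewrite lt_neqAle eq_sym k0 nr_ge0.
  rewrite -(ler_pM2r kp); apply: le_trans h1.
  by rewrite (ip_nr ip_norm) nr_rc ger0_norm ?sqr_ge0// expr2.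
have nc u : nr (c u) <= nr u.
  rewrite -ler_sqr ?nnegrE ?nr_ge0// /c scaleN1r addrC (nr2D ip_norm) nrN ipNr raddfN/=.
  have -> : complex.Re (ip u (k u)) = (s * nr (x u)) ^+ 2.
    by rewrite ipk' (ip_nr ip_norm) -rcM Re_rc exprMn.
  have h := nk u; have : nr (k u) ^+ 2 <= (s * nr (x u)) ^+ 2.
    by rewrite ler_sqr ?nnegrE ?nr_ge0// mulr_ge0// nr_ge0.
  by have := sqr_ge0 (s * nr (x u)); lra.
pose h u := -1 *: sqlim c u + idfun u.
have bh : bnd h by apply: bnd_lincomb; [exact: bnd_sqlim|exact: bnd_id].
(* With [t = sqlim c], the fixed-point equation [2 t = c + t^2] gives [(1 - t)^2 = 1 - c]. *)
have hh u : h (h u) = k u.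
  have e := sqlim_eq bc sc nc u.
  have e2 : 2 *: sqlim c u = c u + sqlim c (sqlim c u).
    rewrite {1}e scalerA -(rc_nat R 2) -rcM divff ?pnatr_eq0// rc1 scale1r//.
  rewrite /h /= !scaleN1r (bndD (bnd_sqlim bc sc nc)) (bndN (bnd_sqlim bc sc nc)).
  rewrite opprD opprK addrA -[_ - _ - _]addrA -opprD -mulr2n -scaler_nat e2.
  by rewrite opprD addrCA subrr addr0 /c scaleN1r opprD opprK subrK.
have hs u v : ip (h u) v = ip u (h v).
  by rewrite /h ipDl ipDr ipZl ipZr rmorphN1 (sqlim_self bc sc nc).
exists (fun u => rc (d + 1) *: h u); split.
- exact: bnd_scale.
- move=> u v; rewrite ipZl ipZr rc_conj hs hh ipk' !mulrA -!rcM /s.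
  by rewrite (_ : (d + 1) * (d + 1) * (d + 1)^-1 ^+ 2 = 1) ?rc1 ?mul1r//; field; rewrite gt_eqF.
- move=> S bS hS; have Sc : S \o c = c \o S.
    apply/funext => u; rewrite /c /k /= (bndD bS) !(bndZ bS).
    by have /= -> := cmp_eq hS u.
  have Sl := sqlim_comm bc sc nc bS Sc.
  by apply/funext => u; rewrite /h /= (bndZ bS) (bndD bS) (bndZ bS) (cmp_eq Sl).
Qed.

(* Polar decomposition of x, in the weak form |x| eta' = x^* eta up to a factor 2. *)
Lemma exists_polar (x h : op) eta : bnd x -> bnd h ->
  (forall u v, ip (h u) (h v) = ip (x u) (x v)) ->
  exists eta', nr eta' ^+ 2 <= 2 * nr eta ^+ 2 /\ forall u, ip (x u) eta = ip (h u) eta'.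
Proof.
move=> bx bh iso; pose K : uop := [set p | exists u, p = (h u, x u)].
have K0 : K 0 by exists 0; rewrite (bnd0 bh) (bnd0 bx).
have KP (a : C) p q : K p -> K q -> K (a *: p + q).
  by move=> [u ->] [v ->]; exists (a *: u + v); rewrite (bndP bh) (bndP bx).
(* The closure of [K] is the graph of a partial isometry [v] taking [h u] to [x u]. The projection
   of [(0, eta)] on it has first component half of the adjoint of [v] applied to [eta]. *)
have [g Lg hg] := exists_projection ip_norm (closure_subspace2 K0 KP) (0, eta).
have iso1 u : ip g.1 (h u) = ip g.2 (x u).
  suff : perp2 ip [set (h u, - x u)] g.
    by move=> /(_ _ erefl); rewrite /gip /= ipNr => /subr0_eq.
  have [_ _ cp] := perp2_closed_subspace ip_norm [set (h u, - x u)].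
  apply: cp; apply: closureS Lg => r [v ->] _ ->.
  by rewrite /gip /= ipNr iso subrr.
have key u : ip eta (x u) = 2 * ip g.1 (h u).
  have := hg (h u, x u) (subset_closure (ex_intro _ u erefl)).
  rewrite /gip /= sub0r ipNl ipBl -iso1 => e; apply/eqP; rewrite -subr_eq0 -e.
  by rewrite mulrDl mul1r opprD addrCA addrA.
have g12 : nr g.1 ^+ 2 = nr g.2 ^+ 2.
  apply: rc_inj; rewrite -!(ip_nr ip_norm).
  suff : perp2 ip [set (g.1, - g.2)] g.
    by move=> /(_ _ erefl); rewrite /gip /= ipNr => /subr0_eq.
  have [_ _ cp] := perp2_closed_subspace ip_norm [set (g.1, - g.2)].
  apply: cp; apply: closureS Lg => r [v ->] _ ->.
  by rewrite /gip /= ipNr (ipC ip (h v)) (ipC ip (x v)) iso1 subrr.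
have gn : nr g.1 ^+ 2 + nr g.2 ^+ 2 <= nr eta ^+ 2.
  have e : gip ip ((0, eta) - g) g = 0 by exact: hg.
  have e1 := nr2BZ ip_norm ((0, eta) - g) g (-1).
  rewrite scaleN1r opprK subrK e mulr0 raddf0 mulr0 subr0 in e1.
  move: e1; rewrite /nr2 /= nr0 expr0n add0r => ->.
  have -> : nr (-1 : C) = 1 by rewrite nrN -rc1 nr_rc normr1.
  by rewrite expr1n mul1r lerDr addr_ge0 ?sqr_ge0.
(* As [nr g.1 = nr g.2], the square norm of [2 g.1] is twice that of the pair [g], which the
   projection keeps below that of [eta]. *)
exists (2 *: g.1); split.
  rewrite nrZ -(rc_nat R 2) nr_rc ger0_norm// exprMn.
  have := sqr_ge0 (nr g.1); have := sqr_ge0 (nr g.2); lra.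
by move=> u; rewrite ipC key ipZr (ipC ip (h u)) rmorphM.
Qed.

End SquareRoot.

(** * Absolutely convergent series and flattened double sums *)

Section ComplexSeries.
Variable R : realType.
Local Notation C := (Cx R).
Local Notation rc := (@rc R).

Lemma Re_le_nr (z : C) : `|complex.Re z| <= nr z.
Proof.
rewrite /nr normc_def /= -(sqrtr_sqr (complex.Re z)); apply: ler_wsqrtr.
by rewrite lerDl sqr_ge0.
Qed.

Lemma Im_le_nr (z : C) : `|complex.Im z| <= nr z.
Proof.
rewrite /nr normc_def /= -(sqrtr_sqr (complex.Im z)); apply: ler_wsqrtr.
by rewrite lerDr sqr_ge0.
Qed.

Lemma nr_le_ReIm (z : C) : nr z <= `|complex.Re z| + `|complex.Im z|.
Proof.
have e : nr z ^+ 2 = complex.Re z ^+ 2 + complex.Im z ^+ 2.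
  by apply: rc_inj; rewrite rcX -nrE; exact/esym/add_Re2_Im2.
rewrite -ler_sqr ?nnegrE ?nr_ge0 ?addr_ge0// e sqrrD !real_normK ?num_real//.
by rewrite addrAC lerDl mulrn_wge0// mulr_ge0.
Qed.

Lemma real_cauchy_cvg (u : nat -> R) :
  (forall e : R, 0 < e -> exists N, forall m n, (N <= m)%N -> (N <= n)%N ->
     `|u m - u n| < e) -> exists l : R, u n @[n --> \oo] --> l.
Proof.
move=> h; suff hu : cvgn u by exists (limn u).
apply/cauchy_cvgP/cauchy_exP => e e0.
have [N hN] := h _ e0; exists (u N); exists N => // n /= Nn.
by rewrite -ball_normE /=; apply: hN.
Qed.

Lemma complex_cauchy_cvg (u : nat -> C) :
  (forall e : R, 0 < e -> exists N, forall m n, (N <= m)%N -> (N <= n)%N ->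
     nr (u m - u n) < e) -> exists l : C, u n @[n --> \oo] --> l.
Proof.
move=> h.
have [a ha] : exists l : R, complex.Re (u n) @[n --> \oo] --> l.
  apply: real_cauchy_cvg => e e0; have [N hN] := h e e0; exists N => m n Nm Nn.
  by rewrite -raddfB; apply: le_lt_trans (Re_le_nr _) (hN _ _ Nm Nn).
have [b hb] : exists l : R, complex.Im (u n) @[n --> \oo] --> l.
  apply: real_cauchy_cvg => e e0; have [N hN] := h e e0; exists N => m n Nm Nn.
  by rewrite -raddfB; apply: le_lt_trans (Im_le_nr _) (hN _ _ Nm Nn).
exists (Complex a b : C); apply/nr_cvgP => e e0; have e20 : 0 < e / 2 by rewrite divr_gt0.
move/cvgrPdist_lt: ha => /(_ _ e20) ha; move/cvgrPdist_lt: hb => /(_ _ e20) hb.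
near=> n; apply: le_lt_trans (nr_le_ReIm _) _; rewrite !raddfB /= [e]splitr.
by apply: ltrD; near: n.
Unshelve. all: by end_near. Qed.

Lemma rc_cvg (u : nat -> R) (l : R) :
  u n @[n --> \oo] --> l -> rc (u n) @[n --> \oo] --> rc l.
Proof.
move=> /cvgrPdist_lt h; apply/nr_cvgP => e e0.
by apply: filterS (h e e0) => n; rewrite -rcB nr_rc.
Qed.

Lemma bounded_series_cvg (a : nat -> R) (B : R) : (forall n, 0 <= a n) ->
  (forall n, \sum_(0 <= k < n) a k <= B) -> cvgn (series a).
Proof.
move=> a0 hB; apply: nondecreasing_is_cvgn.
  by apply/nondecreasing_seqP => n; rewrite /series /= big_nat_recr//= lerDl.
by exists B => _ [n _ <-]; exact: hB.
Qed.

Lemma abs_series_cvg (c : nat -> C) (B : R) :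
  (forall n, \sum_(0 <= k < n) nr (c k) <= B) -> series c @ \oo --> limn (series c).
Proof.
move=> hB; have nc0 n : 0 <= nr (c n) by exact: nr_ge0.
have cv := bounded_series_cvg nc0 hB.
suff [l hl] : exists l : C, series c n @[n --> \oo] --> l by apply: cvgP hl.
apply: complex_cauchy_cvg => e e0; have e20 : 0 < e / 2 by rewrite divr_gt0.
move/cvgrPdist_lt: cv => /(_ _ e20) [N _ hN].
have main m n : (N <= m)%N -> (m <= n)%N -> nr (series c m - series c n) < e.
  move=> Nm mn; rewrite nrB /series /= [\sum_(0 <= k < n) c k](@big_cat_nat _ _ _ m)//=.
  rewrite addrAC subrr add0r; apply: le_lt_trans (nr_sum _ _ _) _.
  have := hN _ Nm; have := hN _ (leq_trans Nm mn); rewrite /series /=.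
  rewrite [X in _ - X](@big_cat_nat _ _ _ m)//= !ltr_norml.
  by move=> /andP[h1 h2] /andP[h3 h4]; lra.
exists N => m n Nm Nn; have [mn|/ltnW nm] := leqP m n; first exact: main.
by rewrite nrB; exact: main.
Qed.

End ComplexSeries.

Section Enumeration.

(** The triangular number, at which row [k] of [pair_at] begins. *)
Fixpoint triangle (k : nat) : nat := if k is k'.+1 then (triangle k' + k)%N else 0%N.

(* The pairs (k, n) with n <= k, in lexicographic order. *)
Fixpoint pair_at (m : nat) : nat * nat := if m is m'.+1 then
  let (k, n) := pair_at m' in if (n < k)%N then (k, n.+1) else (k.+1, 0%N) else (0%N, 0%N).

Lemma pair_at_triangle k n : (n <= k)%N -> pair_at (triangle k + n) = (k, n).
Proof.
elim: k n => [|k IHk] n; first by rewrite leqn0 => /eqP ->.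
elim: n => [|n IHn] nk.
  by rewrite addn0 /= addnS /= IHk// ltnn.
by rewrite addnS [LHS]/= IHn ?(ltnW nk)// nk.
Qed.

Lemma leq_triangle k : (k <= triangle k)%N.
Proof. by elim: k => //= k IH; rewrite leq_addl. Qed.

(** An ultraweak functional is a single series, so the triangular array of the normality proof has
    to be laid out as one sequence. *)
Lemma sum_pair_at (V : nmodType) (F : nat * nat -> V) K :
  \sum_(0 <= m < triangle K) F (pair_at m) =
  \sum_(0 <= k < K) \sum_(0 <= n < k.+1) F (k, n).
Proof.
elim: K => [|K IH]; first by rewrite !big_geq.
rewrite [RHS]big_nat_recr//= -IH (@big_cat_nat _ _ _ (triangle K))//= ?leq_addr//.
congr (_ + _); rewrite -{1}[triangle K]add0n big_addn addKn.
by apply: eq_big_nat => n /andP[_ nK]; rewrite addnC pair_at_triangle.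
Qed.

End Enumeration.

Section UltraweakSeries.
Variables (R : realType) (H : completeNormedModType (Cx R)).
Variable ip : {dot H for Num.conj}.
Local Notation rc := (@rc R).
Local Notation op := (H -> H).
Local Notation bnd := (@bounded_ops R H).
Hypothesis ip_norm : forall x : H, ip x x = `|x| ^+ 2.

Definition sq_bounded (xi : nat -> H) (B : R) : Prop :=
  forall n, \sum_(0 <= k < n) nr (xi k) ^+ 2 <= B.

Lemma square_summableP (xi : nat -> H) :
  square_summable xi <-> exists B, sq_bounded xi B.
Proof.
have rcS n : series (fun n => `|xi n| ^+ 2) n = rc (series (fun n => nr (xi n) ^+ 2) n).
  by rewrite /series /= rc_sum; apply: eq_bigr => k _; rewrite nrE rcX.
have pos n : 0 <= nr (xi n) ^+ 2 by rewrite sqr_ge0.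
split=> [cv|[B hB]]; last first.
  have cv := bounded_series_cvg pos hB.
  rewrite /square_summable (_ : series _ = fun n => rc (series (fun n => nr (xi n) ^+ 2) n)).
    exact: cvgP (rc_cvg cv).
  by apply/funext => n; exact: rcS.
pose s := series (fun n => nr (xi n) ^+ 2).
have mono m n : (m <= n)%N -> s m <= s n.
  move=> mn; rewrite /s /series /= [leRHS](@big_cat_nat _ _ _ m)//= lerDl sumr_ge0//.
move/nr_cvgP: cv => /(_ 1 ltr01) [N _ hN].
exists (nr (limn (series (fun n => `|xi n| ^+ 2))) + 1) => n.
have /= := hN _ (leq_maxl N n); rewrite rcS => h.
apply: le_trans (mono _ _ (leq_maxr N n)) _.
set l := limn _ in h *; set t := s _ in h *.
have t0 : 0 <= t by rewrite /t /s /series sumr_ge0.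
have := nrD (rc t - l) l; rewrite subrK nr_rc ger0_norm// nrB.
by move: h; set q := nr (l - _); lra.
Qed.

Lemma sq_bounded_term xi B n : sq_bounded xi B -> nr (xi n) ^+ 2 <= B.
Proof.
move=> /(_ n.+1); rewrite big_nat_recr//=; apply: le_trans.
by rewrite lerDr sumr_ge0// => k _; rewrite sqr_ge0.
Qed.

Lemma uw_functional_cvg xi eta (T : op) : bnd T -> square_summable xi ->
  square_summable eta ->
  series (fun n => ip (T (xi n)) (eta n)) @ \oo --> uw_functional ip xi eta T.
Proof.
move=> bT /square_summableP[B hB] /square_summableP[B' hB'].
have [c c0 hc] := bnd_norm bT.
apply: (@abs_series_cvg _ _ (c * (B + B'))) => n.
apply: le_trans (_ : \sum_(0 <= k < n) c * (nr (xi k) ^+ 2 + nr (eta k) ^+ 2) <= _).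
  apply: ler_sum => k _; apply: le_trans (cauchy_schwarz ip_norm _ _) _.
  apply: le_trans (ler_wpM2r (nr_ge0 _) (hc _)) _.
  rewrite -mulrA ler_wpM2l//.
  have := sqr_ge0 (nr (xi k) - nr (eta k)); rewrite sqrrD sqrrN mulrN.
  have := sqr_ge0 (nr (xi k)); have := sqr_ge0 (nr (eta k)); rewrite mulr2n.
  by move: (nr (xi k) ^+ 2) (nr (eta k) ^+ 2) (nr (xi k) * nr (eta k)) => p q r; lra.
by rewrite -mulr_sumr big_split/= ler_wpM2l// lerD.
Qed.

End UltraweakSeries.

(** * Pulling ultraweak functionals back along the endomorphism *)

Section Normality.
Variables (R : realType) (H : completeNormedModType (Cx R)).
Variable ip : {dot H for Num.conj}.
Local Notation rc := (@rc R).
Local Notation op := (H -> H).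
Hypothesis ip_norm : forall x : H, ip x x = `|x| ^+ 2.

Variables (M : set op) (Om : H) (theta : op -> op) (W : op).
Hypothesis vM : von_neumann ip M.
Hypothesis iw : intertwiner ip M theta [set z \o W | z in commutant M] W.
Hypothesis WOm : W Om = Om.
Hypothesis dM' : dense [set z Om | z in commutant M].

Lemma exists_polar_vectors z eta : commutant M z -> exists g e,
  [/\ nr g ^+ 2 = nr (z Om) ^+ 2, nr e ^+ 2 <= 2 * nr eta ^+ 2 &
    forall y, M y -> ip (theta y (z Om)) eta = ip (y g) e].
Proof.
move=> Mz; have Ix : [set z \o W | z in commutant M] (z \o W) by exists z.
have bx := iw_bnd iw Ix.
have [h [bh isoh comh]] := exists_sqrt ip_norm bx.
have [e [ne he]] := exists_polar ip_norm eta bx bh isoh.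
exists (h Om), e; split=> //.
  by apply: rc_inj; rewrite -!(ip_nr ip_norm) isoh /= WOm.
move=> y My.
have hy : y \o h = h \o y.
  apply: comh; first exact: (vn_bnd vM).
  apply/funext => u /=.
  by rewrite -(cmp_eq (iw_r iw Ix My)) -(cmp_eq (iw_l iw Ix My)).
rewrite (cmp_eq hy) -he -{1}WOm.
by have /= -> := cmp_eq (iw_l iw Ix My) Om.
Qed.

Lemma commutant_sub z z' : commutant M z -> commutant M z' ->
  commutant M (fun x => z x - z' x).
Proof.
move=> Mz Mz'.
have := @commutant_lincomb _ _ M (-1) z' z (fun T MT => vn_bnd vM MT) Mz' Mz.
by congr (commutant M _); apply/funext => x; rewrite scaleN1r addrC.
Qed.

Lemma series_geometric (n : nat) : \sum_(0 <= k < n) (2^-1 : R) ^+ k <= 2.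
Proof.
suff -> : \sum_(0 <= k < n) (2^-1 : R) ^+ k = 2 - 2 * 2^-1 ^+ n.
  by rewrite gerBl mulr_ge0// exprn_ge0// invr_ge0.
elim: n => [|n IH]; first by rewrite big_geq// expr0; lra.
by rewrite big_nat_recr//= IH exprS; field.
Qed.

Lemma natS_le_exp2 n : n.+1%:R <= 2 ^+ n :> R.
Proof. by rewrite -natrX ler_nat ltn_expl. Qed.

Section Representation.
Variables (xi eta : nat -> H) (B B' : R).
Hypothesis xiB : sq_bounded xi B.
Hypothesis etaB : sq_bounded eta B'.

Let delta (k : nat) : R := 8^-1 ^+ k.

(* Expand each xi n along vectors of M' Om as the sum over k >= n of the vectors
   zeta k n Om, and apply exists_polar_vectors to each term; the weights c make
   both families square summable. *)
Lemma exists_flat_representation : exists xi' eta', [/\ square_summable xi',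
  square_summable eta' & forall y, M y ->
    uw_functional ip xi eta (theta y) = uw_functional ip xi' eta' y].
Proof.
have d0 k : 0 < delta k by rewrite exprn_gt0// invr_gt0.
have dS k : delta k = 8 * delta k.+1 by rewrite /delta exprS; field.
(* a (n, k) Om approximates xi n within 8^-k *)
have /choice [a ha] : forall p : nat * nat, exists z,
    commutant M z /\ nr (xi p.1 - z Om) < delta p.2.
  move=> p; move/nr_denseP: dM' => /(_ (xi p.1) _ (d0 p.2)) [_ [z Mz <-] hz].
  by exists z.
(* Row [k] starts the expansion of [xi k] and refines that of each earlier [xi n], so that rows [n]
   to [k] telescope to [a (n, k)]. *)
pose zeta k n : op := if n == k then a (k, k) else fun x => a (n, k) x - a (n, k.-1) x.
have Mzeta k n : commutant M (zeta k n).
  rewrite /zeta; case: eqP => _; first by case: (ha (k, k)).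
  by apply: commutant_sub; [case: (ha (n, k))|case: (ha (n, k.-1))].
have /choice [G hG] : forall p : nat * nat, exists q : H * H,
   [/\ nr q.1 ^+ 2 = nr (zeta p.1 p.2 Om) ^+ 2, nr q.2 ^+ 2 <= 2 * nr (eta p.2) ^+ 2 &
    forall y, M y -> ip (theta y (zeta p.1 p.2 Om)) (eta p.2) = ip (y q.1) q.2].
  move=> p; have [g [e [h1 h2 h3]]] := exists_polar_vectors (eta p.2) (Mzeta p.1 p.2).
  by exists (g, e).
(* Off the diagonal the vectors from [zeta] are of size [8^-k], while those from [eta n] do not
   decay in [k]. The factor [2^k] shares the decay: the square norms become at most [81 * 16^-k] and
   [2 * 4^-k * nr (eta n) ^+ 2], summable over the whole array even with [k] terms in a row. *)
pose c (p : nat * nat) : R := if p.2 == p.1 then 1 else 2 ^+ p.1.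
have c0 p : 0 < c p by rewrite /c; case: ifP => _ //; rewrite exprn_gt0.
pose F p := rc (c p) *: (G p).1; pose E p := rc (c p)^-1 *: (G p).2.
have FE y p : M y -> ip (y (F p)) (E p) = ip (theta y (zeta p.1 p.2 Om)) (eta p.2).
  move=> My; have [_ _ ->//] := hG p.
  rewrite /F /E (bndZ (vn_bnd vM My)) ipZl ipZr rc_conj mulrA -rcM mulfV ?gt_eqF//.
  by rewrite rc1 mul1r.
have B0 : 0 <= B by have := xiB 0; rewrite big_geq.
have B0' : 0 <= B' by have := etaB 0; rewrite big_geq.
(* The 9 comes from [8^-k + 8^-(k-1) = 9 * 8^-k]. *)
have zn k n : (n < k)%N -> nr (zeta k n Om) <= 9 * delta k.
  case: k => // k nk; rewrite /zeta ltn_eqF//=.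
  have [_ /= h1] := ha (n, k.+1); have [_ /= h2] := ha (n, k).
  apply: le_trans (nr_tri (xi n) _ _) _; rewrite nrB.
  by move: h1 h2; rewrite (dS k); lra.
have zk k : nr (zeta k k Om) <= nr (xi k) + delta k.
  rewrite /zeta eqxx; have [_ /= h1] := ha (k, k).
  have := nrD (a (k, k) Om - xi k) (xi k); rewrite subrK nrB; lra.
pose t k : R := 2^-1 ^+ k.
have t0 k : 0 < t k by rewrite exprn_gt0// invr_gt0.
have t1 k : t k <= 1 by rewrite exprn_ile1// ?invr_ge0// invf_le1// ler1n.
have t2 k : t k * 2 ^+ k = 1 by rewrite -exprMn mulVf ?expr1n// pnatr_eq0.
have dt k : delta k = t k * t k * t k.
  by rewrite /delta /t -!exprMn; congr (_ ^+ _); field.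
have kt k : k.+1%:R * t k <= 1.
  by have := ler_wpM2r (ltW (t0 k)) (natS_le_exp2 k); rewrite [2 ^+ k * _]mulrC t2.
have kt' k : k%:R * t k <= 1.
  by apply: le_trans (kt k); rewrite ler_wpM2r ?(ltW (t0 k))// ler_nat.
have tt k : t k * t k <= t k by rewrite ler_piMr ?(ltW (t0 k)).
have flat (f : nat * nat -> H) (D : R) :
    (forall K, \sum_(0 <= k < K) \sum_(0 <= n < k.+1) nr (f (k, n)) ^+ 2 <= D) ->
    square_summable (fun m => f (pair_at m)).
  move=> hD; apply/square_summableP; exists D => m; apply: le_trans (hD m).
  rewrite -(sum_pair_at (fun p => nr (f p) ^+ 2)).
  rewrite (@big_cat_nat _ _ _ m 0 (triangle m))//= ?leq_triangle// lerDl.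
  by apply: sumr_ge0 => k _; exact: sqr_ge0.
have sF : square_summable (fun m => F (pair_at m)).
  (* In row [k] the diagonal entry costs [2 * nr (xi k) ^+ 2 + 2 * t k] and the others together
     [81 * t k]; the sum of all [t k] is at most 2. *)
  apply: (flat _ (2 * B + 83 * 2)) => K.
  apply: le_trans (_ : \sum_(0 <= k < K) (2 * nr (xi k) ^+ 2 + 83 * t k) <= _); last first.
    by rewrite big_split/= -!mulr_sumr lerD// ler_wpM2l// series_geometric.
  apply: ler_sum => k _; rewrite big_nat_recr//= addrC.
  have nF n : nr (F (k, n)) ^+ 2 = c (k, n) ^+ 2 * nr (zeta k n Om) ^+ 2.
    by have [<- _ _] := hG (k, n); rewrite nrZ nr_rc ger0_norm ?(ltW (c0 _))// exprMn.
  have last_le : nr (F (k, k)) ^+ 2 <= 2 * nr (xi k) ^+ 2 + 2 * t k.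
    rewrite nF /c eqxx expr1n mul1r.
    have h1 := zk k; have z0 := nr_ge0 (zeta k k Om); have x0 := nr_ge0 (xi k).
    have h2 : delta k ^+ 2 <= t k.
      rewrite dt expr2; apply: le_trans (ler_piMr _ _) _.
      - by rewrite !mulr_ge0 ?(ltW (t0 k)).
      - by rewrite !mulr_ile1 ?mulr_ge0 ?(ltW (t0 k)).
      - by rewrite ler_piMl ?(ltW (t0 k))// mulr_ile1 ?(ltW (t0 k)).
    have h3 : nr (zeta k k Om) ^+ 2 <= (nr (xi k) + delta k) ^+ 2.
      by rewrite ler_sqr ?nnegrE// addr_ge0// ltW.
    apply: le_trans h3 _; have := sqr_ge0 (nr (xi k) - delta k).
    by rewrite sqrrB sqrrD mulr2n; lra.
  have rest_le : \sum_(0 <= n < k) nr (F (k, n)) ^+ 2 <= 81 * t k.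
    apply: le_trans (_ : \sum_(0 <= n < k) 81 * (t k * t k * t k * t k) <= _).
      rewrite !big_seq; apply: ler_sum => n; rewrite mem_index_iota => /andP[_ nk].
      rewrite nF /c ltn_eqF//= -exprMn.
      have h1 : 2 ^+ k * nr (zeta k n Om) <= 9 * (t k * t k).
        apply: le_trans (ler_wpM2l _ (zn k n nk)) _; first by rewrite exprn_ge0.
        rewrite dt; have -> : 2 ^+ k * (9 * (t k * t k * t k)) = 9 * (t k * t k) * (t k * 2 ^+ k).
          by ring.
        by rewrite t2 mulr1.
      have h2 : 0 <= 2 ^+ k * nr (zeta k n Om) by rewrite mulr_ge0 ?exprn_ge0 ?nr_ge0.
      apply: le_trans (_ : (9 * (t k * t k)) ^+ 2 <= _).
        by rewrite ler_sqr// ?nnegrE// mulr_ge0// mulr_ge0// ltW.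
      by rewrite le_eqVlt; apply/orP; left; apply/eqP; ring.
    rewrite sumr_const_nat subn0 -[_ *+ k]mulr_natl.
    have -> : k%:R * (81 * (t k * t k * t k * t k)) = 81 * ((k%:R * t k) * (t k * t k) * t k).
      by ring.
    rewrite ler_wpM2l// ler_piMl ?(ltW (t0 k))//.
    by rewrite mulr_ile1 ?mulr_ge0 ?(ltW (t0 k))// mulr_ile1 ?(ltW (t0 k)).
  by move: last_le rest_le; lra.
have sE : square_summable (fun m => E (pair_at m)).
  apply: (flat _ (2 * B' + 2 * B' * 2)) => K.
  apply: le_trans (_ : \sum_(0 <= k < K) (2 * nr (eta k) ^+ 2 + 2 * B' * t k) <= _); last first.
    rewrite big_split/= -!mulr_sumr lerD//; first by rewrite ler_wpM2l.
    by rewrite ler_wpM2l// ?mulr_ge0// series_geometric.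
  apply: ler_sum => k _; rewrite big_nat_recr//= addrC.
  have nE n : nr (E (k, n)) ^+ 2 <= (c (k, n))^-1 ^+ 2 * (2 * nr (eta n) ^+ 2).
    have [_ h _] := hG (k, n).
    rewrite nrZ nr_rc ger0_norm ?invr_ge0 ?(ltW (c0 _))// exprMn ler_wpM2l//.
    exact: sqr_ge0.
  apply: lerD; first by have := nE k; rewrite /c eqxx invr1 expr1n mul1r.
  apply: le_trans (_ : \sum_(0 <= n < k) t k * (2 * nr (eta n) ^+ 2) <= _).
    rewrite !big_seq; apply: ler_sum => n; rewrite mem_index_iota => /andP[_ nk].
    apply: le_trans (nE n) _; rewrite /c ltn_eqF//= ler_wpM2r//.
      by rewrite mulr_ge0// sqr_ge0.
    by rewrite -exprVn -/(t k) expr2.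
  by rewrite -mulr_sumr -mulr_sumr mulrC ler_wpM2r ?(ltW (t0 k))// ler_wpM2l.
exists (fun m => F (pair_at m)), (fun m => E (pair_at m)); split=> // y My.
have bth := iw_img iw My; have [d d1 hd] := bnd_norm bth.
have sxi : square_summable xi by apply/square_summableP; exists B.
have seta : square_summable eta by apply/square_summableP; exists B'.
pose S' K := \sum_(0 <= k < K) \sum_(0 <= n < k.+1) ip (y (F (k, n))) (E (k, n)).
(* The first [K] rows telescope to the approximants of the last row [K.-1]; for [K = 0] the sum is
   empty, and the truncated predecessor is harmless. *)
have S'E K : S' K = \sum_(0 <= n < K) ip (theta y (a (n, K.-1) Om)) (eta n).
  elim: K => [|K IH]; first by rewrite /S' !big_geq.
  rewrite /S' big_nat_recr//= -/(S' K) IH [RHS]big_nat_recr//= [in LHS]big_nat_recr//=.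
  rewrite addrA; congr (_ + _); last by rewrite (FE _ _ My) /= /zeta eqxx.
  rewrite -big_split /= !big_seq; apply: eq_bigr => n.
  rewrite mem_index_iota => /andP[_ nK]; rewrite (FE _ _ My) /= /zeta ltn_eqF//=.
  by rewrite (bndB bth) ipBl addrC subrK.
have cv1 : S' K @[K --> \oo] -->
    uw_functional ip (fun m => F (pair_at m)) (fun m => E (pair_at m)) y.
  have /nr_cvgP hs := uw_functional_cvg ip_norm (vn_bnd vM My) sF sE.
  apply/nr_cvgP => e e0; have [N _ hN] := hs e e0; exists N => // K /= NK.
  have /= := hN (triangle K) (leq_trans NK (leq_triangle K)).
  by rewrite /series /= (sum_pair_at (fun p => ip (y (F p)) (E p))).
have cv2 : S' K @[K --> \oo] --> uw_functional ip xi eta (theta y).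
  have /nr_cvgP hs := uw_functional_cvg ip_norm bth sxi seta.
  apply/nr_cvgP => e e0; have e20 : 0 < e / 2 by rewrite divr_gt0.
  have [N _ hN] := hs _ e20.
  have D0 : 0 <= 2 * (d * (B' + 1)) by rewrite mulr_ge0// mulr_ge0// addr_ge0.
  have [N' hN'] := invS_lt (divS_gt0 D0 e20).
  exists (maxn N N').+1 => // -[//|k] /=; rewrite ltnS geq_max => /andP[Nk Nk'].
  have /= h1 := hN k.+1 (leq_trans Nk (leqnSn _)).
  rewrite [e]splitr.
  apply: le_lt_trans (nr_tri (series (fun n => ip (theta y (xi n)) (eta n)) k.+1) _ _) _.
  apply: ltrD => //; rewrite S'E /series /= -sumrB.
  apply: le_lt_trans (nr_sum _ _ _) _.
  (* Each of the [k + 1] approximants is off by less than [8^-k], and [nr (eta n) <= B' + 1] follows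
     from [2 r <= r^2 + 1]. One factor [2^-k] of [8^-k] absorbs the number of terms. *)
  apply: le_lt_trans (_ : \sum_(0 <= n < k.+1) d * delta k * (B' + 1) < _).
    apply: ler_sum => n _; rewrite -ipBl -(bndB bth).
    apply: le_trans (cauchy_schwarz ip_norm _ _) _.
    apply: ler_pM; rewrite ?nr_ge0//.
      apply: le_trans (hd _) _; rewrite ler_wpM2l//; apply: ltW.
      by have [_] := ha (n, k).
    have := sq_bounded_term n etaB; have := nr_ge0 (eta n).
    by move=> p0 p1; have := sqr_ge0 (nr (eta n) - 1); rewrite sqrrB expr1n mulr1 mulr2n; lra.
  rewrite sumr_const_nat subn0 -[_ *+ k.+1]mulr_natl dt.
  have -> : k.+1%:R * (d * (t k * t k * t k) * (B' + 1)) =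
      d * (B' + 1) * ((k.+1%:R * t k) * (t k * t k)) by ring.
  have tk : t k <= k.+1%:R^-1 by rewrite -[leRHS]mul1r ler_pdivlMr// mulrC.
  have q1 : k.+1%:R * t k * (t k * t k) <= k.+1%:R^-1.
    apply: le_trans tk; apply: le_trans (tt k); rewrite ler_piMl//.
    by rewrite mulr_ge0// ltW.
  have D1 : 0 <= d * (B' + 1) by rewrite mulr_ge0// addr_ge0.
  apply: le_lt_trans (ler_wpM2l D1 q1) _.
  have h2 := hN' _ Nk'; apply: le_lt_trans (ler_wpM2l D1 (ltW h2)) _.
  apply: le_lt_trans (_ : 2 * (d * (B' + 1)) * (e / 2 / (2 * (d * (B' + 1)) + 1)) < _).
    by rewrite ler_wpM2r ?(ltW (divS_gt0 D0 e20))// ler_peMl// ler1n.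
  exact: mul_divS_lt.
exact: cvg_uniqC cv2 cv1.
Qed.

End Representation.

(** On [M], an ultraweak functional composed with [theta] is again an ultraweak functional. *)
Lemma intertwiner_normal : normal_map ip M theta.
Proof.
move=> F PF FM T MT FT xi eta /square_summableP[B hB] /square_summableP[B' hB'].
have [xi' [eta' [s s' h]]] := exists_flat_representation hB hB'.
have hT := h T MT; have /nr_cvgP hf := FT xi' eta' s s'.
apply/nr_cvgP => e e0; have Fe := hf e e0.
have : F [set S | nr (uw_functional ip xi eta (theta T) - uw_functional ip xi eta (theta S)) < e].
  by apply: filterS2 FM Fe => S MS /=; rewrite (h S MS) hT.
exact.
Qed.

End Normality.

(** * Vector states and conjugation groups *)

Section Trace.
Variables (R : realType) (H : completeNormedModType (Cx R)).
Variable ip : {dot H for Num.conj}.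
Local Notation C := (Cx R).
Local Notation rc := (@rc R).
Local Notation op := (H -> H).
Local Notation bnd := (@bounded_ops R H).
Local Notation adjo := (adjo ip).
Hypothesis ip_norm : forall x : H, ip x x = `|x| ^+ 2.

Definition orthonormal_set (B : set H) : Prop :=
  forall e f, B e -> B f -> ip e f = (e == f)%:R.

(** [has_trace] quantifies over all bases, so a trace is unique only once some basis exists. *)
Lemma exists_orthonormal_basis : exists B : set H, orthonormal_basis ip B.
Proof.
have [|B [oB maxB]] := @Zorn_bigcup H orthonormal_set.
  move=> F FP tot e f [X FX Xe] [Y FY Yf].
  have [XY|YX] := tot X Y FX FY; first by apply: (FP Y) => //; exact: XY.
  by apply: (FP X) => //; exact: YX.
exists B; split=> // x xB.
have [//|x0] := eqVneq x 0; exfalso.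
have nx : nr x != 0 by apply: contra_neq x0 => /nr_eq0.
pose e := rc (nr x)^-1 *: x.
have ee : ip e e = 1.
  rewrite /e ipZl ipZr rc_conj (ip_nr ip_norm) -!rcM -rc1; congr (rc _).
  by field.
have eB f : B f -> ip e f = 0 by move=> Bf; rewrite ipZl xB// mulr0.
have Be : ~ B e by move=> /eB; rewrite ee => /eqP; rewrite oner_eq0.
apply: (maxB (B `|` [set e])).
  split; first by move=> f Bf; left.
  by move=> h; apply: Be; apply: h; right.
have ne f : B f -> (e == f) = false by move=> Bf; apply/eqP => ef; apply: Be; rewrite ef.
move=> f g [Bf|->] [Bg|->].
- exact: oB.
- by rewrite ipC (eB f Bf) eq_sym (ne f Bf) rmorph0.
- by rewrite (eB g Bg) (ne g Bg).
- by rewrite ee eqxx.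
Qed.

Section Basis.
Variable B : set H.
Hypothesis onB : orthonormal_basis ip B.

Lemma finite_subsets_proper : ProperFilter (finite_subsets_filter B).
Proof.
apply: filter_from_proper; last by move=> F hF; exists F; split.
apply: filter_from_filter; first by exists set0; split.
move=> F G [fF FB] [fG GB]; exists (F `|` G).
  by split; [rewrite finite_setU|move=> x [/FB|/GB]].
move=> K [[fK KB] FGK]; split; split=> // x hx; apply: FGK; first by left.
by right.
Qed.

Definition partial_expansion (s : seq H) (x : H) : H := \sum_(e <- s) ip x e *: e.

Section Finite.
Variable s : seq H.
Hypothesis us : uniq s.
Hypothesis sB : forall e, e \in s -> B e.

Lemma expansion_coef x e : e \in s -> ip (partial_expansion s x) e = ip x e.
Proof.
move=> es; have [oB _] := onB; rewrite /partial_expansion.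
have -> : ip (\sum_(f <- s) ip x f *: f) e = \sum_(f <- s) ip x f * ip f e.
  elim: (s) => [|f r IH]; first by rewrite !big_nil ip0l.
  by rewrite !big_cons ipDl ipZl IH.
rewrite (bigD1_seq e)//= (oB e e (sB es) (sB es)) eqxx mulr1.
rewrite big_seq_cond big1 ?addr0// => f /andP[fs fe].
by rewrite (oB f e (sB fs) (sB es)) (negbTE fe) mulr0.
Qed.

Lemma ip_expansion_r x y : ip x (partial_expansion s y) = \sum_(e <- s) (ip y e)^* * ip x e.
Proof.
rewrite /partial_expansion; elim: (s) => [|f r IH]; first by rewrite !big_nil ip0r.
by rewrite !big_cons ipDr ipZr IH.
Qed.

Lemma expansion_orth x y : ip (x - partial_expansion s x) (partial_expansion s y) = 0.
Proof.
rewrite ip_expansion_r big_seq big1// => e es.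
by rewrite ipBl expansion_coef// subrr mulr0.
Qed.

Lemma expansion_norm x : nr (partial_expansion s x) <= nr x.
Proof.
have := nr2D ip_norm (x - partial_expansion s x) (partial_expansion s x).
rewrite subrK expansion_orth raddf0 mulr0 addr0 => e.
by rewrite -ler_sqr ?nnegrE ?nr_ge0// e lerDr sqr_ge0.
Qed.

Lemma expansionP (a : C) x y :
  partial_expansion s (a *: x + y) = a *: partial_expansion s x + partial_expansion s y.
Proof.
rewrite /partial_expansion scaler_sumr -big_split/=; apply: eq_bigr => e _.
by rewrite ipDl ipZl scalerDl scalerA.
Qed.

Lemma expansionB x y :
  partial_expansion s (x - y) = partial_expansion s x - partial_expansion s y.
Proof. by rewrite addrC -scaleN1r expansionP scaleN1r addrC. Qed.

End Finite.

Local Notation fseq F := (finmap.enum_fset (fset_set F)).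

Definition expandable (x : H) : Prop := forall e : R, 0 < e ->
  exists2 F0, fsets B F0 & forall F, fsets B F -> F0 `<=` F ->
    nr (x - partial_expansion (fseq F) x) < e.

Let fset_in F e : fsets B F -> e \in (fseq F) -> B e.
Proof. by move=> [fF FB]; rewrite in_fset_set// inE => /FB. Qed.

(** The expandable vectors form a subspace containing [B], dense because [B] is total. It is closed
    because expansions are contractions uniformly in the finite set. *)
Lemma expandable_all x : expandable x.
Proof.
pose S : set H := expandable.
have [oB tB] := onB.
have sS : Defs.subspace S.
  split.
    move=> e e0; exists set0; first by split.
    move=> F _ _; rewrite sub0r nrN (_ : partial_expansion _ _ = 0) ?nr0//.
    by rewrite /partial_expansion big1// => f _; rewrite ip0l scale0r.
  move=> a u v hu hv e e0; have e20 : 0 < e / 2 by rewrite divr_gt0.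
  have [F1 [fF1 F1B] h1] := hu _ (divS_gt0 (nr_ge0 a) e20); have [F2 [fF2 F2B] h2] := hv _ e20.
  exists (F1 `|` F2); first by split; [rewrite finite_setU|move=> z [/F1B|/F2B]].
  move=> F hF FF; rewrite expansionP opprD addrACA -scalerBr.
  apply: le_lt_trans (nrD _ _) _; rewrite [e]splitr nrZ; apply: ler_ltD.
    have /ltW := h1 F hF (fun z Fz => FF z (or_introl Fz)).
    by move=> /(ler_wpM2l (nr_ge0 a))/le_trans; apply; rewrite mul_divS_le ?nr_ge0// ltW.
  exact: h2 F hF (fun z Fz => FF z (or_intror Fz)).
have cS : closed S.
  move=> u /nr_closureP hu e e0; have e40 : 0 < e / 4 by rewrite divr_gt0.
  have [v Sv uv] := hu _ e40; have e20 : 0 < e / 2 by rewrite divr_gt0.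
  have [F0 hF0 h] := Sv _ e20; exists F0 => // F hF FF.
  have := h F hF FF; set s := (fseq F) => h1.
  have h2 : nr (partial_expansion s v - partial_expansion s u) <= nr (v - u).
    rewrite -expansionB; apply: expansion_norm; [exact: finmap.fset_uniq|].
    by move=> f; exact: fset_in.
  apply: le_lt_trans (nr_tri v _ _) _.
  apply: le_lt_trans (lerD (lexx _) (nr_tri (partial_expansion s v) _ _)) _.
  move: h1 h2 uv; rewrite (nrB v u); lra.
have SB f : B f -> S f.
  move=> Bf e e0; exists [set f]; first by split=> // _ ->.
  move=> F hF Ff; suff -> : partial_expansion (fseq F) f = f by rewrite subrr nr0.
  have fs : f \in (fseq F) by rewrite in_fset_set ?inE; [exact: Ff|case: hF].
  rewrite /partial_expansion (bigD1_seq f)//= ?finmap.fset_uniq// oB// eqxx scale1r.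
  rewrite big_seq_cond big1 ?addr0// => g /andP[gs gf].
  by rewrite oB ?(eq_sym f) ?(negbTE gf) ?scale0r//; exact: fset_in gs.
have dS : dense S.
  apply: (total_dense ip_norm sS) => u hu; apply: tB => e Be.
  exact/hu/SB.
by apply: cS; apply/nr_closureP; move/nr_denseP: dS; apply.
Qed.

Lemma parseval x y :
  (fun F : set H => \sum_(e \in F) ip x e * ip e y) @ finite_subsets_filter B --> ip x y.
Proof.
have FF := @filter_filter _ _ finite_subsets_proper.
apply/nr_cvgP => e e0.
have [F0 hF0 h] := expandable_all x (divS_gt0 (nr_ge0 y) e0).
exists F0 => // F [hF F0F] /=.
have -> : \sum_(e \in F) ip x e * ip e y = ip (partial_expansion (fseq F) x) y.
  rewrite fsbig_finite; last by case: hF.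
  rewrite /partial_expansion; elim: (fseq F) => [|f r IH].
    by rewrite !big_nil ip0l.
  by rewrite !big_cons ipDl ipZl IH.
rewrite -ipBl; apply: le_lt_trans (cauchy_schwarz ip_norm _ _) _.
apply: le_lt_trans (ler_wpM2r (nr_ge0 _) (ltW (h F hF F0F))) _.
by rewrite mulrC mul_divS_lt// nr_ge0.
Qed.

End Basis.

Lemma has_trace_uniq T c c' : has_trace ip T c -> has_trace ip T c' -> c = c'.
Proof.
have [B oB] := exists_orthonormal_basis; have PF := finite_subsets_proper B.
by move=> h h'; exact: (cvg_uniqC (h B oB) (h' B oB)).
Qed.

Lemma tr_eq T c : has_trace ip T c -> tr ip T = c.
Proof.
move=> h; rewrite /tr; case: xgetP => [c' _ h'|/(_ c)//].
exact: has_trace_uniq h' h.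
Qed.

(** For a unit vector [Om], the projector on its line, which is the density of the vector state of
    [Om]. *)
Definition rank_one (Om : H) : op := fun x => ip x Om *: Om.

Lemma rank_one_trace Om (y : op) : bnd y -> has_trace ip (rank_one Om \o y) (ip (y Om) Om).
Proof.
move=> by_ B oB.
rewrite (_ : ip (y Om) Om = ip Om (adjo y Om)); last by rewrite -(adjoP ip_norm _ _ by_).
suff -> : (fun F : set H => \sum_(e \in F) ip ((rank_one Om \o y) e) e) =
    fun F => \sum_(e \in F) ip Om e * ip e (adjo y Om) by exact: parseval.
apply/funext => F.
apply: eq_fsbigr => e _; rewrite /rank_one /= ipZl mulrC.
by rewrite -(adjoP ip_norm _ _ by_).
Qed.

Lemma expect_rank_one Om (y : op) : bnd y -> expect ip (rank_one Om) y = ip (y Om) Om.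
Proof. by move=> by_; apply: tr_eq; exact: rank_one_trace. Qed.

Lemma density_rank_one Om : ip Om Om = 1 -> density ip (rank_one Om).
Proof.
move=> O1; split.
- apply: (@mk_bnd _ _ _ (nr Om * nr Om)).
  + by rewrite mulr_ge0 ?nr_ge0.
  + by move=> a x y; rewrite /rank_one ipDl ipZl scalerDl scalerA.
  + move=> x; rewrite /rank_one nrZ mulrAC.
    by rewrite ler_wpM2r ?nr_ge0// mulrC; exact: cauchy_schwarz.
- by move=> x; rewrite /rank_one ipZl (ipC ip Om) mul_conjC_ge0.
- by have := @rank_one_trace Om idfun (bnd_id H); rewrite /= O1.
Qed.

End Trace.

(** * Dominated convergence and continuous groups of unitaries *)

Section Tannery.
Variable R : realType.
Local Notation C := (Cx R).

Lemma nr_lim_le_near (V : pseudoMetricNormedZmodType C) (f : nat -> V) l (b : R) N :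
  f n @[n --> \oo] --> l -> (forall n, (N <= n)%N -> nr (f n) <= b) -> nr l <= b.
Proof.
move=> /nr_cvgP hf hb; apply/ler_addgt0Pl => e e0.
have [N' _ hN] := hf e e0; have /= h := hN _ (leq_maxr N N').
have := nrD (l - f (maxn N N')) (f (maxn N N')); rewrite subrK => h1.
have := hb _ (leq_maxl N N'); lra.
Qed.

Lemma nr_cvgD (V : pseudoMetricNormedZmodType C) T (F : set_system T) {FF : Filter F}
    (f g : T -> V) (l m : V) :
  f i @[i --> F] --> l -> g i @[i --> F] --> m -> f i + g i @[i --> F] --> l + m.
Proof.
move=> /nr_cvgP hf /nr_cvgP hg; apply/nr_cvgP => e e0.
have e20 : 0 < e / 2 by rewrite divr_gt0.
apply: filterS2 (hf _ e20) (hg _ e20) => i h1 h2.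
by rewrite opprD addrACA; apply: le_lt_trans (nrD _ _) _; rewrite [e]splitr ltrD.
Qed.

(** Dominated convergence for series along an arbitrary filter: the tails are uniformly small by the
    bound [b], and the finite part converges termwise. *)
Lemma tannery T (F : set_system T) {FF : Filter F} (f : T -> nat -> C) (g : nat -> C)
    (b : nat -> R) (B : R) :
  (forall i n, nr (f i n) <= b n) -> (forall n, nr (g n) <= b n) ->
  (forall n, \sum_(0 <= k < n) b k <= B) ->
  (forall n, f i n @[i --> F] --> g n) ->
  limn (series (f i)) @[i --> F] --> limn (series g).
Proof.
move=> fb gb bB fg.
have b0 n : 0 <= b n by apply: le_trans (gb n); exact: nr_ge0.
have cv := bounded_series_cvg b0 bB.
have ser (h : nat -> C) : (forall n, nr (h n) <= b n) -> series h @ \oo --> limn (series h).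
  move=> hb; apply: (@abs_series_cvg _ _ B) => n; apply: le_trans (bB n).
  exact: ler_sum.
apply/nr_cvgP => e e0; have e40 : 0 < e / 4 by rewrite divr_gt0.
have e80 : 0 < e / 8 by rewrite divr_gt0.
move/cvgrPdist_lt: cv => /(_ _ e80) [N _ hN].
have tail (h : nat -> C) : (forall n, nr (h n) <= b n) ->
    nr (limn (series h) - series h N) <= e / 4.
  move=> hb; apply: (@nr_lim_le_near _ (fun n => series h n - series h N) _ _ N).
    by apply: nr_cvgD; [exact: ser|exact: cvg_cst].
  move=> n Nn; rewrite /series /= (@big_cat_nat _ _ _ N 0 n)//= addrAC subrr add0r.
  apply: le_trans (nr_sum _ _ _) _; apply: le_trans (ler_sum _ (fun k _ => hb k)) _.
  have /= := hN _ (leqnn N); have /= := hN _ Nn; rewrite /series /=.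
  rewrite (@big_cat_nat _ _ _ N 0 n)//= !ltr_norml => /andP[h1 h2] /andP[h3 h4].
  lra.
have fin : series (f i) N @[i --> F] --> series g N.
  rewrite /series /=; elim: (N) => [|n IH].
    have -> : (fun i => \sum_(0 <= k < 0) f i k) = fun=> 0.
      by apply/funext => i; rewrite big_geq.
    by rewrite big_geq//; exact: (cvg_cst (0 : C)).
  have -> : (fun i => \sum_(0 <= k < n.+1) f i k) =
      fun i => \sum_(0 <= k < n) f i k + f i n.
    by apply/funext => i; rewrite big_nat_recr.
  have -> : \sum_(0 <= k < n.+1) g k = \sum_(0 <= k < n) g k + g n by rewrite big_nat_recr.
  exact: (@nr_cvgD _ _ F FF (fun i => \sum_(0 <= k < n) f i k) (fun i => f i n) _ _ IH (fg n)).
move/nr_cvgP: fin => /(_ _ e40); apply: filterS => i hi.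
apply: le_lt_trans (nr_tri (series g N) _ _) _.
apply: le_lt_trans (lerD (tail _ gb) (nr_tri (series (f i) N) _ _)) _.
have h1 := tail _ (fb i); rewrite nrB in h1.
have aux (p q r : R) : p < r / 4 -> q <= r / 4 -> 0 < r -> r / 4 + (p + q) < r.
  by move=> *; lra.
exact: aux hi h1 e0.
Qed.

End Tannery.

Section Continuity.
Variables (R : realType) (H : completeNormedModType (Cx R)).
Variable ip : {dot H for Num.conj}.
Local Notation op := (H -> H).
Local Notation bnd := (@bounded_ops R H).
Local Notation adjo := (adjo ip).
Hypothesis ip_norm : forall x : H, ip x x = `|x| ^+ 2.

(** Turns a vector into a square-summable sequence, so that ultraweak convergence specialises to
    convergence of matrix elements. *)
Definition single (x : H) : nat -> H := fun n => if n == 0%N then x else 0.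

Lemma single_summable x : square_summable (single x).
Proof.
apply/square_summableP; exists (nr x ^+ 2) => -[|n]; first by rewrite big_geq ?sqr_ge0.
rewrite big_nat_recl//= big1_seq ?addr0// => k _.
by rewrite nr0 expr0n.
Qed.

Lemma uw_functional_single x y (T : op) :
  uw_functional ip (single x) (single y) T = ip (T x) y.
Proof.
have h : series (fun n => ip (T (single x n)) (single y n)) @ \oo --> ip (T x) y.
  apply/nr_cvgP => e e0; exists 1%N => // -[//|n] _ /=.
  rewrite /series /= big_nat_recl//= big1_seq ?addr0 ?subrr ?nr0// => k _.
  by rewrite ip0r.
have hl : series (fun n => ip (T (single x n)) (single y n)) @ \oo -->
  uw_functional ip (single x) (single y) T by exact: cvgP h.
exact: (cvg_uniqC hl h).
Qed.

(** When the norms agree, the square norm of [l - f i] is twice the real part of [ip (l - f i) l],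
    whence the tolerance [e ^+ 2 / 2]. *)
Lemma cvg_isometric_weak T (F : set_system T) {FF : Filter F} (f : T -> H) (l : H) :
  (forall i, nr (f i) = nr l) -> ip (f i) l @[i --> F] --> ip l l -> f i @[i --> F] --> l.
Proof.
move=> nf /nr_cvgP h; apply/nr_cvgP => e e0.
have e20 : 0 < e ^+ 2 / 2 by rewrite divr_gt0// exprn_gt0.
apply: filterS (h _ e20) => i hi.
rewrite -ltr_sqr ?nnegrE ?nr_ge0 ?(ltW e0)// (nr2D ip_norm) nrN nf ipNr raddfN/=.
have hl : nr l ^+ 2 = complex.Re (ip l l) by rewrite (ip_nr ip_norm).
have hr := le_lt_trans (Re_le_nr (ip l l - ip (f i) l)) hi.
have e1 : complex.Re (ip l (f i)) = complex.Re (ip (f i) l).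
  by rewrite ipC; case: (ip (f i) l).
rewrite e1 hl; move: hr; rewrite raddfB /= ltr_norml => /andP[h1 h2]; lra.
Qed.

(** Ultraweak continuity of [beta] makes [U] weakly continuous on the vectors [y Om]. Constancy of
    the norms makes this strong, and density extends it to [H]. *)
Lemma strongly_continuous (M : set op) (Om : H) (beta : R -> op -> op) (U : R -> op) :
  M `<=` bnd -> dense [set y Om | y in M] -> uw_continuous ip M beta ->
  (forall t, bnd (U t)) -> (forall t x, nr (U t x) = nr x) ->
  (forall t y, M y -> U t (y Om) = beta t y Om) ->
  forall t x, U s x @[s --> t] --> U t x.
Proof.
move=> bM /nr_denseP dM uwc bU nU hU t x; apply/nr_cvgP => e e0.
have e40 : 0 < e / 4 by rewrite divr_gt0.
have [_ [y My <-] xy] := dM x _ e40.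
have h : U s (y Om) @[s --> t] --> U t (y Om).
  apply: cvg_isometric_weak => [s|]; first by rewrite !nU.
  have /nr_cvgP hw := uwc y My t (single Om) (single (U t (y Om)))
    (@single_summable Om) (@single_summable _).
  apply/nr_cvgP => d d0; have {}hw := hw (@fmap_filter _ _ _ _ (nbhs_filter t)) d d0.
  have : \forall s \near t, nr (uw_functional ip (single Om) (single (U t (y Om))) (beta t y)
      - uw_functional ip (single Om) (single (U t (y Om))) (beta s y)) < d by exact: hw.
  apply: filterS => s; rewrite !uw_functional_single.
  by rewrite -(hU t y My) -(hU s y My).
move/nr_cvgP: h => /(_ _ e40); apply: filterS => s hs.
have b1 z : nr (U z x - U z (y Om)) < e / 4 by rewrite -(bndB (bU z)) nU.
apply: le_lt_trans (nr_tri (U t (y Om)) _ _) _.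
apply: le_lt_trans (lerD (lexx _) (nr_tri (U s (y Om)) _ _)) _.
have := b1 t; have := b1 s; rewrite (nrB (U s x)); lra.
Qed.

Section Conjugation.
Variable V : R -> op.
Hypothesis bV : forall t, bnd (V t).
Hypothesis V_adj : forall t, adjo (V t) = V (- t).
Hypothesis V0 : V 0 = idfun.
Hypothesis VD : forall s t, V (s + t) = V s \o V t.
Hypothesis V_cont : forall t x, V s x @[s --> t] --> V t x.

(** [V (- t)] is the adjoint of [V t]. Unlike the perturbed group itself, this acts on all bounded
    operators, as [quantum_noise] demands. *)
Definition conjugation (t : R) (y : op) : op := V t \o y \o V (- t).

Lemma V_NK t x : V (- t) (V t x) = x.
Proof. by have /= <- := congr1 (fun f => f x) (VD (- t) t); rewrite addNr V0. Qed.

Lemma V_KN t x : V t (V (- t) x) = x.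
Proof. by have /= <- := congr1 (fun f => f x) (VD t (- t)); rewrite subrr V0. Qed.

Lemma V_nr t x : nr (V t x) = nr x.
Proof.
apply: (isometry_nr ip_norm) => //; apply/funext => y.
by rewrite /= V_adj V_NK.
Qed.

Lemma bnd_conjugation t y : bnd y -> bnd (conjugation t y).
Proof. by move=> by_; exact: bnd_comp (bnd_comp (bV t) by_) (bV (- t)). Qed.

Lemma conjugationK t y : conjugation (- t) (conjugation t y) = y.
Proof. by apply/funext => x; rewrite /conjugation /= opprK !V_NK. Qed.

Lemma conjugation_group : aut_group ip bnd conjugation.
Proof.
split.
- move=> t; split; first split.
  + exact: bnd_conjugation.
  + by apply/funext => x; rewrite /conjugation /= V_KN.
  + move=> a S T bS bT; apply/funext => x; rewrite /conjugation /=.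
    by rewrite (bndP (bV t)).
  + by move=> S T _ _; apply/funext => x; rewrite /conjugation /= V_NK.
  + move=> S T bS bT ST x y; rewrite /conjugation /= (adjoP ip_norm _ _ (bV t)) V_adj ST.
    by rewrite (adjoP ip_norm _ _ (bV _)) V_adj opprK.
  + split.
    * exact: bnd_conjugation.
    * by move=> S T _ _ e; rewrite -(conjugationK t S) e conjugationK.
    * move=> T bT; exists (conjugation (- t) T); first exact: bnd_conjugation.
      by rewrite -{1}[t]opprK conjugationK.
- by move=> T bT; apply/funext => x; rewrite /conjugation /= oppr0 V0.
- move=> s t T bT; apply/funext => x.
  by rewrite /conjugation /= opprD [- s - t]addrC !VD.
Qed.

Lemma conjugation_continuous : uw_continuous ip bnd conjugation.
Proof.
move=> T bT t xi eta /square_summableP[B hB] /square_summableP[B' hB'].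
have [c c0 hc] := bnd_norm bT.
have term s x y : ip (conjugation s T x) y = ip (T (V (- s) x)) (V (- s) y).
  by rewrite /conjugation /= (adjoP ip_norm _ _ (bV s)) V_adj.
have bound s n : nr (ip (conjugation s T (xi n)) (eta n)) <=
    c * (nr (xi n) ^+ 2 + nr (eta n) ^+ 2).
  rewrite term; apply: le_trans (cauchy_schwarz ip_norm _ _) _.
  apply: le_trans (ler_wpM2r (nr_ge0 _) (hc _)) _; rewrite !V_nr.
  rewrite -mulrA ler_wpM2l//.
  have := sqr_ge0 (nr (xi n) - nr (eta n)); rewrite sqrrD sqrrN mulrN.
  have := sqr_ge0 (nr (xi n)); have := sqr_ge0 (nr (eta n)); rewrite mulr2n.
  by move: (nr (xi n) ^+ 2) (nr (eta n) ^+ 2) (nr (xi n) * nr (eta n)) => p q r; lra.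
have Vm x : V (- s) x @[s --> t] --> V (- t) x.
  apply: (@cvg_comp _ _ _ (fun s : R => - s) (fun s => V s x)); last exact: V_cont.
  by apply: cvgN; exact: cvg_id.
apply: (@tannery R R (nbhs t) (nbhs_filter t)
  (fun s n => ip (conjugation s T (xi n)) (eta n))
  (fun n => ip (conjugation t T (xi n)) (eta n))
  (fun n => c * (nr (xi n) ^+ 2 + nr (eta n) ^+ 2)) (c * (B + B'))).
- exact: bound.
- exact: bound.
- by move=> n; rewrite -mulr_sumr big_split/= ler_wpM2l// lerD.
- move=> n; rewrite term; under eq_fun do rewrite term.
  by apply: (ip_cvg ip_norm); [apply: (bnd_cvg bT); exact: Vm|exact: Vm].
Qed.

End Conjugation.
End Continuity.

(** * The transported noise *)

Section Transport.
Variables (R : realType) (H : completeNormedModType (Cx R)).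
Variable ip : {dot H for Num.conj}.
Local Notation C := (Cx R).
Local Notation op := (H -> H).
Local Notation uop := (set (H * H)%type).
Local Notation bnd := (@bounded_ops R H).
Local Notation adjo := (adjo ip).
Hypothesis ip_norm : forall x : H, ip x x = `|x| ^+ 2.

Lemma graph_closed_op T : bnd T -> closed_op (graph T).
Proof.
move=> bT; split.
- by rewrite /graph /= (bnd0 bT).
- by move=> a p q; rewrite /graph /= => -> ->; rewrite (bndP bT).
- by move=> y; rewrite /graph /= (bnd0 bT).
- by apply/nr_denseP => x e e0; exists x; rewrite ?subrr ?nr0//; exists (T x).
- move=> p /nr_closure2P hp; rewrite /graph /=; apply/subr0_eq/nr_lim0 => e e0.
  have [c c0 hc] := bnd_norm bT; have e20 : 0 < e / 2 by rewrite divr_gt0.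
  have m0 : 0 < Num.min (e / 2) (e / 2 / (c + 1)) by rewrite lt_min e20 divS_gt0.
  have [q [qT h1 h2]] := hp _ m0.
  move: h1 h2; rewrite !lt_min => /andP[_ h1] /andP[h2 _].
  apply: le_trans (nr_tri q.2 _ _) _; rewrite qT -(bndB bT) nrB.
  have h3 : nr (T (q.1 - p.1)) <= e / 2.
    apply: le_trans (hc _) _; rewrite nrB; apply: le_trans (ler_wpM2l c0 (ltW h1)) _.
    by rewrite mul_divS_le// ltW.
  by move: h2 h3; rewrite qT nrB; lra.
Qed.

Lemma exists_char_pair (G : uop) : closed_subspace G -> exists a b, char_pair ip G a b.
Proof.
move=> cG.
have /choice [P hP] : forall x, exists g, G g /\ forall q, G q -> gip ip ((x, 0) - g) q = 0.
  by move=> x; have [g Gg hg] := exists_projection ip_norm cG (x, 0); exists g.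
have uniq x g : G g -> (forall q, G q -> gip ip ((x, 0) - g) q = 0) -> g = P x.
  move=> Gg hg; apply/subr0_eq/(ip2_eq0 ip_norm).
  have Gd : G (g - P x) by apply: csB => //; case: (hP x).
  have -> : gip ip (g - P x) (g - P x) =
      gip ip ((x, 0) - P x) (g - P x) - gip ip ((x, 0) - g) (g - P x).
    by rewrite -ip2Bl; congr (gip ip _ _); rewrite opprB [RHS]addrC addrA subrK.
  by rewrite hg// (hP x).2// subrr.
have lin (a : C) x y : P (a *: x + y) = a *: P x + P y.
  apply/esym/uniq; first by apply: (csP cG); [case: (hP x)|case: (hP y)].
  move=> q Gq; have -> : (a *: x + y, 0) - (a *: P x + P y) =
      a *: ((x, 0) - P x) + ((y, 0) - P y) :> H * H.
    rewrite scalerBr addrACA -opprD; congr (_ - _).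
    by rewrite -[a *: (x, 0) + (y, 0)]/(a *: x + y, a *: 0 + 0) scaler0 addr0.
  by rewrite ip2Dl ip2Zl (hP x).2// (hP y).2// mulr0 addr0.
have nP x : nr2 (P x) <= nr x ^+ 2.
  have e := nr2BZ ip_norm ((x, 0) - P x) (P x) (-1).
  rewrite scaleN1r opprK subrK (hP x).2 ?mulr0 ?raddf0 ?mulr0 ?subr0 in e; last by case: (hP x).
  have n1 : nr (-1 : C) = 1 by rewrite nrN -rc1 nr_rc normr1.
  move: e; rewrite n1 expr1n mul1r {1}/nr2 /= nr0 expr0n addr0 => ->.
  by rewrite addr0 lerDr nr2_ge0.
exists (fun x => (P x).1), (fun x => (P x).2); split.
- apply: (@mk_bnd _ _ _ 1) => //; first by move=> a x y; rewrite lin.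
  move=> x; rewrite mul1r -ler_sqr ?nnegrE ?nr_ge0//; apply: le_trans (nP x).
  by rewrite lerDl sqr_ge0.
- apply: (@mk_bnd _ _ _ 1) => //; first by move=> a x y; rewrite lin.
  move=> x; rewrite mul1r -ler_sqr ?nnegrE ?nr_ge0//; apply: le_trans (nP x).
  by rewrite lerDr sqr_ge0.
- move=> x; split; first by rewrite -surjective_pairing; case: (hP x).
  by move=> p Gp; have := (hP x).2 p Gp; rewrite /gip /= sub0r.
Qed.

(** [kp_gen] speaks of the algebra generated by graphs of bounded operators, which thereby become an
    instance of the results on affiliated operators. *)
Lemma graph_affiliated (M : set op) T : von_neumann ip M -> M T -> affiliated ip M (graph T).
Proof.
move=> vM MT; have bT := vn_bnd vM MT; have cT := graph_closed_op bT.
have cG := closed_op_subspace cT; have [a [b ch]] := exists_char_pair cG.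
have key B : commutant M B -> B \o a = a \o B /\ B \o b = b \o B.
  move=> MB; have [bB MaB] := commutant_star ip_norm vM MB.
  have cw Q : commutant M Q -> commutes_with Q (graph T).
    by move=> MQ p; rewrite /graph /= => ->; rewrite (cmp_eq (MQ.2 _ MT)).
  apply: (commuting_char ip_norm cG ch bB (cw _ MB)).
  rewrite -(adjoK ip_norm bB); apply: (commutes_with_adj ip_norm); first exact: MaB.1.
  exact: cw.
have [ba bb _] := ch.
by split=> //; exists a, b; split=> //; apply: (vn_memP vM) => // B /key[].
Qed.

Section Fixed.
Variables (N : set op) (theta : op -> op) (I : set op) (W : op).
Hypothesis iw : intertwiner ip N theta I W.
Local Notation push := (push ip I).
Local Notation stable := (stable ip I).

Let bI X : I X -> bnd X. Proof. exact: (iw_bnd iw). Qed.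
Let bIa X : I X -> bnd (adjo X). Proof. by move=> /bI; exact: (bnd_adjo ip_norm). Qed.

Lemma push_zero : push (@op_zero R H) = @op_zero R H.
Proof.
apply/seteqP; split=> p hp; first by apply: (iw_total iw) => X IX; exact: (hp X IX).
by move=> X IX; rewrite /op_zero /= hp (bnd0 (bIa IX)).
Qed.

(** Closedness and stability are carried along so that operations can be nested, as in [op_sub] and
    in the linearity of the noise. *)
Lemma push_scale (a : C) G : closed_subspace G -> stable G ->
  [/\ closed_subspace (op_scale a G), stable (op_scale a G) &
      push (op_scale a G) = op_scale a (push G)].
Proof.
move=> cG sG; have sub (K : uop) : closed_subspace K ->
    let S := [set p | exists2 u, K (p.1, u) & p.2 = a *: u] in
    S 0 /\ forall (b : C) p q, S p -> S q -> S (b *: p + q).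
  move=> cK; split; first by exists 0; [exact: (cs0 cK)|rewrite scaler0].
  move=> b p q [u Ku pu] [v Kv qv]; exists (b *: u + v).
    exact: (csP cK b Ku Kv).
  by rewrite /= pu qv scalerDr !scalerA (mulrC a b).
have sS := sub _ cG; have sS' := sub _ (push_closed_subspace ip_norm iw cG).
have [h1 h2] : stable (op_scale a G) /\ push (op_scale a G) = op_scale a (push G).
  apply: (push_closure ip_norm iw) => //.
    move=> X p IX [u Gu pu]; exists (X u); last by rewrite /= pu (bndZ (bI IX)).
    exact: (push_in (p := (p.1, u)) sG IX Gu).
  move=> X p IX [u Gu pu]; exists (adjo X u); last by rewrite /= pu (bndZ (bIa IX)).
  exact: (Gu X IX).
by split=> //; exact: closure_subspace2 sS.1 sS.2.
Qed.

Lemma push_add G1 G2 : closed_subspace G1 -> stable G1 -> closed_subspace G2 -> stable G2 ->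
  [/\ closed_subspace (op_add G1 G2), stable (op_add G1 G2) &
      push (op_add G1 G2) = op_add (push G1) (push G2)].
Proof.
move=> c1 s1 c2 s2; have sub (K1 K2 : uop) : closed_subspace K1 -> closed_subspace K2 ->
    let S := [set p | exists u v, [/\ K1 (p.1, u), K2 (p.1, v) & p.2 = u + v]] in
    S 0 /\ forall (b : C) p q, S p -> S q -> S (b *: p + q).
  move=> k1 k2; split; first by exists 0, 0; split; [exact: (cs0 k1)|exact: (cs0 k2)|rewrite addr0].
  move=> b p q [u [v [Ku Kv pu]]] [u' [v' [Ku' Kv' qu]]].
  exists (b *: u + u'), (b *: v + v'); split.
  - exact: (csP k1 b Ku Ku').
  - exact: (csP k2 b Kv Kv').
  - by rewrite /= pu qu scalerDr addrACA.
have sS := sub _ _ c1 c2.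
have sS' := sub _ _ (push_closed_subspace ip_norm iw c1) (push_closed_subspace ip_norm iw c2).
have [h1 h2] : stable (op_add G1 G2) /\ push (op_add G1 G2) = op_add (push G1) (push G2).
  apply: (push_closure ip_norm iw) => //.
    move=> X p IX [u [v [Gu Gv pu]]]; exists (X u), (X v); split.
    + exact: (push_in (p := (p.1, u)) s1 IX Gu).
    + exact: (push_in (p := (p.1, v)) s2 IX Gv).
    + by rewrite /= pu (bndD (bI IX)).
  move=> X p IX [u [v [Gu Gv pu]]]; exists (adjo X u), (adjo X v); split.
  + exact: (Gu X IX).
  + exact: (Gv X IX).
  + by rewrite /= pu (bndD (bIa IX)).
by split=> //; exact: closure_subspace2 sS.1 sS.2.
Qed.

Lemma push_sub G1 G2 : closed_subspace G1 -> stable G1 -> closed_subspace G2 -> stable G2 ->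
  push (op_sub G1 G2) = op_sub (push G1) (push G2).
Proof.
move=> c1 s1 c2 s2; have [c3 s3 e3] := push_scale (-1) c2 s2.
by have [_ _ e] := push_add c1 s1 c3 s3; rewrite /op_sub e e3.
Qed.

Lemma push_comm G1 G2 : closed_subspace G1 -> stable G1 -> closed_subspace G2 -> stable G2 ->
  push (op_comm G1 G2) = op_comm (push G1) (push G2).
Proof.
move=> c1 s1 c2 s2; have sub (K1 K2 : uop) : closed_subspace K1 -> closed_subspace K2 ->
    let S := [set p | exists u u' v v', [/\ K2 (p.1, u), K1 (u, u'),
      K1 (p.1, v), K2 (v, v') & p.2 = u' - v']] in
    S 0 /\ forall (b : C) p q, S p -> S q -> S (b *: p + q).
  move=> k1 k2; split.
    exists 0, 0, 0, 0; split; rewrite ?subrr//;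
      [exact: (cs0 k2)|exact: (cs0 k1)|exact: (cs0 k1)|exact: (cs0 k2)].
  move=> b p q [u [u' [v [v' [a1 a2 a3 a4 pE]]]]] [x [x' [y [y' [b1 b2 b3 b4 qE]]]]].
  exists (b *: u + x), (b *: u' + x'), (b *: v + y), (b *: v' + y'); split.
  - exact: (csP k2 b a1 b1).
  - exact: (csP k1 b a2 b2).
  - exact: (csP k1 b a3 b3).
  - exact: (csP k2 b a4 b4).
  - by rewrite /= pE qE scalerBr opprD addrACA.
have sS := sub _ _ c1 c2.
have sS' := sub _ _ (push_closed_subspace ip_norm iw c1) (push_closed_subspace ip_norm iw c2).
apply: (proj2 (push_closure ip_norm iw _ _ _ _)) => //.
  move=> X p IX [u [u' [v [v' [a1 a2 a3 a4 pE]]]]].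
  exists (X u), (X u'), (X v), (X v'); split.
  - exact: (push_in (p := (p.1, u)) s2 IX a1).
  - exact: (push_in (p := (u, u')) s1 IX a2).
  - exact: (push_in (p := (p.1, v)) s1 IX a3).
  - exact: (push_in (p := (v, v')) s2 IX a4).
  - by rewrite /= pE (bndB (bI IX)).
move=> X p IX [u [u' [v [v' [a1 a2 a3 a4 pE]]]]].
exists (adjo X u), (adjo X u'), (adjo X v), (adjo X v'); split.
- exact: (a1 X IX).
- exact: (a2 X IX).
- exact: (a3 X IX).
- exact: (a4 X IX).
- by rewrite /= pE (bndB (bIa IX)).
Qed.

(** The linear span of the vectors [X xi], encoded as an intersection of subspaces so that
    membership is itself an induction principle. *)
Definition span_image (D : set H) : set H :=
  [set u | forall S : set H, @Defs.subspace R H S -> (forall X xi, I X -> D xi -> S (X xi)) -> S u].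

Lemma span_image_subspace D : @Defs.subspace R H (span_image D).
Proof.
split; first by move=> S [S0 _] _.
by move=> a x y hx hy S sS hS; apply: sS.2; [exact: hx|exact: hy].
Qed.

Lemma span_image_in D X xi : I X -> D xi -> span_image D (X xi).
Proof. by move=> IX Dxi S _; apply. Qed.

Lemma span_image_dense D : dense D -> dense (span_image D).
Proof.
move=> dD; apply: (total_dense ip_norm (span_image_subspace D)) => u hu.
apply: (iw_total iw) => X IX; apply: (dense_total ip_norm dD) => x Dx.
by rewrite (adjoPr ip_norm _ _ (bI IX)); apply: hu; exact: span_image_in.
Qed.

Lemma dom_subspace G : closed_subspace G -> @Defs.subspace R H (Defs.dom G).
Proof.
move=> cG; split; first by exists 0; exact: (cs0 cG).
by move=> a x y [x' Gx] [y' Gy]; exists (a *: x' + y'); exact: (csP cG a Gx Gy).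
Qed.

Lemma push_core G D : @Defs.subspace R H D -> closed_op G -> stable G -> core G D ->
  core (push G) (span_image D).
Proof.
move=> sD cG' sG [DG coreG]; have cG := closed_op_subspace cG'.
have cP := push_closed_subspace ip_norm iw cG.
split.
  move=> u; apply; first exact: dom_subspace.
  move=> X xi IX Dxi; have [y Gy] := DG _ Dxi.
  by exists (X y); exact: (push_in (p := (xi, y)) sG IX Gy).
apply/seteqP; split.
  move=> p hp; apply: (csC cP); apply: closureS hp => q; by case.
apply: (push_ind ip_norm iw cG sG).
  apply: closure_subspace2.
    by split; [exact: (cs0 cP)|split=> //; exact: (span_image_subspace D).1].
  move=> a p q [hp [Dp _]] [hq [Dq _]]; split; first exact: (csP cP).
  by split=> //; exact: (span_image_subspace D).2.
move=> X p IX; rewrite -{1}coreG; apply: (closure_map (bI IX)) => q [Gq [Dq _]].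
split; first exact: push_in.
by split=> //; exact: span_image_in.
Qed.

Lemma push_invariant G D : @Defs.subspace R H D -> closed_op G -> stable G -> core G D ->
  (forall p, G p -> D p.1 -> D p.2) ->
  forall p, push G p -> span_image D p.1 -> span_image D p.2.
Proof.
move=> sD cG sG [DG _] iD p Gp Dp.
have cP := push_closed_op ip_norm iw cG sG; have cP' := closed_op_subspace cP.
(* By univalence it is enough that some value of [push G] at [p.1] lies in the span; the vectors
   having such a value form a subspace. *)
suff [v Dv Gv] : exists2 v, span_image D v & push G (p.1, v).
  suff -> : p.2 = v by [].
  apply/subr0_eq/(co_univalent cP).
  have h : push G (p.1, p.2) by rewrite -surjective_pairing.
  by have := csB cP' h Gv; rewrite -[(_, _) - _]/(p.1 - p.1, p.2 - v) subrr.
apply: (Dp [set u | exists2 v, span_image D v & push G (u, v)]).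
  split; first by exists 0; [exact: (span_image_subspace D).1|exact: (cs0 cP')].
  move=> a x y [v Dv Gv] [v' Dv' Gv']; exists (a *: v + v').
    exact: (span_image_subspace D).2.
  exact: (csP cP' a Gv Gv').
move=> X xi IX Dxi; have [y Gy] := DG _ Dxi; exists (X y).
  by apply: span_image_in => //; exact: (iD (xi, y)).
exact: (push_in (p := (xi, y)) sG IX Gy).
Qed.

(** The vectors admitting some continuous path of values form a subspace, and univalence makes the
    path unique. *)
Lemma push_path_continuous (G : R -> uop) D : (forall t, closed_op (G t)) ->
  (forall t, stable (G t)) -> (forall t, D `<=` Defs.dom (G t)) ->
  (forall xi (f : R -> H), D xi -> (forall t, G t (xi, f t)) -> continuous f) ->
  forall xi (f : R -> H), span_image D xi -> (forall t, push (G t) (xi, f t)) -> continuous f.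
Proof.
move=> cG sG DG cont xi f Dxi hf.
have cP t := push_closed_op ip_norm iw (cG t) (sG t).
have cP' t := closed_op_subspace (cP t).
suff [g cg hg] : exists2 g : R -> H, continuous g & forall t, push (G t) (xi, g t).
  suff -> : f = g by [].
  apply/funext => t; apply/subr0_eq/(co_univalent (cP t)).
  by have := csB (cP' t) (hf t) (hg t); rewrite -[(_, _) - _]/(xi - xi, f t - g t) subrr.
apply: (Dxi [set u | exists2 g : R -> H, continuous g & forall t, push (G t) (u, g t)]).
  split; first by exists (fun=> 0) => [t|t]; [exact: cvg_cst|exact: (cs0 (cP' t))].
  move=> a x y [g cg hg] [h ch hh]; exists (fun t => a *: g t + h t).
    by move=> t; apply: cvgD; [apply: cvgZr; exact: cg|exact: ch].
  by move=> t; exact: (csP (cP' t) a (hg t) (hh t)).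
move=> X x IX Dx.
have /choice [g hg] : forall t, exists y, G t (x, y) by move=> t; exact: DG.
exists (fun t => X (g t)).
  by move=> t; apply: (bnd_cvg (bI IX)); exact: (cont x g Dx hg).
by move=> t; exact: (push_in (p := (x, g t)) (sG t) IX (hg t)).
Qed.

End Fixed.
End Transport.

(** * Noise axioms and Kolmogorov property of the image *)

Section TransportedNoise.
Variables (R : realType) (H : completeNormedModType (Cx R)).
Variable ip : {dot H for Num.conj}.
Local Notation C := (Cx R).
Local Notation op := (H -> H).
Local Notation uop := (set (H * H)%type).
Local Notation bnd := (@bounded_ops R H).
Local Notation affiliated := (affiliated ip).
Hypothesis ip_norm : forall x : H, ip x x = `|x| ^+ 2.

Variables (A : lmodType (Cx R)) (br : A -> A -> A) (star : A -> A).
Variables (j : R -> A -> uop) (alpha : R -> op -> op) (rho : op) (M : set op).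
Variables (D : set H) (U : R -> op).
Hypothesis qn : quantum_noise ip br star j alpha rho.
Hypothesis vM : von_neumann ip M.
Hypothesis Mnoise : M = noise_alg ip j.
Hypothesis Mincr : M = all_incr_alg ip j.
Hypothesis shM : shift_relation ip M alpha j.
Hypothesis autM : aut_group ip M alpha.
Hypothesis cD : common_domain ip alpha j D.
Hypothesis iwU : forall t, intertwiner ip M (alpha t) [set U t] (U t).

Variables (theta : op -> op) (I : set op) (W : op) (Om : H).
Hypothesis iw : intertwiner ip M theta I W.
Hypothesis thM : forall y, M y -> M (theta y).
Hypothesis WOm : W Om = Om.
Hypothesis expectE : forall y, M y -> expect ip rho y = ip (y Om) Om.

Variable alphat : R -> op -> op.
Hypothesis alphat_group : aut_group ip bnd alphat.
Hypothesis alphat_cont : uw_continuous ip bnd alphat.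
Hypothesis alphat_inv : forall t y, bnd y ->
  expect ip (rank_one ip Om) (alphat t y) = expect ip (rank_one ip Om) y.
Hypothesis alphatM_group : aut_group ip M alphat.
Hypothesis alphat_theta : forall t y, M y -> alphat t (theta y) = theta (alpha t y).

Let aM t y : M y -> M (alpha t y). Proof. exact: (sh_maps (ag_aut autM t).1). Qed.
Let bM y : M y -> bnd y. Proof. exact: (vn_bnd vM). Qed.

Definition pushed (t : R) (x : A) : uop := push ip I (j t x).
Local Notation Mt := (theta @` M).

Let aJ t x : affiliated M (j t x). Proof. exact: (noise_affiliated qn shM). Qed.
Let sJ t x : closed_subspace (j t x). Proof. exact: (noise_subspace qn). Qed.
Let stJ t x : stable ip I (j t x). Proof. exact: (stable_affiliated ip_norm iw (aJ t x)). Qed.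
Let aS s t x : affiliated M (shifted ip j U s t x).
Proof. exact: (shifted_affiliated ip_norm qn shM autM iwU). Qed.
Let aI s t x : affiliated M (incr j s t x).
Proof. exact: (incr_affiliated ip_norm qn vM shM autM cD iwU). Qed.

Lemma pushed_incr s t x : incr pushed s t x = push ip I (incr j s t x).
Proof. by rewrite /incr (push_sub ip_norm iw). Qed.

Lemma pushed_gen (S S' : set uop) : (forall G, S G -> affiliated M G) ->
  push ip I @` S = S' -> vN_gen ip S' = theta @` vN_gen ip S.
Proof. by move=> aSS <-; exact: (vN_gen_push ip_norm iw vM aSS). Qed.

Lemma pushed_noise_alg : noise_alg ip pushed = Mt.
Proof.
rewrite Mnoise; apply: pushed_gen; first by move=> G [t [x ->]].
apply/seteqP; split; first by move=> _ [G [t [x ->]] <-]; exists t, x.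
by move=> _ [t [x ->]]; exists (j t x) => //; exists t, x.
Qed.

Lemma pushed_all_incr_alg : all_incr_alg ip pushed = Mt.
Proof.
rewrite Mincr; apply: pushed_gen; first by move=> G [s [t [x ->]]].
apply/seteqP; split.
  by move=> _ [G [s [t [x ->]]] <-]; exists s, t, x; rewrite pushed_incr.
by move=> _ [s [t [x ->]]]; exists (incr j s t x); [exists s, t, x|rewrite pushed_incr].
Qed.

Lemma pushed_past_alg t : past_alg ip pushed t = theta @` past_alg ip j t.
Proof.
apply: pushed_gen; first by move=> G [r [x [rt ->]]].
apply/seteqP; split.
  by move=> _ [G [r [x [rt ->]]] <-]; exists r, x; rewrite pushed_incr.
by move=> _ [r [x [rt ->]]]; exists (incr j r t x); [exists r, x|rewrite pushed_incr].
Qed.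

Lemma pushed_incr_alg s t : incr_alg ip pushed s t = theta @` incr_alg ip j s t.
Proof.
apply: pushed_gen; first by move=> G [x _ <-].
apply/seteqP; split; first by move=> _ [G [x _ <-] <-]; exists x => //; rewrite pushed_incr.
by move=> _ [x _ <-]; exists (incr j s t x); [exists x|rewrite pushed_incr].
Qed.

Lemma pushed_closed t x : closed_op (pushed t x).
Proof. exact: (push_closed_op ip_norm iw (qn_closed qn t x)). Qed.

Lemma pushed_incr_subspace s t x : closed_subspace (incr pushed s t x).
Proof.
rewrite pushed_incr; apply: (push_closed_subspace ip_norm iw).
by apply: closed_op_subspace; case: (aI s t x).
Qed.

(** The image is the algebra generated by the pushed noise, and that is a commutant by
    definition. *)
Lemma image_vN : von_neumann ip Mt.
Proof.
rewrite -pushed_noise_alg; apply: (vN_gen_vN ip_norm) => G [t [x ->]].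
exact/closed_op_subspace/pushed_closed.
Qed.

Lemma image_sub : Mt `<=` M.
Proof. by move=> _ [y My <-]; exact: thM. Qed.

Lemma pushed_image t x : op_image ip M theta (j t x) (pushed t x).
Proof. exact: (push_op_image ip_norm iw (aJ t x)). Qed.

(** [N] is left open because the shift relation is wanted in all bounded operators for the noise
    axioms and in the image of [M] for the flow. *)
Lemma pushed_shifted_image (N : set op) s t x : Mt `<=` N ->
  op_image ip N (alphat t) (pushed s x) (push ip I (shifted ip j U t s x)).
Proof.
move=> MN; have [_ [a [b [Ma Mb ch ch1]]]] := pushed_image s x.
have cS := (aS t s x).1.
have ch2 : char_pair ip (shifted ip j U t s x) (alpha t a) (alpha t b).
  by apply: (push_char ip_norm (iwU t)) => //; exact: (stable_affiliated ip_norm (iwU t)).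
split; first exact: (push_closed_op ip_norm iw cS (stable_affiliated ip_norm iw (aS t s x))).
exists (theta a), (theta b); split=> //; [by apply: MN; exists a|by apply: MN; exists b|].
rewrite !alphat_theta//; apply: (push_char ip_norm iw) => //.
- exact: closed_op_subspace.
- exact: (stable_affiliated ip_norm iw (aS t s x)).
- exact: aM.
- exact: aM.
Qed.

Lemma pushed_shift_add s t x :
  pushed (t + s) x = op_add (pushed t x) (push ip I (shifted ip j U t s x)).
Proof.
rewrite /pushed (noise_shift ip_norm qn shM iwU).
have [_ _ ->] := push_add ip_norm iw (sJ t x) (@stJ t x)
  (closed_op_subspace (aS t s x).1) (stable_affiliated ip_norm iw (aS t s x)).
by [].
Qed.

Lemma pushed_shift (N : set op) : Mt `<=` N -> shift_relation ip N alphat pushed.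
Proof.
move=> MN s t x; exists (push ip I (shifted ip j U t s x)).
  exact: pushed_shifted_image.
exact: pushed_shift_add.
Qed.

Lemma pushed_domain : common_domain ip alphat pushed (span_image I D).
Proof.
case: cD => sD dD coreD _ contD; split.
- exact: span_image_subspace.
- exact: (span_image_dense ip_norm iw dD).
- move=> t x; have [c1 c2] := coreD t x; split.
    exact: (push_core ip_norm iw sD (qn_closed qn t x) (@stJ t x)).
  exact: (push_invariant ip_norm iw sD (qn_closed qn t x) (@stJ t x) c1 c2).
(* Uniqueness of characteristic pairs identifies any image [G] with the pushed operator, whose core
   is known. *)
- move=> s t x G imG; suff -> : G = push ip I (shifted ip j U t s x).
    apply: (push_core ip_norm iw sD (aS t s x).1 (stable_affiliated ip_norm iw (aS t s x))).
    exact: (shifted_core ip_norm qn vM shM cD iwU).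
  have [cG [a [b [_ _ ch ch']]]] := imG.
  have [cG' [a2 [b2 [_ _ ch2 ch2']]]] := @pushed_shifted_image M s t x image_sub.
  have [e1 e2] := char_pair_uniq ip_norm (closed_op_subspace (pushed_closed s x)) ch ch2.
  rewrite e1 e2 in ch'; exact: (char_pair_inj ip_norm cG cG' ch' ch2').
- move=> x xi f Dxi hf.
  apply: (@push_path_continuous _ _ _ ip_norm _ _ _ _ iw (fun t => j t x) D _ _ _ _ xi f) => //.
  + by move=> t; exact: (qn_closed qn).
  + by move=> t; have [[h _] _] := coreD t x.
  + by move=> y g Dy hg; exact: (contD x y g Dy hg).
Qed.

(** [W] intertwines and fixes [Om], and it is isometric, so the matrix element at [Om] is
    unchanged. *)
Lemma theta_expect y : M y -> expect ip (rank_one ip Om) (theta y) = expect ip rho y.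
Proof.
move=> My; rewrite (expect_rank_one ip_norm)//; last exact/bM/thM.
rewrite expectE// -{1}WOm; have /= <- := cmp_eq (iw_l iw (iw_in iw) My) Om.
have bW := iw_bnd iw (iw_in iw).
rewrite -{2}WOm (adjoP ip_norm _ _ bW).
by have /= -> := cmp_eq1 (iw_iso iw) Om.
Qed.

Lemma theta_comp S T : M S -> M T -> theta (S \o T) = theta S \o theta T.
Proof. by move=> MS MT; apply: (iw_comp ip_norm iw) => //; exact: (vn_comp vM). Qed.

Lemma vN_gen_incr_sub s t (S : set A) : vN_gen ip [set incr j s t x | x in S] `<=` M.
Proof. by apply: (vN_gen_sub ip_norm vM) => G [x _ <-]. Qed.

Lemma theta_big n (y z : 'I_n -> op) : (forall i, M (z i)) -> (forall i, theta (z i) = y i) ->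
  M (\big[comp/idfun]_(i < n) z i) /\
  theta (\big[comp/idfun]_(i < n) z i) = \big[comp/idfun]_(i < n) y i.
Proof.
move=> Mz zy; elim/big_rec2: _ => [|i S T _ [MT TS]].
  by split; [exact: (vn_id vM)|apply: (iw_id ip_norm iw); exact: (vn_id vM)].
by split; [exact: (vn_comp vM)|rewrite theta_comp// TS zy].
Qed.

Lemma pushed_quantum_noise : quantum_noise ip br star pushed alphat (rank_one ip Om).
Proof.
split.
- exact: pushed_closed.
- by exists (span_image I D); exact: pushed_domain.
- by move=> x; rewrite /pushed (qn_zero qn) (push_zero ip_norm iw).
- move=> t a x y; rewrite /pushed (qn_linear qn).
  have [c1 s1 e1] := push_scale ip_norm iw a (sJ t x) (@stJ t x).
  by have [_ _ ->] := push_add ip_norm iw c1 s1 (sJ t y) (@stJ t y); rewrite e1.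
- by move=> t x; rewrite /pushed (push_adj ip_norm iw)// (qn_star qn).
- by move=> t x y t0; rewrite /pushed (qn_br qn)// (push_comm ip_norm iw).
- exact: alphat_group.
- exact: alphat_cont.
- by apply: pushed_shift => y /image_sub/bM.
(* The square norm of [Om] is the trace of [rho]. *)
- apply: (density_rank_one ip_norm); rewrite -[X in ip X]/(idfun Om) -expectE.
    by apply: (tr_eq ip_norm); case: (qn_state qn).
  exact: (vn_id vM).
- exact: alphat_inv.
- move=> s1 t1 s2 t2 x1 x2 y1 y2 st1 st2 dis.
  have gen s t x : vN_gen ip [set incr pushed s t x] = theta @` vN_gen ip [set incr j s t x].
    by apply: pushed_gen; [move=> _ ->|rewrite image_set1 pushed_incr].
  have sub s t x : vN_gen ip [set incr j s t x] `<=` M.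
    by apply: (vN_gen_sub ip_norm vM) => _ ->.
  rewrite !gen => -[z1 Fz1 <-] [z2 Fz2 <-].
  have Mz1 := sub _ _ _ _ Fz1; have Mz2 := sub _ _ _ _ Fz2.
  rewrite -(theta_comp Mz1 Mz2) -(theta_comp Mz2 Mz1).
  by rewrite (qn_commute qn st1 st2 dis Fz1 Fz2).
- move=> n s t y st dis hy.
  have /choice [z hz] : forall i, exists z, incr_alg ip j (s i) (t i) z /\ theta z = y i.
    by move=> i; have := hy i; rewrite pushed_incr_alg => -[z Fz zy]; exists z.
  have Fz i : incr_alg ip j (s i) (t i) (z i) by case: (hz i).
  have Mz i : M (z i) by exact: vN_gen_incr_sub (Fz i).
  have zy i : theta (z i) = y i by case: (hz i).
  have [MZ <-] := theta_big Mz zy.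
  rewrite theta_expect// (qn_independent qn st dis Fz).
  by apply: eq_bigr => i _; rewrite -zy theta_expect.
Qed.

Lemma theta_scalar (c : C) : M (fun x => c *: x) -> theta (fun x => c *: x) = fun x => c *: x.
Proof.
move=> Mc; apply: (iw_eq ip_norm iw).
- exact: (iw_img iw).
- exact: (bnd_scale c (bnd_id H)).
- move=> X IX; rewrite -(iw_l iw IX Mc); apply/funext => x /=.
  by rewrite (bndZ (iw_bnd iw IX)).
Qed.

Lemma image_factor : vn_factor ip M -> vn_factor ip Mt.
Proof.
move=> [_ fac]; have scM c : M (fun x : H => c *: x).
  have : scalars (fun x : H => c *: x) by exists c.
  by rewrite -fac => -[].
split; first exact: image_vN.
apply/seteqP; split=> [_ [[y My <-] [_ hy]]|_ [c ->]].
  have : (M `&` commutant M) y.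
    split=> //; split; first exact: bM.
    move=> z Mz; apply: (iw_inj iw); try exact: (vn_comp vM).
    rewrite (theta_comp My Mz) (theta_comp Mz My); by apply: hy; exists z.
  by rewrite fac => -[c ye]; exists c; rewrite ye theta_scalar// -ye.
split; first by exists (fun x => c *: x); rewrite ?theta_scalar.
split; first exact: (bnd_scale c (bnd_id H)).
move=> _ [y My <-]; apply/funext => x /=.
by rewrite (bndZ (bM (thM My))).
Qed.

Lemma theta_star_hom N : Mt `<=` N -> star_hom ip M N theta.
Proof.
move=> MN; split.
- by move=> y My; apply: MN; exists y.
- by apply: (iw_id ip_norm iw); exact: (vn_id vM).
- by move=> a S T MS MT; apply: (iw_lincomb ip_norm iw) => //; exact: (vn_lincomb vM).
- exact: theta_comp.
- move=> S T MS MT /(adjo_uniq ip_norm (bM MS)) ->.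
  rewrite (iw_adjo ip_norm iw MS _ (bM MS)); last exact: (vn_adjo ip_norm vM).
  by move=> x y; rewrite (adjoP ip_norm)//; exact/bM/thM.
Qed.

Lemma image_comp t (N : set op) : N `<=` M ->
  alphat t @` (theta @` N) = theta @` (alpha t @` N).
Proof.
move=> NM; apply/seteqP; split.
  move=> _ [_ [y Ny <-] <-]; exists (alpha t y); first by exists y.
  by rewrite alphat_theta//; exact: NM.
move=> _ [_ [y Ny <-] <-]; exists (theta y); first by exists y.
by rewrite alphat_theta//; exact: NM.
Qed.

Lemma image_aut_group : aut_group ip Mt alphat.
Proof.
split.
- move=> t; have [[h1 h2 h3 h4 h5] [_ hinj _]] := ag_aut alphatM_group t.
  have maps T : Mt T -> Mt (alphat t T).
    by move=> [y My <-]; rewrite alphat_theta//; exists (alpha t y) => //; exact: aM.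
  split; first split=> //.
  + by move=> a S T /image_sub MS /image_sub MT; exact: h3.
  + by move=> S T /image_sub MS /image_sub MT; exact: h4.
  + by move=> S T /image_sub MS /image_sub MT; exact: h5.
  + split=> //.
      move=> S T; rewrite !inE => /image_sub MS /image_sub MT; apply: hinj; exact/mem_set.
    move=> _ [y My <-]; exists (theta (alpha (- t) y)).
      by exists (alpha (- t) y) => //; exact: aM.
    rewrite alphat_theta; last exact: aM.
    by rewrite -(ag_add autM)// subrr (ag_id autM).
- by move=> T /image_sub MT; exact: (ag_id alphatM_group).
- by move=> s t T /image_sub MT; exact: (ag_add alphatM_group).
Qed.

Lemma image_kolmogorov : kolmogorov_past ip M alpha (past_alg ip j 0) ->
  @scalars R H `<=` M ->
  kolmogorov_flow_generated_by ip Mt alphat pushed.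
Proof.
move=> kp scM; have [vN0 N0M mono gen triv] := kp.
have past : kolmogorov_past ip Mt alphat (past_alg ip pushed 0).
  rewrite pushed_past_alg; split.
  - rewrite -pushed_past_alg; apply: (vN_gen_vN ip_norm) => G [r [x [_ ->]]].
    exact: pushed_incr_subspace.
  - by move=> _ [y Ny <-]; exists y => //; exact: N0M.
  - by move=> s t st; rewrite !image_comp//; apply: image_subset; exact: mono.
  - have genM G : (@graph R H @` \bigcup_t (alpha t @` past_alg ip j 0)) G -> affiliated M G.
      move=> [_ [t _ [y Ny <-]] <-]; apply: (graph_affiliated ip_norm vM).
      by apply: aM; exact: N0M.
    rewrite {1}gen; apply/esym/(pushed_gen genM).
    apply/seteqP; split.
      move=> _ [_ [_ [t _ [y Ny <-]] <-] <-]; have May := aM t (N0M _ Ny).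
      rewrite (push_graph ip_norm iw May (bM May)); exists (theta (alpha t y)) => //.
      by exists t => //; rewrite image_comp//; exists (alpha t y) => //; exists y.
    move=> _ [x [t _ hx] <-]; move: hx; rewrite image_comp// => -[_ [y Ny <-] <-].
    have May := aM t (N0M _ Ny).
    exists (graph (alpha t y)); last by rewrite (push_graph ip_norm iw May (bM May)).
    by exists (alpha t y) => //; exists t => //; exists y.
  - apply/seteqP; split=> [T hT|_ [c ->]].
      have [y My yT] : Mt T.
        have := hT 0 Logic.I; rewrite image_comp// => -[_ [y Ny <-] <-].
        by exists (alpha 0 y) => //; exact/aM/N0M.
      have : (\bigcap_t (alpha t @` past_alg ip j 0)) y.
        move=> t _; have := hT t Logic.I; rewrite image_comp// => -[_ [z Nz <-]].
        rewrite -yT => /(iw_inj iw (aM t (N0M _ Nz)) My) <-; by exists z.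
      by rewrite triv => -[c ye]; exists c; rewrite -yT ye theta_scalar// -ye.
    move=> t _; rewrite image_comp//.
    have Mc : M (fun x => c *: x) by apply: scM; exists c.
    have : (\bigcap_t (alpha t @` past_alg ip j 0)) (fun x => c *: x).
      by rewrite triv; exists c.
    by move=> /(_ t Logic.I) h; exists (fun x => c *: x) => //; exact: theta_scalar.
split.
- split; [exact: image_vN|exact: image_aut_group|].
  by exists (past_alg ip pushed 0).
- exact: past.
- by rewrite pushed_all_incr_alg.
- exact: pushed_shift.
Qed.

Lemma pushed_noise_iso : noise_iso ip j rho pushed (rank_one ip Om).
Proof.
exists theta; rewrite -Mnoise pushed_noise_alg; split.
- split; first exact: theta_star_hom.
  split; first by move=> y My; exists y.
    by move=> S T; rewrite !inE => MS MT; exact: (iw_inj iw).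
  by move=> _ [y My <-]; exists y.
- exact: pushed_image.
- exact: theta_expect.
Qed.

End TransportedNoise.

(** * The perturbed group on the GNS space and its limit noise *)

Lemma star_iso_comp (R : realType) (H : completeNormedModType (Cx R))
    (ip : {dot H for Num.conj}) (N1 N2 N3 : set (H -> H)) (f g : (H -> H) -> (H -> H)) :
  star_iso ip N1 N2 f -> star_iso ip N2 N3 g -> star_iso ip N1 N3 (g \o f).
Proof.
move=> [[f1 f2 f3 f4 f5] fb] [[g1 g2 g3 g4 g5] gb]; split; last exact: set_bij_comp fb gb.
split=> /=.
- by move=> T NT; exact/g1/f1.
- by rewrite f2.
- by move=> a S T NS NT; rewrite f3// g3//; exact: f1.
- by move=> S T NS NT; rewrite f4// g4//; exact: f1.
- by move=> S T NS NT ST; apply: g5; [exact: f1|exact: f1|exact: f5].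
Qed.

Theorem theorem6p2 (R : realType)
    (A : lmodType (Cx R)) (br : A -> A -> A) (star : A -> A)
    (H : completeNormedModType (Cx R)) (ip : {dot H for Num.conj})
    (j : R -> A -> set (H * H)%type) (alpha : R -> (H -> H) -> (H -> H))
    (rho : H -> H) (M : set (H -> H)) (cls : (H -> H) -> H)
    (w : R -> (H -> H) -> (H -> H)) :
  lie_star_algebra br star ->
  (forall x : H, ip x x = `|x| ^+ 2) ->
  quantum_noise ip br star j alpha rho ->
  M = noise_alg ip j ->
  vn_factor ip M ->
  kolmogorov_flow_generated_by ip M alpha j ->
  standard_form ip M rho cls ->
  markovian_cocycle ip M j alpha w ->
  (forall t y, M y -> expect ip rho (w t y) = expect ip rho y) ->
  exists (Mt : set (H -> H)) (jt : R -> A -> set (H * H)%type)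
         (winf : (H -> H) -> (H -> H)),
    (forall y xi, M y -> w (- t) y xi @[t --> +oo] --> winf y xi) /\
    star_hom ip M M winf /\
    normal_map ip M winf /\
    Mt = winf @` M /\
    Mt `<=` M /\
    vn_factor ip Mt /\
    (forall t x, op_image ip M winf (j t x) (jt t x)) /\
    kolmogorov_flow_generated_by ip Mt (fun t y => w t (alpha t y)) jt /\
    (exists (alphat : R -> (H -> H) -> (H -> H)) (rhot : H -> H),
      [/\ quantum_noise ip br star jt alphat rhot,
          forall t y, M y -> alphat t y = w t (alpha t y),
          forall y, M y -> expect ip rhot y = expect ip rho y &
          noise_iso ip j rho jt rhot]).
Proof.
move=> lieA ip_norm qn ME [vM factM] [kf kp Mall shM] sf mc wE.
pose Om := cls idfun.
have bM y : M y -> bounded_ops y by move=> My; exact: (vn_bnd vM).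
have clsE y : M y -> cls y = y Om.
  by move=> My; rewrite /Om (sf_act sf My (vn_id vM)).
have cyc : dense [set y Om | y in M].
  have := sf_dense sf; congr dense; apply/seteqP; split=> _ [y My <-]; exists y => //.
    by rewrite clsE.
  by rewrite clsE.
have M0 : M (fun=> 0).
  have := vn_lincomb vM (-1) (vn_id vM) (vn_id vM).
  by congr (M _); apply/funext => x; rewrite /= scaleN1r addNr.
have sep y : M y -> y Om = 0 -> y = fun=> 0.
  move=> My yOm; apply: (sf_inj sf); rewrite ?inE//.
  by rewrite !clsE.
have EE y : M y -> expect ip rho y = ip (y Om) Om.
  move=> My; rewrite -clsE// -[cls y in RHS]/(cls y) /Om.
  by rewrite (sf_ip sf My (vn_id vM) (y' := idfun)).
have autM : aut_group ip M alpha by case: kf.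
have [D cD] := qn_domain qn.
have /choice [U hU] : forall t, exists V : H -> H,
    [/\ bounded_ops V, V \o adjo ip V = idfun, adjo ip V \o V = idfun,
        V Om = Om & (forall y, M y -> V (y Om) = alpha t y Om) /\
        forall y, M y -> V \o y = alpha t y \o V].
  move=> t; apply: (implementation ip_norm vM cyc (ag_aut autM t)) => y My.
  rewrite -!EE//; last exact: (sh_maps (ag_aut autM t).1).
  by rewrite (qn_invariant qn)//; exact: bM.
have /choice [Wu hW] : forall t, exists V : H -> H,
    [/\ bounded_ops V, V \o adjo ip V = idfun, adjo ip V \o V = idfun,
        V Om = Om & (forall y, M y -> V (y Om) = w t y Om) /\
        forall y, M y -> V \o y = w t y \o V].
  move=> t; apply: (implementation ip_norm vM cyc (mc_aut mc t)) => y My.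
  rewrite -!EE//; first exact: wE.
  exact: (sh_maps (mc_aut mc t).1).
have bU t : bounded_ops (U t) by case: (hU t).
have bW t : bounded_ops (Wu t) by case: (hW t).
have UU t : U t \o adjo ip (U t) = idfun by case: (hU t).
have UU' t : adjo ip (U t) \o U t = idfun by case: (hU t).
have WW t : Wu t \o adjo ip (Wu t) = idfun by case: (hW t).
have WW' t : adjo ip (Wu t) \o Wu t = idfun by case: (hW t).
have UOm t : U t Om = Om by case: (hU t).
have WOm t : Wu t Om = Om by case: (hW t).
have Uy t y : M y -> U t (y Om) = alpha t y Om by case: (hU t) => _ _ _ _ [h _]; exact: h.
have Wy t y : M y -> Wu t (y Om) = w t y Om by case: (hW t) => _ _ _ _ [h _]; exact: h.
have UM t y : M y -> U t \o y = alpha t y \o U t by case: (hU t) => _ _ _ _ [_ h]; exact: h.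
have WM t y : M y -> Wu t \o y = w t y \o Wu t by case: (hW t) => _ _ _ _ [_ h]; exact: h.
have aM t y : M y -> M (alpha t y) by exact: (sh_maps (ag_aut autM t).1).
have wM t y : M y -> M (w t y) by exact: (sh_maps (mc_aut mc t).1).
have iwU t : intertwiner ip M (alpha t) [set U t] (U t).
  apply: (unitary_intertwiner (bU t) (UU t) (UU' t) (UM t)).
  by move=> y My; apply: bM; exact: aM.
pose F := future_alg ip j.
have Fsub t : F t `<=` M.
  by move=> y; exact: (future_sub ip_norm qn vM shM autM cD iwU).
have Fshift r t : alpha r @` F t = F (r + t).
  exact: (future_shift ip_norm qn vM shM autM cD iwU).
have Fdense : dense [set y Om | y in \bigcup_s F s].
  by move=> O; exact: (future_dense ip_norm qn vM ME shM autM cD iwU cyc).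
have markov t y : 0 <= t -> F t y -> w t y = y by exact: (mc_markov mc).
pose W := Winf Wu; pose theta := winf w; pose I := [set z \o W | z in commutant M].
have iw : intertwiner ip M theta I W.
  exact: (winf_intertwiner ip_norm vM sep autM (mc_aut mc) (mc_id mc) (mc_cocycle mc)
    markov Fsub Fshift Fdense bW WW WW' WOm WM).
have thM y : M y -> M (theta y).
  exact: (winf_M ip_norm vM sep autM (mc_aut mc) (mc_id mc) (mc_cocycle mc)
    markov Fsub Fshift Fdense bW WW WW' WOm WM).
have thP y xi : M y -> w (- t) y xi @[t --> +oo] --> theta y xi.
  exact: (winfP ip_norm vM sep autM (mc_aut mc) (mc_id mc) (mc_cocycle mc)
    markov Fsub Fshift Fdense bW WW WW' WOm WM).
have th_shift t y : M y -> w t (alpha t (theta y)) = theta (alpha t y).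
  exact: (winf_shift ip_norm vM sep autM (mc_aut mc) (mc_id mc) (mc_cocycle mc)
    markov Fsub Fshift Fdense bU UU UM bW WW WW' WOm WM).
have WinfOm : W Om = Om.
  exact: (Winf_Om ip_norm autM (mc_aut mc) (mc_id mc) (mc_cocycle mc)
    markov Fsub Fshift Fdense bW WW' WOm WM).
pose V t := Wu t \o U t.
have bV t : bounded_ops (V t) by exact: bnd_comp.
have Vy t y : M y -> V t (y Om) = w t (alpha t y) Om.
  by move=> My; rewrite /V /= Uy// Wy//; exact: aM.
(* The cocycle identity is the group law of the perturbed maps. *)
have pert_add s t y : M y -> w (s + t) (alpha (s + t) y) = w s (alpha s (w t (alpha t y))).
  move=> My; rewrite (mc_cocycle mc); last exact: aM.
  by rewrite -(ag_add autM)// addrA addNr add0r.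
have total u : (forall z, [set y Om | y in M] z -> ip u z = 0) -> u = 0.
  exact: (dense_total ip_norm cyc).
have V0 : V 0 = idfun.
  apply: (bnd_total_eq ip_norm (bV 0) (bnd_id H) total) => _ [y My <-].
  by rewrite Vy// (ag_id autM)// (mc_id mc).
have VD s t : V (s + t) = V s \o V t.
  apply: (bnd_total_eq ip_norm (bV _) (bnd_comp (bV s) (bV t)) total) => _ [y My <-].
  rewrite Vy// pert_add// -Vy; last exact/wM/aM.
  by rewrite -(Vy t y My).
have VK t : adjo ip (V t) \o V t = idfun.
  rewrite (adjo_comp ip_norm (bW t) (bU t)); apply/funext => x /=.
  by have /= -> := cmp_eq1 (WW' t) (U t x); have /= -> := cmp_eq1 (UU' t) x.
have VKN t x : V t (V (- t) x) = x.
  by rewrite -[RHS]/(idfun x) -V0 -(subrr t) VD.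
have V_adj t : adjo ip (V t) = V (- t).
  apply/funext => x; have h : adjo ip (V t) (V t (V (- t) x)) = V (- t) x.
    exact: (cmp_eq1 (VK t)).
  by rewrite -h VKN.
have nU t x : nr (U t x) = nr x by exact: (isometry_nr ip_norm).
have nW t x : nr (Wu t x) = nr x by exact: (isometry_nr ip_norm).
have contU t x : U s x @[s --> t] --> U t x.
  apply: (strongly_continuous ip_norm bM cyc _ bU nU Uy) => y My.
  exact: (qn_group_continuous qn (bM y My)).
have contW t x : Wu s x @[s --> t] --> Wu t x.
  exact: (strongly_continuous ip_norm bM cyc (mc_continuous mc) bW nW Wy).
have contV t x : V s x @[s --> t] --> V t x.
  apply/nr_cvgP => e e0; have e20 : 0 < e / 2 by rewrite divr_gt0.
  have /nr_cvgP/(_ _ e20) h1 := contU t x; have /nr_cvgP/(_ _ e20) h2 := contW t (U t x).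
  apply: filterS2 h1 h2 => s h1 h2; rewrite /V /= [e]splitr.
  apply: le_lt_trans (nr_tri (Wu s (U t x)) _ _) _; apply: ltrD => //.
  by rewrite -(bndB (bW s)) nW.
pose alphat := conjugation V.
have alphatE t y : M y -> alphat t y = w t (alpha t y).
  move=> My; apply/funext => x; have com z : V t (y z) = w t (alpha t y) (V t z).
    by rewrite /V /= (cmp_eq (UM t y My)) (cmp_eq (WM t _ (aM t y My))).
  by rewrite /alphat /conjugation [LHS]com VKN.
have alphat_group := conjugation_group ip_norm bV V_adj V0 VD.
have alphat_cont := conjugation_continuous ip_norm bV V_adj V0 VD contV.
have VOm t : V t Om = Om by rewrite /V /= UOm WOm.
have alphat_inv t y : bounded_ops y ->
    expect ip (rank_one ip Om) (alphat t y) = expect ip (rank_one ip Om) y.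
  move=> by_; rewrite !(expect_rank_one ip_norm)//; last exact: bnd_conjugation.
  by rewrite /alphat /conjugation /= VOm (adjoP ip_norm _ _ (bV t)) V_adj VOm.
(* Two versions of the perturbed group coexist: [alphat] on all bounded operators for the noise
   axioms, [beta] as written in the conclusion for the flow. They agree on [M]. *)
pose beta t y := w t (alpha t y).
have beta_group : aut_group ip M beta.
  split=> [t|y My|s t y My]; last exact: pert_add.
    exact: star_iso_comp (ag_aut autM t) (mc_aut mc t).
  by rewrite /beta (ag_id autM)// (mc_id mc).
have alphat_theta t y : M y -> alphat t (theta y) = theta (alpha t y).
  by move=> My; rewrite alphatE ?th_shift//; exact: thM.
have fac : vn_factor ip M by [].
exists (theta @` M), (pushed ip j I), theta; split=> //; split.
  by apply: (theta_star_hom ip_norm vM iw thM) => _ [y My <-]; exact: thM.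
split.
  apply: (intertwiner_normal ip_norm vM iw WinfOm); apply: (total_dense ip_norm).
    split.
      exists (fun=> 0) => //; split; first exact: bM.
      by move=> T MT; apply/funext => x /=; rewrite (bnd0 (bM T MT)).
    move=> a _ _ [z Mz <-] [z' Mz' <-]; exists (fun x => a *: z x + z' x) => //.
    exact: (commutant_lincomb a bM).
  move=> u hu; apply: (commutant_total ip_norm vM sep) => z Mz; apply: hu; by exists z.
split=> //; split; first by move=> _ [y My <-]; exact: thM.
split; first exact: (image_factor ip_norm qn vM ME shM iw thM fac).
split; first exact: (pushed_image ip_norm qn shM iw).
split.
  apply: (image_kolmogorov ip_norm qn vM ME Mall shM autM cD iwU iw thM beta_group th_shift kp).
  by rewrite -factM => T [].
exists alphat, (rank_one ip Om); split=> //.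
- exact: (pushed_quantum_noise ip_norm qn vM shM autM cD iwU iw thM WinfOm EE alphat_group
      alphat_cont alphat_inv alphat_theta).
- by move=> y My; rewrite (expect_rank_one ip_norm) ?EE//; exact: bM.
- exact: (pushed_noise_iso ip_norm qn vM ME shM iw thM WinfOm EE).
Qed.
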